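(* Assume that the coefficients $b,\sigma,f,h$ and the control domain $U$ satisfy (A1) and (A2) of the context, that $h$ is convex, that $h_x$ is continuous, and that the maximized Hamiltonian $\bar H(t,x,p,q)=\max_{u\in U}H(t,x,u,p,q)$ satisfies (A3) of the context. Let $(\tilde x_t,\tilde u_t,\tilde p_t,\tilde q_t)_{0\le t\le T}$ be a solution, for some initial value $\tilde p_0\in\mathbb{R}^n$ and some control process $\tilde q$, of the forward system with maximum condition $$ \begin{cases} \mathrm{d}\tilde x_t=b(t,\tilde x_t,\tilde u_t)\,\mathrm{d}t+\sigma(t,\tilde x_t,\tilde u_t)\,\mathrm{d}W_t,\\ \mathrm{d}\tilde p_t=-H_x(t,\tilde x_t,\tilde u_t,\tilde p_t,\tilde q_t)\,\mathrm{d}t+\tilde q_t\,\mathrm{d}W_t,\\ \tilde x_0=x_0,\qquad \tilde p_t|_{t=0}=\tilde p_0,\\ H(t,\tilde x_t,\tilde u_t,\tilde p_t,\tilde q_t)=\max_{u\in U}H(t,\tilde x_t,u,\tilde p_t,\tilde q_t), \end{cases} $$ where the last line holds for a.e. $t\in[0,T]$, $\mathbb{P}$-a.s. Assume that, almost surely, for all $t\in[0,T]$ the map $(x,u)\mapsto H(t,x,u,\tilde p_t,\tilde q_t)$ is concave. If $$\mathbb{E}\big[\,|-h_x(\tilde x_T)-\tilde p_T|^2\,\big]=0,$$ then $(\tilde x_t,\tilde u_t,\tilde p_t,\tilde q_t)_{0\le t\le T}$ is a solution $(x^*,u^*,p^*,q^* )$ of the extended stochastic Hamiltonian system $$ \begin{cases}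 \mathrm{d}x^*_t=b(t,x^*_t,u^*_t)\,\mathrm{d}t+\sigma(t,x^*_t,u^*_t)\,\mathrm{d}W_t,\\ \mathrm{d}p^*_t=-H_x(t,x^*_t,u^*_t,p^*_t,q^*_t)\,\mathrm{d}t+q^*_t\,\mathrm{d}W_t,\qquad t\in[0,T],\\ x^*_0=x_0,\qquad p^*_T=-h_x(x^*_T),\\ H(t,x^*_t,u^*_t,p^*_t,q^*_t)=\max_{u\in U}H(t,x^*_t,u,p^*_t,q^*_t)\quad\text{a.e. }t\in[0,T],\ \mathbb{P}\text{-a.s.}, \end{cases} $$ and the optimal cost is attained by $\tilde u$: $$\inf_{u(\cdot)\in\mathcal{U}_{ad}[0,T]}J(u(\cdot))=J(\tilde u(\cdot))=\mathbb{E}\Big\{\int_0^T f(t,\tilde x_t,\tilde u_t)\,\mathrm{d}t+h(\tilde x_T)\Big\}.$$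
   Context: Setting. $T>0$; $(\Omega,\mathcal{F},\mathbb{P})$ is a complete probability space carrying a $d$-dimensional standard Brownian motion $W$; $\mathbb{F}=\{\mathcal{F}_t\}_{0\le t\le T}$ is the natural filtration generated by $W$, with $\mathcal{F}_0$ containing all $\mathbb{P}$-null sets of $\mathcal{F}$, and $\mathbb{F}$ right-continuous. $L^2_{\mathcal{F}}(0,T;\mathbb{R}^m)$ denotes the $\mathbb{F}$-adapted $\mathbb{R}^m$-valued processes $y$ with $\mathbb{E}\int_0^T|y_t|^2\,\mathrm{d}t<\infty$. $U\subset\mathbb{R}^k$ is the control domain and $\mathcal{U}_{ad}[0,T]$ is the set of $U$-valued processes $u\in L^2_{\mathcal{F}}(0,T;\mathbb{R}^k)$ (admissible controls). The (deterministic) coefficients are $b:[0,T]\times\mathbb{R}^n\times U\to\mathbb{R}^n$, $\sigma:[0,T]\times\mathbb{R}^n\times U\to\mathbb{R}^{n\times d}$, $f:[0,T]\times\mathbb{R}^n\times U\to\mathbb{R}$, $h:\mathbb{R}^n\to\mathbb{R}$, and $x_0\in\mathbb{R}^n$ is fixed. Control problem. For $u\in\mathcal{U}_{ad}[0,T]$, let $x$ solve $\mathrm{d}x_t=b(t,x_t,u_t)\,\mathrm{d}t+\sigma(t,x_t,u_t)\,\mathrm{d}W_t$ with initial value $x_0$, and put $J(u(\cdot))=\mathbb{E}\{\int_0^Tf(t,x_t,u_t)\,\mathrm{d}t+h(x_T)\}$. The control problem is to minimize $J$ over $\mathcal{U}_{ad}[0,T]$. Hamiltonian. For $(t,x,u,p,q)\in[0,T]\times\mathbb{R}^n\times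 U\times\mathbb{R}^n\times\mathbb{R}^{n\times d}$, $$H(t,x,u,p,q)=\langle p,b(t,x,u)\rangle+\mathrm{tr}[q^{\mathrm T}\sigma(t,x,u)]-f(t,x,u),$$ and $\bar H(t,x,p,q)=\max_{u\in U}H(t,x,u,p,q)$ (the maximum is assumed to exist). Subscripts $x,p,q$ denote partial derivatives in those variables. Solutions. A solution $(x,u,p,q)$ of either system in the claim consists of $\mathbb{F}$-adapted processes with $u\in\mathcal{U}_{ad}[0,T]$, $x,p\in L^2_{\mathcal{F}}(0,T;\mathbb{R}^n)$, $q\in L^2_{\mathcal{F}}(0,T;\mathbb{R}^{n\times d})$ satisfying the stated equations. (A1) (i) $b,\sigma,f,h$ are measurable and there are a constant $L>0$ and a modulus of continuity $\bar\omega:[0,\infty)\to[0,\infty)$ such that for $\varphi=b,\sigma,f,h$: $|\varphi(t,x,u)-\varphi(t,\hat x,\hat u)|\le L|x-\hat x|+\bar\omega(\|u-\hat u\|)$ for all $t\in[0,T]$, $x,\hat x\in\mathbb{R}^n$, $u,\hat u\in U$, and $|\varphi(t,0,u)|\le L$ for all $t\in[0,T]$, $u\in U$. (ii) $b,\sigma,f,h$ are $C^2$ in $x$, and there are a constant $L>0$ and a modulus of continuity $\bar\omega$ such that for $\varphi=b,\sigma,f,h$: $|\varphi_x(t,x,u)-\varphi_x(t,\hat x,\hat u)|\le L|x-\hat x|+\bar\omega(\|u-\hat u\|)$ and $|\varphi_{xx}(t,x,u)-\varphi_{xx}(t,\hat x,\hat u)|\le\bar\omega(|x-\hat x|+\|u-\hat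 u\|)$ for all $t\in[0,T]$, $x,\hat x\in\mathbb{R}^n$, $u,\hat u\in U$. (For $h$, which depends on $x$ only, the arguments $t,u$ are ignored.) (A2) $U$ is a convex body in $\mathbb{R}^k$ (a convex set with nonempty interior); $b,\sigma,f$ are locally Lipschitz in $u$, and their derivatives in $x$ are continuous in $(x,u)$. (A3) $\bar H$ is differentiable in $x,p,q$ with derivatives continuous in $x,p,q$, and there is a constant $C>0$ such that for $\varphi=\bar H_x,\bar H_p,\bar H_q$, all $t\in[0,T]$, $x,x',p,p'\in\mathbb{R}^n$, $q,q'\in\mathbb{R}^{n\times d}$: $|\varphi(t,x,p,q)-\varphi(t,x',p',q')|\le C(|x-x'|+|p-p'|+|q-q'|)$, $|\varphi(t,0,0,0)|\le C$, and $|\bar H_q(t,x,p,0)|\le C$. *)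

(* Defs.v *)
From HB Require Import structures.
From mathcomp Require Import all_boot all_order all_algebra.
From mathcomp Require Import all_classical all_reals all_analysis.

Set Implicit Arguments.
Unset Strict Implicit.
Unset Printing Implicit Defensive.

Import Order.TTheory GRing.Theory Num.Theory.
Import numFieldNormedType.Exports.

Local Open Scope classical_set_scope.
Local Open Scope ring_scope.

(* Vectors of R^m are columns 'cV[R]_m, and scalar coefficients are seen as
   1 x 1 matrices when the assumptions are stated uniformly.  The ambient norm
   `|A| on matrices is the sup norm, so the Euclidean norm is spelled out; the
   topology is the same. *)

Section calculus.
Context {R : realType}.

Definition fnorm (r c : nat) (A : 'M[R]_(r, c)) : R :=
  Num.sqrt (\sum_i \sum_j A i j ^+ 2).

Definition dot (m : nat) (x y : 'cV[R]_m) : R := (x^T *m y) 0 0.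

(* The Riesz representative of the derivative for <A, B> = tr (A^T B). *)
Definition grad (r c : nat) (g : 'M[R]_(r, c) -> R) (A : 'M[R]_(r, c)) :
    'M[R]_(r, c) :=
  \matrix_(i, j) 'D_(delta_mx i j) g A.

Definition dx (n r c : nat) (g : 'cV[R]_n -> 'M[R]_(r, c)) (i : 'I_n)
    (x : 'cV[R]_n) : 'M[R]_(r, c) :=
  'D_(delta_mx i 0) g x.

Definition C2 (n r c : nat) (g : 'cV[R]_n -> 'M[R]_(r, c)) : Prop :=
  [/\ forall x, differentiable g x,
      forall i x, differentiable (dx g i) x &
      forall i j, continuous (dx (dx g i) j)].

Definition modulus (om : R -> R) : Prop :=
  [/\ om 0 = 0,
      forall r, 0 <= r -> 0 <= om r,
      forall r s, 0 <= r -> r <= s -> om r <= om s &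
      om r @[r --> 0^'+] --> 0].

Definition borel (X : topologicalType) : set (set X) := <<s (@open X) >>.

(* D need not be Borel: measurability is for the trace sigma-algebra on D. *)
Definition borel_on (X Y : topologicalType) (D : set X) (g : X -> Y) : Prop :=
  forall B, borel B ->
    exists2 Z, borel Z & D `&` g @^-1` B = D `&` Z.

End calculus.

Section processes.
Context {R : realType} {disp : measure_display} {Omega : measurableType disp}.
Variables (P : probability Omega R) (T : R).

Definition process (r c : nat) : Type := R -> Omega -> 'M[R]_(r, c).

Definition past (d : nat) (W : process d 1) (t : R) : set (set Omega) :=
  [set A | exists s B, [/\ 0 <= s <= t, borel B & A = W s @^-1` B]].

(* The product formula says at once that W_t - W_s is independent of
   (W_r)_(r <= s) and has law N(0, (t - s) I_d); the second parameter of
   normal_prob is the standard deviation. *)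
Definition brownian_motion (d : nat) (W : process d 1) : Prop :=
  [/\ forall t B, 0 <= t <= T -> borel B -> measurable (W t @^-1` B),
      {ae P, forall w, W 0 w = 0},
      {ae P, forall w, {within `[0, T], continuous (fun t => W t w)}} &
      forall (s t : R) (A : set Omega) (B : 'I_d -> set R),
        0 <= s -> s < t -> t <= T -> <<s past W s >> A ->
        (forall i, measurable (B i)) ->
        P (A `&` [set w | forall i, B i (W t w i 0 - W s w i 0)]) =
        (P A * \prod_(i < d) normal_prob 0 (Num.sqrt (t - s)%R) (B i))%E].

Definition filtration (d : nat) (W : process d 1) (t : R) : set (set Omega) :=
  <<s past W t `|` P.-negligible >>.

Definition right_continuous_filtration (F : R -> set (set Omega)) : Prop :=
  forall t, 0 <= t < T -> F t = \bigcap_(s in `]t, T]) F s.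

Section with_brownian_motion.
Variables (d : nat) (W : process d 1).
Local Notation F := (filtration W).
Local Notation mu := (@lebesgue_measure R).

Definition adapted (r c : nat) (y : process r c) : Prop :=
  forall t B, 0 <= t <= T -> borel B -> F t (y t @^-1` B).

Definition jointly_measurable (r c : nat) (y : process r c) : Prop :=
  forall B, borel B ->
    measurable ((`[0, T] `*` [set: Omega]) `&`
                [set z : R * Omega | B (y z.1 z.2)]).

Definition L2F (r c : nat) (y : process r c) : Prop :=
  [/\ adapted y, jointly_measurable y &
      (\int[P]_w \int[mu]_(t in `[0%R, T]) (fnorm (y t w) ^+ 2)%:E < +oo)%E].

(* The step process equal to sp_coef j on ]sp_time j, sp_time j.+1],
   for j < sp_size. *)
Record step_process (r : nat) := StepProcess {
  sp_size : nat;
  sp_time : nat -> R;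
  sp_coef : nat -> Omega -> 'M[R]_(r, d) }.

Definition step_adapted (r : nat) (S : step_process r) : Prop :=
  forall j, (j < sp_size S)%N ->
    [/\ 0 <= sp_time S j, sp_time S j <= sp_time S j.+1, sp_time S j.+1 <= T,
        forall B, borel B -> F (sp_time S j) (sp_coef S j @^-1` B) &
        exists M, forall w, fnorm (sp_coef S j w) <= M].

Definition step_val (r : nat) (S : step_process r) : process r d :=
  fun t w => \sum_(j < sp_size S)
    \1_(`]sp_time S j, sp_time S j.+1]) t *: sp_coef S j w.

Definition step_integral (r : nat) (S : step_process r) : process r 1 :=
  fun t w => \sum_(j < sp_size S)
    sp_coef S j w *m (W (Num.min (sp_time S j.+1) t) w -
                      W (Num.min (sp_time S j) t) w).

(* I is (a continuous version of) the Ito integral of q against W. *)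
Definition ito_integral (r : nat) (q : process r d) (I : process r 1) : Prop :=
  [/\ L2F q, adapted I,
      {ae P, forall w, {within `[0, T], continuous (fun t => I t w)}} &
      exists S : nat -> step_process r,
        [/\ forall N, step_adapted (S N),
            (\int[P]_w \int[mu]_(t in `[0%R, T])
               (fnorm (step_val (S N) t w - q t w) ^+ 2)%:E)%E
              @[N --> \oo] --> 0%E &
            forall t, 0 <= t <= T ->
              (\int[P]_w (fnorm (step_integral (S N) t w - I t w) ^+ 2)%:E)%E
                @[N --> \oo] --> 0%E]].

(* dX_t = a_t dt + q_t dW_t on [0, T], as an integral equation. *)
Definition ito_equation (r : nat) (X a : process r 1) (q : process r d) :
    Prop :=
  {ae P, forall w, forall i,
     mu.-integrable `[0, T] (fun t => (a t w i 0)%:E)} /\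
  exists2 I : process r 1, ito_integral q I &
    {ae P, forall w, forall t, 0 <= t <= T ->
       X t w = X 0 w + (\col_i \int[mu]_(s in `[0, t]) a s w i 0) + I t w}.

End with_brownian_motion.
End processes.

Section control.
Context {R : realType} {n d k : nat}.
Variables (T : R) (U : set 'cV[R]_k).
Variables (b : R -> 'cV[R]_n -> 'cV[R]_k -> 'cV[R]_n)
          (sigma : R -> 'cV[R]_n -> 'cV[R]_k -> 'M[R]_(n, d))
          (f : R -> 'cV[R]_n -> 'cV[R]_k -> R)
          (h : 'cV[R]_n -> R).

Definition coef (r c : nat) : Type :=
  R -> 'cV[R]_n -> 'cV[R]_k -> 'M[R]_(r, c).

Definition scalar_coef (g : R -> 'cV[R]_n -> 'cV[R]_k -> R) : coef 1 1 :=
  fun t x u => (g t x u)%:M.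

Local Notation f1 := (scalar_coef f).
Local Notation h1 := (scalar_coef (fun _ x _ => h x)).

Definition coef_measurable (r c : nat) (phi : coef r c) : Prop :=
  borel_on (`[0, T] `*` [set: 'cV[R]_n] `*` U)
    (fun z : R * 'cV[R]_n * 'cV[R]_k => phi z.1.1 z.1.2 z.2).

Definition coef_lipschitz (L : R) (om : R -> R) (r c : nat) (phi : coef r c) :
    Prop :=
  forall t, 0 <= t <= T ->
    (forall x x' u u', U u -> U u' ->
       fnorm (phi t x u - phi t x' u') <=
         L * fnorm (x - x') + om (fnorm (u - u'))) /\
    (forall u, U u -> fnorm (phi t 0 u) <= L).

Definition coef_C2 (L : R) (om : R -> R) (r c : nat) (phi : coef r c) : Prop :=
  forall t, 0 <= t <= T ->
    [/\ forall u, U u -> C2 (phi t ^~ u),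
        forall x x' u u', U u -> U u' ->
          Num.sqrt (\sum_i
            fnorm (dx (phi t ^~ u) i x - dx (phi t ^~ u') i x') ^+ 2) <=
          L * fnorm (x - x') + om (fnorm (u - u')) &
        forall x x' u u', U u -> U u' ->
          Num.sqrt (\sum_i \sum_j
            fnorm (dx (dx (phi t ^~ u) i) j x -
                   dx (dx (phi t ^~ u') i) j x') ^+ 2) <=
          om (fnorm (x - x') + fnorm (u - u'))].

Definition A1 : Prop :=
  [/\ [/\ coef_measurable b, coef_measurable sigma, coef_measurable f1 &
          borel_on [set: 'cV[R]_n] h],
      exists L om, [/\ 0 < L, modulus om &
        [/\ coef_lipschitz L om b, coef_lipschitz L om sigma,
            coef_lipschitz L om f1 & coef_lipschitz L om h1]] &
      exists L om, [/\ 0 < L, modulus om &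
        [/\ coef_C2 L om b, coef_C2 L om sigma,
            coef_C2 L om f1 & coef_C2 L om h1]]].

Definition locally_lipschitz_u (r c : nat) (phi : coef r c) : Prop :=
  forall t x u0, 0 <= t <= T -> U u0 ->
    exists K e, 0 < e /\
      forall u u', U u -> U u' -> fnorm (u - u0) < e -> fnorm (u' - u0) < e ->
        fnorm (phi t x u - phi t x u') <= K * fnorm (u - u').

Definition dx_continuous (r c : nat) (phi : coef r c) : Prop :=
  forall t i, 0 <= t <= T ->
    {within [set: 'cV[R]_n] `*` U, continuous
      (fun z : 'cV[R]_n * 'cV[R]_k => dx (phi t ^~ z.2) i z.1)}.

Definition A2 : Prop :=
  [/\ convex_set U /\ interior U !=set0,
      [/\ locally_lipschitz_u b, locally_lipschitz_u sigma &
          locally_lipschitz_u f1] &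
      [/\ dx_continuous b, dx_continuous sigma & dx_continuous f1]].

Definition ham (t : R) (x : 'cV[R]_n) (u : 'cV[R]_k) (p : 'cV[R]_n)
    (q : 'M[R]_(n, d)) : R :=
  dot p (b t x u) + \tr (q^T *m sigma t x u) - f t x u.

Definition ham_x t x u p q : 'cV[R]_n := grad (fun y => ham t y u p q) x.

(* A maximum under [max_exists]. *)
Definition hbar (t : R) (x p : 'cV[R]_n) (q : 'M[R]_(n, d)) : R :=
  sup [set ham t x u p q | u in U].

Definition max_exists : Prop :=
  forall t x p q, 0 <= t <= T ->
    exists2 u, U u & forall v, U v -> ham t x v p q <= ham t x u p q.

Definition hbar_x t x p q : 'cV[R]_n := grad (fun y => hbar t y p q) x.
Definition hbar_p t x p q : 'cV[R]_n := grad (fun y => hbar t x y q) p.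
Definition hbar_q t x p q : 'M[R]_(n, d) := grad (fun y => hbar t x p y) q.

Definition hbar_bound (C : R) (r c : nat)
    (phi : R -> 'cV[R]_n -> 'cV[R]_n -> 'M[R]_(n, d) -> 'M[R]_(r, c)) : Prop :=
  forall t, 0 <= t <= T ->
    (forall x x' p p' q q',
       fnorm (phi t x p q - phi t x' p' q') <=
         C * (fnorm (x - x') + fnorm (p - p') + fnorm (q - q'))) /\
    fnorm (phi t 0 0 0) <= C.

Definition A3 : Prop :=
  (forall t, 0 <= t <= T ->
     [/\ forall z : 'cV[R]_n * 'cV[R]_n * 'M[R]_(n, d),
           differentiable (fun z : 'cV[R]_n * 'cV[R]_n * 'M[R]_(n, d) =>
                             hbar t z.1.1 z.1.2 z.2) z,
         continuous (fun z : 'cV[R]_n * 'cV[R]_n * 'M[R]_(n, d) =>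
                       hbar_x t z.1.1 z.1.2 z.2),
         continuous (fun z : 'cV[R]_n * 'cV[R]_n * 'M[R]_(n, d) =>
                       hbar_p t z.1.1 z.1.2 z.2) &
         continuous (fun z : 'cV[R]_n * 'cV[R]_n * 'M[R]_(n, d) =>
                       hbar_q t z.1.1 z.1.2 z.2)]) /\
  exists C, [/\ 0 < C,
    [/\ hbar_bound C hbar_x, hbar_bound C hbar_p & hbar_bound C hbar_q] &
    forall t x p, 0 <= t <= T -> fnorm (hbar_q t x p 0) <= C].

Section dynamics.
Context {disp : measure_display} {Omega : measurableType disp}.
Variables (P : probability Omega R) (W : process (R := R) (Omega := Omega) d 1).
Variable x0 : 'cV[R]_n.

Local Notation proc := (@process R disp Omega).

Definition admissible (u : proc k 1) : Prop :=
  (forall t w, 0 <= t <= T -> U (u t w)) /\ L2F P T W u.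

Definition state (u : proc k 1) (x : proc n 1) : Prop :=
  [/\ L2F P T W x, {ae P, forall w, x 0 w = x0} &
      ito_equation P T W x (fun t w => b t (x t w) (u t w))
                           (fun t w => sigma t (x t w) (u t w))].

Definition cost (u : proc k 1) (x : proc n 1) : \bar R :=
  (\int[P]_w (\int[lebesgue_measure]_(t in `[0%R, T])
                 (f t (x t w) (u t w))%:E + (h (x T w))%:E))%E.

(* c = J(u).  A relation rather than a function, since J(u) is defined through
   the solution x of the state equation (existing and unique under A1). *)
Definition cost_of (u : proc k 1) (c : \bar R) : Prop :=
  exists2 x, state u x & c = cost u x.

Definition optimal_cost : \bar R :=
  ereal_inf [set c | exists2 u, admissible u & cost_of u c].

(* The dynamics of (x, p), the initial value of x and the maximum condition,
   common to the two systems below. *)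
Definition hamiltonian_dynamics (x : proc n 1) (u : proc k 1) (p : proc n 1)
    (q : proc n d) : Prop :=
  [/\ admissible u, state u x, L2F P T W p /\ L2F P T W q,
      ito_equation P T W p
        (fun t w => - ham_x t (x t w) (u t w) (p t w) (q t w)) q &
      {ae lebesgue_measure, forall t : R, 0 <= t <= T ->
        {ae P, forall w, ham t (x t w) (u t w) (p t w) (q t w) =
                         hbar t (x t w) (p t w) (q t w)}}].

Definition forward_system (p0 : 'cV[R]_n) (x : proc n 1) (u : proc k 1)
    (p : proc n 1) (q : proc n d) : Prop :=
  hamiltonian_dynamics x u p q /\ {ae P, forall w, p 0 w = p0}.

Definition extended_hamiltonian_system (x : proc n 1) (u : proc k 1)
    (p : proc n 1) (q : proc n d) : Prop :=
  hamiltonian_dynamics x u p q /\ {ae P, forall w, p T w = - grad h (x T w)}.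

End dynamics.
End control.

(* Main.v *)
(* Let v be an admissible control with state y.  The product rule gives
   E<p_T, y_T - x_T> as the integral over [0, T] x Omega of
   - <H_x, y - x> + <p, b(y, v) - b(x, u)> + tr(q^T (sigma(y, v) - sigma(x, u))),
   which equals f(y, v) - f(x, u) + H(y, v) - H(x, u) - <H_x, y - x>.  Concavity
   of H in (x, u) and maximality of u make the last three terms nonpositive.
   Since p_T = - h_x(x_T), convexity of h gives
   h(x_T) - h(y_T) <= <p_T, y_T - x_T>, and adding up yields J(u) <= J(v).

   Only the expectation of the product rule is needed, so Ito's formula is
   avoided: after integration by parts for the drifts, the mixed terms are
   handled by Fubini and the martingale property, and the product of the two
   martingale parts by the Ito isometry. *)

Require Import Defs.
From HB Require Import structures.
From mathcomp Require Import all_boot all_order all_algebra.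
From mathcomp Require Import all_classical all_reals all_analysis.
From mathcomp Require Import measurable_realfun ring lra.

Set Implicit Arguments.
Unset Strict Implicit.
Unset Printing Implicit Defensive.

Import Order.TTheory GRing.Theory Num.Theory.
Import numFieldNormedType.Exports.

Local Open Scope classical_set_scope.
Local Open Scope ring_scope.

(** * Square-integrable functions *)

(** An Ito integral in the sense of [ito_integral] comes without joint measurability in (t, w). Time
    integrals against the noise are therefore written with the state minus its initial value and its
    drift, which is jointly measurable and equals the noise almost surely at each fixed time. The
    covariances behind the isometry must be drawn from a product formula for events: events of F_s
    are exchanged with raw past events modulo null sets, Gaussian moments are computed, and
    indicators are replaced by random variables through an orthogonality argument instead of
    conditional expectations. The maximum condition holds for almost every t and then almost surely,
    with a null set depending on t, so the comparison of Hamiltonians integrates over Omega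
    first. *)

Section square_integrable.
Context d (X : measurableType d) (R : realType).
Implicit Types (m : {measure set X -> \bar R}) (f g : X -> R).

Definition L1 m f := m.-integrable setT (EFin \o f).
Definition L2 m f := measurable_fun setT f /\ L1 m (fun x => f x ^+ 2).

Lemma L1_measurable m f : L1 m f -> measurable_fun setT f.
Proof. by move=> /measurable_int/measurable_EFinP. Qed.

Lemma L1_le m f g : measurable_fun setT f -> (forall x, `|f x| <= g x) ->
  L1 m g -> L1 m f.
Proof.
move=> mf fg; apply: le_integrable => //; first exact/measurable_EFinP.
by move=> x _ /=; rewrite lee_fin (le_trans (fg x))// ler_norm.
Qed.

Lemma L1D m f g : L1 m f -> L1 m g -> L1 m (fun x => f x + g x).
Proof.
move=> hf hg; have := @integrableD _ _ _ m setT measurableT _ _ hf hg.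
by apply: eq_integrable.
Qed.

Lemma L1Zl m a f : L1 m f -> L1 m (fun x => a * f x).
Proof.
move=> hf; have := @integrableZl _ _ _ m setT measurableT a _ hf.
by apply: eq_integrable.
Qed.

Lemma L1N m f : L1 m f -> L1 m (fun x => - f x).
Proof.
by move=> /(@L1Zl _ (-1)); apply: eq_integrable => // x _ /=; rewrite mulN1r.
Qed.

Lemma L1B m f g : L1 m f -> L1 m g -> L1 m (fun x => f x - g x).
Proof. by move=> hf hg; apply: L1D => //; exact: L1N. Qed.

Lemma L1_sum m I (s : seq I) (p : pred I) (F : I -> X -> R) :
  (forall i, p i -> L1 m (F i)) -> L1 m (fun x => \sum_(i <- s | p i) F i x).
Proof.
move=> h; have := @integrable_sum _ _ _ m setT measurableT I s p
  (fun i => EFin \o F i) h.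
by apply: eq_integrable => // x _ /=; rewrite sumEFin.
Qed.

Lemma Rint_sum m I (s : seq I) (p : pred I) (F : I -> X -> R) :
  (forall i, p i -> L1 m (F i)) ->
  \int[m]_x (\sum_(i <- s | p i) F i x) = \sum_(i <- s | p i) \int[m]_x F i x.
Proof.
move=> h; elim: s => [|i s ih].
  under eq_Rintegral do rewrite big_nil.
  by rewrite big_nil /Rintegral integral0.
rewrite big_cons; under eq_Rintegral do rewrite big_cons.
case: ifPn => pi; last exact: ih.
rewrite RintegralD//; [by rewrite ih|exact: h|exact: L1_sum].
Qed.

Lemma ae_Rint m f g : measurable_fun setT f -> measurable_fun setT g ->
  {ae m, forall x, f x = g x} -> \int[m]_x f x = \int[m]_x g x.
Proof.
move=> mf mg fg; congr fine; apply: ae_eq_integral => //.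
- exact/measurable_EFinP.
- exact/measurable_EFinP.
- by apply: filterS fg => x /= -> _.
Qed.

Lemma L1_ae m f g : measurable_fun setT g ->
  {ae m, forall x, f x = g x} -> L1 m f -> L1 m g.
Proof.
move=> mg fg /integrableP[mf hf]; apply/integrableP; split.
  exact/measurable_EFinP.
rewrite (@ae_eq_integral _ _ _ m setT (abse \o (EFin \o f)) (abse \o (EFin \o g)))//.
- by apply: measurableT_comp => //; exact/measurable_EFinP.
- exact: measurableT_comp.
- by apply: filterS fg => x /= -> _.
Qed.

Lemma RintD m f g : L1 m f -> L1 m g ->
  \int[m]_x (f x + g x) = \int[m]_x f x + \int[m]_x g x.
Proof. exact: RintegralD. Qed.

Lemma RintB m f g : L1 m f -> L1 m g ->
  \int[m]_x (f x - g x) = \int[m]_x f x - \int[m]_x g x.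
Proof. exact: RintegralB. Qed.

Lemma RintZl m a f : L1 m f -> \int[m]_x (a * f x) = a * \int[m]_x f x.
Proof. exact: RintegralZl. Qed.

Lemma RintN m f : L1 m f -> \int[m]_x (- f x) = - \int[m]_x f x.
Proof.
move=> hf; rewrite -mulN1r -RintZl//.
by under [RHS]eq_Rintegral do rewrite mulN1r.
Qed.

Lemma Rint_ge0 m f : (forall x, 0 <= f x) -> 0 <= \int[m]_x f x.
Proof. by move=> h; exact: Rintegral_ge0. Qed.

Lemma L2_measurable m f : L2 m f -> measurable_fun setT f.
Proof. by case. Qed.

Lemma L2_le m f g : measurable_fun setT f -> (forall x, f x ^+ 2 <= g x) ->
  L1 m g -> L2 m f.
Proof.
move=> mf fg hg; split => //; apply: L1_le hg; first exact: measurable_funX.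
by move=> x; rewrite ger0_norm ?sqr_ge0.
Qed.

Lemma L2D m f g : L2 m f -> L2 m g -> L2 m (fun x => f x + g x).
Proof.
move=> [mf hf] [mg hg]; apply: (@L2_le _ _ (fun x => 2 * f x ^+2 + 2 * g x ^+2)).
- exact: measurable_funD.
- by move=> x; have := sqr_ge0 (f x - g x); nra.
- by apply: L1D; exact: L1Zl.
Qed.

Lemma L2N m f : L2 m f -> L2 m (fun x => - f x).
Proof.
move=> [mf hf]; split; first exact: measurableT_comp.
by apply: eq_integrable hf => // x _ /=; rewrite sqrrN.
Qed.

Lemma L2B m f g : L2 m f -> L2 m g -> L2 m (fun x => f x - g x).
Proof. by move=> hf hg; apply: L2D => //; exact: L2N. Qed.

Lemma L2_0 m : L2 m (fun=> 0).
Proof.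
split => //; apply: eq_integrable (integrable0 _ _) => // x _ /=.
by rewrite expr0n.
Qed.

Lemma L2_sum m I (s : seq I) (p : pred I) (F : I -> X -> R) :
  (forall i, p i -> L2 m (F i)) -> L2 m (fun x => \sum_(i <- s | p i) F i x).
Proof.
move=> h; elim: s => [|i s ih].
  by under eq_fun do rewrite big_nil; exact: L2_0.
under eq_fun do rewrite big_cons; case pi: (p i) => //.
by apply: L2D => //; exact: h.
Qed.

Lemma L2M m f g : L2 m f -> L2 m g -> L1 m (fun x => f x * g x).
Proof.
move=> [mf hf] [mg hg].
apply: (@L1_le _ _ (fun x => f x ^+ 2 + g x ^+ 2)).
- exact: measurable_funM.
- move=> x; rewrite ler_norml.
  have := sqr_ge0 (f x - g x); have := sqr_ge0 (f x + g x); nra.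
- exact: L1D.
Qed.

Lemma L2Mb m f g M : L2 m f -> measurable_fun setT g ->
  (forall x, `|g x| <= M) -> L2 m (fun x => f x * g x).
Proof.
move=> [mf hf] mg gM; apply: (@L2_le _ _ (fun x => M ^+ 2 * f x ^+2)).
- exact: measurable_funM.
- move=> x; rewrite exprMn mulrC ler_wpM2r ?sqr_ge0//.
  by rewrite -real_normK ?num_real// lerXn2r// nnegrE (le_trans _ (gM x)).
- exact: L1Zl.
Qed.

Lemma L2_ae m f g : measurable_fun setT g ->
  {ae m, forall x, f x = g x} -> L2 m f -> L2 m g.
Proof.
move=> mg fg [mf hf]; split => //.
apply: (@L1_ae _ (fun x => f x ^+ 2)) hf; first exact: measurable_funX.
by apply: filterS fg => x /= ->.
Qed.

Lemma cauchy_schwarz m f g : L2 m f -> L2 m g ->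
  `|\int[m]_x (f x * g x)| <=
    Num.sqrt (\int[m]_x (f x ^+ 2)) * Num.sqrt (\int[m]_x (g x ^+ 2)).
Proof.
move=> hf hg; set A := \int[m]_x (f x ^+ 2); set C := \int[m]_x (g x ^+ 2).
set B := \int[m]_x _.
have A0 : 0 <= A by apply: Rint_ge0 => x; exact: sqr_ge0.
have C0 : 0 <= C by apply: Rint_ge0 => x; exact: sqr_ge0.
(* The quadratic is the integral of (f - t g)^2; the claim is the sign of its discriminant, with the
   degenerate case C = 0 apart. *)
have key t : 0 <= A - 2 * t * B + t ^+ 2 * C.
  have -> : A - 2 * t * B + t ^+ 2 * C = \int[m]_x ((f x - t * g x) ^+ 2).
    rewrite (_ : \int[m]_x ((f x - t * g x) ^+ 2) = \int[m]_x
      (f x ^+ 2 + (- 2 * t) * (f x * g x) + t ^+ 2 * g x ^+ 2)); last first.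
      by apply: eq_Rintegral => x _; ring.
    have i1 : L1 m (fun x => (- 2 * t) * (f x * g x)).
      by apply: L1Zl; exact: L2M.
    rewrite RintD; last 2 first.
    - by apply: L1D => //; exact: hf.2.
    - by apply: L1Zl; exact: hg.2.
    rewrite RintD; [|exact: hf.2|by []].
    by rewrite !RintZl//; [rewrite /A /B /C; ring|exact: hg.2|exact: L2M].
  by apply: Rint_ge0 => x; exact: sqr_ge0.
have BAC : B ^+ 2 <= A * C.
  have [C1|C1] := eqVneq C 0.
    rewrite C1 mulr0; have [B1|B1] := eqVneq B 0; first by rewrite B1 expr0n.
    (* For C = 0 the polynomial is affine in t; this t, the root of A - 2 t B = -1, contradicts its
       sign. *)
    have := key ((A + 1) / (2 * B)).
    have -> : A - 2 * ((A + 1) / (2 * B)) * B + ((A + 1) / (2 * B)) ^+ 2 * C = -1.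
      by rewrite C1; field.
    by rewrite oppr_ge0 ler10.
  (* t = B / C minimizes the quadratic. *)
  have := key (B / C); have Cp : 0 < C by rewrite lt0r C1.
  have -> : A - 2 * (B / C) * B + (B / C) ^+ 2 * C = (A * C - B ^+ 2) / C.
    by field.
  by rewrite pmulr_lge0 ?invr_gt0// subr_ge0.
by rewrite -sqrtrM// -sqrtr_sqr ler_wsqrtr.
Qed.

(** [Rintegral] sends an infinite integral to 0, so this is L2 convergence only together with
    membership of the functions in [L2]. *)
Definition cvgL2 m (F : nat -> X -> R) f :=
  \int[m]_x ((F n x - f x) ^+ 2) @[n --> \oo] --> (0 : R).

Lemma cvgL2_mulr m F f g : (forall n, L2 m (F n)) -> L2 m f -> L2 m g ->
  cvgL2 m F f ->
  \int[m]_x (F n x * g x) @[n --> \oo] --> \int[m]_x (f x * g x).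
Proof.
move=> hF hf hg Ff.
apply/subr_cvg0/norm_cvg0P.
have h0 : Num.sqrt (\int[m]_x ((F n x - f x) ^+ 2)) *
    Num.sqrt (\int[m]_x (g x ^+ 2)) @[n --> \oo] --> (0 : R).
  rewrite -(mul0r (Num.sqrt (\int[m]_x (g x ^+ 2)))); apply: cvgMl.
  by rewrite -sqrtr0; apply: (cvg_comp _ Num.sqrt Ff); exact: sqrt_continuous.
apply: (squeeze_cvgr _ (cvg_cst 0) h0).
apply: nearW => n; rewrite normr_ge0/=.
apply: le_trans (cauchy_schwarz _ hg); last exact: L2B.
rewrite -RintB; [|exact: L2M|exact: L2M].
by under [in leRHS]eq_Rintegral do rewrite mulrBl.
Qed.

Lemma cvgL2_mul m F f G g : (forall n, L2 m (F n)) -> L2 m f ->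
  (forall n, L2 m (G n)) -> L2 m g -> cvgL2 m F f -> cvgL2 m G g ->
  \int[m]_x (F n x * G n x) @[n --> \oo] --> \int[m]_x (f x * g x).
Proof.
move=> hF hf hG hg Ff Gg.
(* F_n G_n = (F_n - f)(G_n - g) + F_n g + (G_n f - g f): the first term goes by Cauchy-Schwarz, the
   others have one fixed factor. *)
have -> : (fun n => \int[m]_x (F n x * G n x)) =
  (fun n => \int[m]_x ((F n x - f x) * (G n x - g x)) +
     (\int[m]_x (F n x * g x)) + (\int[m]_x (G n x * f x) -
   \int[m]_x (g x * f x))).
  apply/funext => n; rewrite -RintB; [|exact: L2M|exact: L2M].
  have i1 : L1 m (fun x => (F n x - f x) * (G n x - g x)).
    by apply: L2M; exact: L2B.
  rewrite -RintD//; last exact: L2M.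
  rewrite -RintD; last 2 first.
  - by apply: L1D => //; exact: L2M.
  - by apply: L1B; apply: L2M.
  by apply: eq_Rintegral => x _; ring.
rewrite -[\int[m]_x (f x * g x)]add0r -[0 + \int[m]_x (f x * g x)]addr0.
apply: cvgD; last first.
  rewrite -(subrr (\int[m]_x (g x * f x))); apply: cvgB; last exact: cvg_cst.
  exact: cvgL2_mulr.
apply: cvgD; last exact: cvgL2_mulr.
apply/norm_cvg0P.
have h0 : Num.sqrt (\int[m]_x ((F n x - f x) ^+ 2)) *
    Num.sqrt (\int[m]_x ((G n x - g x) ^+ 2)) @[n --> \oo] --> (0 : R).
  rewrite -(mul0r 0) -sqrtr0; apply: cvgM.
    by apply: (cvg_comp _ Num.sqrt Ff); exact: sqrt_continuous.
  by apply: (cvg_comp _ Num.sqrt Gg); exact: sqrt_continuous.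
apply: (squeeze_cvgr _ (cvg_cst 0) h0).
apply: nearW => n; rewrite normr_ge0/=.
by apply: cauchy_schwarz; exact: L2B.
Qed.

End square_integrable.

(** * Measurability of matrix-valued maps *)

Section borel_functions.
Context d (Z : measurableType d) (R : realType).

(** Same trace convention as [measurable_fun E g], for a target known only as a topological space;
    [bmeasR] and [bmeas_mxP] lead back to real functions. *)
Definition bmeas (Y : topologicalType) (E : set Z) (g : Z -> Y) :=
  forall B, borel B -> measurable (E `&` g @^-1` B).

Lemma bmeas_open (Y : topologicalType) (E : set Z) (g : Z -> Y) :
  measurable E -> (forall O, open O -> measurable (E `&` g @^-1` O)) ->
  bmeas E g.
Proof.
move=> mE h; apply: smallest_sub; last exact: h.
split.
- by rewrite preimage_set0 setI0.
- move=> B /= mB; rewrite setTD preimage_setC.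
  have -> : E `&` ~` (g @^-1` B) = E `\` (E `&` g @^-1` B).
    by rewrite setDIr setDv set0U setDE.
  exact: measurableD.
- move=> F /= mF; rewrite preimage_bigcup setI_bigcupr.
  exact: bigcupT_measurable.
Qed.

Lemma borel_preimage (Y Y' : topologicalType) (phi : Y -> Y') :
  continuous phi -> forall B, borel B -> borel (phi @^-1` B).
Proof.
move=> /continuousP cphi; apply: smallest_sub; last first.
  by move=> O /cphi; exact: sub_sigma_algebra.
split.
- by rewrite /= preimage_set0; exact: sigma_algebra0.
- by move=> B /= mB; rewrite setTD preimage_setC -setTD; exact: sigma_algebraCD.
- by move=> F /= mF; rewrite preimage_bigcup; exact: sigma_algebra_bigcup.
Qed.

Lemma bmeas_comp (Y Y' : topologicalType) (E : set Z) (g : Z -> Y)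
  (phi : Y -> Y') : continuous phi -> bmeas E g -> bmeas E (phi \o g).
Proof.
by move=> cphi mg B mB; rewrite comp_preimage; apply: mg; exact: borel_preimage.
Qed.

Lemma bmeasR (E : set Z) (g : Z -> R) : measurable E ->
  bmeas E g <-> measurable_fun E g.
Proof.
move=> mE; split => [mg|mg].
  apply: (measurability _ (RGenOpens.measurableE R)).
  move=> _ -[_ [a [b ->] <-]]; apply: mg.
  by apply: sub_sigma_algebra; exact: interval_open.
by apply: bmeas_open => // O oO; apply: mg => //; exact: open_measurable.
Qed.

(** A countable dense family makes every open set a countable union of balls with centres in the
    family and rational radii. *)
Lemma bmeas_ball (Y : pseudoMetricType R) (K : countType) (iota : K -> Y)
    (E : set Z) (g : Z -> Y) :
  (forall y (e : R), 0 < e -> exists k, ball y e (iota k)) ->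
  measurable E ->
  (forall k (e : R), 0 < e -> measurable (E `&` g @^-1` (ball (iota k) e))) ->
  bmeas E g.
Proof.
move=> dense mE h; apply: bmeas_open => // O oO.
pose F (kr : K * rat) := if `[< 0 < ratr kr.2 :> R /\
  ball (iota kr.1) (ratr kr.2) `<=` O >] then
  ball (iota kr.1) (ratr kr.2 : R) else set0.
have -> : O = \bigcup_kr F kr.
  apply/seteqP; split => [y Oy|y [kr _]]; last first.
    by rewrite /F; case: asboolP => // -[_]; apply.
  have /nbhs_ballP[e /= e0 ye] : nbhs y O by apply: open_nbhs_nbhs.
  (* With a radius below e / 2, a ball that contains y stays inside the ball of radius e about y. *)
  have [r] := @rat_in_itvoo R 0 (e / 2) (divr_gt0 e0 (ltr0Sn _ _)).
  rewrite in_itv/= => /andP[r0 re].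
  have [k yk] := dense y (ratr r) r0.
  exists (k, r) => //; rewrite /F asboolT/=; first exact: ball_sym.
  split => // z kz; apply: ye; rewrite (splitr e).
  by apply: (ball_triangle (y := iota k)); apply: le_ball (ltW re) _ _.
rewrite preimage_bigcup setI_bigcupr.
apply: countable_bigcupT_measurable; first exact: countableP.
move=> kr; rewrite /F; case: asboolP => [[r0 _]|_]; first exact: h.
by rewrite preimage_set0 setI0.
Qed.

Lemma bmeas_mxP r c (E : set Z) (g : Z -> 'M[R]_(r, c)) i j : measurable E ->
  bmeas E g -> measurable_fun E (fun z => g z i j).
Proof.
move=> mE mg; apply/bmeasR => //.
by apply: (bmeas_comp (phi := fun A : 'M[R]_(r, c) => A i j)) => // A;
  exact: coord_continuous.
Qed.

Lemma measurable_ball_fun (E : set Z) (g : Z -> R) y e : measurable E ->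
  measurable_fun E g -> measurable (E `&` g @^-1` ball y e).
Proof.
move=> mE mg; apply: mg => //; apply: open_measurable.
by case: (ltP 0 e) => e0; [exact: ball_open|rewrite (ball0 y e).2//; exact: open0].
Qed.

Lemma ball_matE r c (x : 'M[R]_(r, c)) e : 0 < e ->
  ball x e = \bigcap_(ij in [set: 'I_r * 'I_c])
    [set A : 'M[R]_(r, c) | ball (x ij.1 ij.2) e (A ij.1 ij.2)].
Proof.
move=> e0; apply/seteqP; split => [A [_ h] [i j] _|A h]; first exact: h.
by split => // i j; exact: (h (i, j)).
Qed.

Lemma measurable_ball_mx r c (E : set Z) (g : Z -> 'M[R]_(r, c)) x e :
  measurable E -> 0 < e -> (forall i j, measurable_fun E (fun z => g z i j)) ->
  measurable (E `&` g @^-1` ball x e).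
Proof.
move=> mE e0 mg; rewrite ball_matE// preimage_bigcap.
rewrite (_ : E `&` _ = E `&` \bigcap_(ij in [set: 'I_r * 'I_c])
  (E `&` g @^-1` [set A | ball (x ij.1 ij.2) e (A ij.1 ij.2)])).
  apply: measurableI => //; apply: fin_bigcap_measurable.
    exact: finite_finset.
  by move=> [i j] _; exact: (measurable_ball_fun (g := fun z => g z i j)).
apply/seteqP; split => z [Ez h]; split => // ij _; last by case: (h ij I).
by split => //; exact: h.
Qed.

Lemma rat_dense (y e : R) : 0 < e -> exists k : rat, ball y e (ratr k).
Proof.
move=> e0; have [r] := @rat_in_itvoo R (y - e) (y + e) ltac:(lra).
rewrite in_itv/= => /andP[h1 h2]; exists r.
by rewrite /ball/= ltr_norml; apply/andP; split; lra.
Qed.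

Lemma mx_dense r c (y : 'M[R]_(r, c)) e : 0 < e ->
  exists k : 'M[rat]_(r, c), ball y e (map_mx ratr k).
Proof.
move=> e0; have h i j := rat_dense (y i j) e0.
exists (\matrix_(i, j) xget 0 [set k | ball (y i j) e (ratr k : R)]).
split => // i j; rewrite !mxE.
have [k hk] := h i j.
exact: (@xgetPex _ 0 [set k | ball (y i j) e (ratr k : R)] (ex_intro _ k hk)).
Qed.

Lemma bmeas_mx r c (E : set Z) (g : Z -> 'M[R]_(r, c)) : measurable E ->
  (forall i j, measurable_fun E (fun z => g z i j)) -> bmeas E g.
Proof.
move=> mE mg; apply: (@bmeas_ball 'M[R]_(r, c) 'M[rat]_(r, c) (map_mx ratr)) => //.
  exact: mx_dense.
by move=> k e e0; exact: measurable_ball_mx.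
Qed.

(** [coef_measurable] refers to Borel sets of the product topology; these are reached from the
    factors through the countable dense set of rational points, because balls of the product are
    products of balls. *)
Lemma bmeas_triple n k (E : set Z) (tau : Z -> R) (x : Z -> 'cV[R]_n)
    (v : Z -> 'cV[R]_k) : measurable E -> measurable_fun E tau ->
  (forall i, measurable_fun E (fun z => x z i 0)) ->
  (forall i, measurable_fun E (fun z => v z i 0)) ->
  bmeas E (fun z => (tau z, x z, v z)).
Proof.
move=> mE mtau mx mv.
pose iota (a : rat * 'cV[rat]_n * 'cV[rat]_k) : R * 'cV[R]_n * 'cV[R]_k :=
  (ratr a.1.1, map_mx ratr a.1.2, map_mx ratr a.2).
apply: (@bmeas_ball (R * 'cV[R]_n * 'cV[R]_k)%type (rat * 'cV[rat]_n * 'cV[rat]_k)%type iota) => //.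
  move=> [[t y] w] e e0.
  have [a ha] := rat_dense t e0; have [b hb] := mx_dense y e0.
  by have [c hc] := mx_dense w e0; exists (a, b, c).
move=> [[a b] c] e e0.
rewrite (_ : E `&` _ =
  (E `&` tau @^-1` ball (ratr a : R) e) `&`
  ((E `&` x @^-1` ball (map_mx ratr b : 'cV[R]_n) e) `&`
   (E `&` v @^-1` ball (map_mx ratr c : 'cV[R]_k) e))).
  apply: measurableI; first exact: measurable_ball_fun.
  apply: measurableI.
    by apply: measurable_ball_mx => // i j; rewrite ord1.
  by apply: measurable_ball_mx => // i j; rewrite ord1.
apply/seteqP; split=> z /=.
  by move=> [Ez [[h1 h2] h3]].
by move=> [[Ez h1] [[_ h2] [_ h3]]].
Qed.

End borel_functions.

(** * Densities, and orthogonality to functions of a random variable *)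

Section density.
Context d (X : measurableType d) (R : realType).
Import HBNNSimple.

(** The hypothesis on [nu] is the case of indicators; simple functions follow by linearity and [f]
    by monotone convergence on both sides. *)
Lemma ge0_integral_density (m nu : {measure set X -> \bar R}) (p f : X -> R) :
  measurable_fun setT p -> (forall x, 0 <= p x) ->
  (forall A, measurable A -> nu A = (\int[m]_(x in A) (p x)%:E)%E) ->
  measurable_fun setT f -> (forall x, 0 <= f x) ->
  (\int[nu]_x (f x)%:E = \int[m]_x (f x * p x)%:E)%E.
Proof.
move=> mp p0 nuE mf f0.
have meF : measurable_fun [set: X] (EFin \o f) by exact/measurable_EFinP.
pose g := nnsfun_approx measurableT meF.
have gf x : EFin \o g ^~ x @ \oo --> (f x)%:E.
  by apply: (cvg_nnsfun_approx _ meF) => // y _; rewrite lee_fin.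
have ndg x : {homo (fun n => g n x) : a b / (a <= b)%N >-> a <= b}.
  by move=> a b ab; exact/lefP/nd_nnsfun_approx.
have step n : (\int[nu]_x (g n x)%:E = \int[m]_x (g n x * p x)%:E)%E.
  rewrite integral_nnsfun//= (_ : g n \_ setT = g n); last first.
    by apply/funext => x; rewrite patchT// inE.
  rewrite sintegralE.
  transitivity (\int[m]_x (\sum_(y \in range (g n))
      ((y * \1_(g n @^-1` [set y]) x)%:E * (p x)%:E)))%E; last first.
    apply: eq_integral => x _; rewrite [in RHS]fimfunE EFinM -fsumEFin//.
    rewrite ge0_mule_fsuml// => y.
    by rewrite EFinM; exact: nnfun_muleindic_ge0.
  rewrite ge0_integral_fsum//; last 2 first.
  - move=> y; under eq_fun do rewrite -EFinM.
    apply/measurable_EFinP; apply: measurable_funM => //.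
    exact: measurable_funM.
  - move=> y x _; rewrite EFinM mule_ge0 ?lee_fin//.
    by have := nnfun_muleindic_ge0 (g n) y x; rewrite -EFinM lee_fin.
  apply: eq_fsbigr => y _; rewrite nuE//.
  transitivity (\int[m]_x (y%:E * (\1_(g n @^-1` [set y]) x * p x)%:E))%E;
    last by apply: eq_integral => x _; rewrite -!EFinM mulrA.
  (* A negative y is not a value of [g n], so its preimage is empty; a nonnegative one can be taken
     out of the integral. *)
  have [y0|y0] := ltP y 0.
    rewrite preimage_nnfun0// integral_set0 mule0.
    by rewrite integral0_eq// => x _; rewrite indicE in_set0 mul0r mule0.
  rewrite ge0_integralZl//; last 2 first.
  - by apply/measurable_EFinP; apply: measurable_funM => //.
  - by move=> x _; rewrite lee_fin mulr_ge0.
  congr (_ * _)%E; rewrite [LHS]integral_mkcond; apply: eq_integral => x _.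
  by rewrite patchE indicE; case: ifP; rewrite ?mul1r ?mul0r.
have e1 : (\int[nu]_x (f x)%:E = limn (fun n => \int[nu]_x (g n x)%:E))%E.
  under eq_integral do rewrite -(cvg_lim _ (gf _))//.
  apply: monotone_convergence => //.
  - by move=> n; exact/measurable_EFinP.
  - by move=> n x _; rewrite lee_fin.
  - by move=> x _ a b ab; rewrite lee_fin ndg.
have e2 : (\int[m]_x (f x * p x)%:E = limn (fun n => \int[m]_x (g n x * p x)%:E))%E.
  have h x : (fun n => (g n x * p x)%:E) @ \oo --> (f x * p x)%:E.
    apply: cvg_EFin; first exact: nearW.
    apply: cvgM; last exact: cvg_cst.
    exact: (fine_cvg (gf x)).
  under eq_integral do rewrite -(cvg_lim _ (h _))//.
  apply: monotone_convergence => //.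
  - move=> n; apply/measurable_EFinP; exact: measurable_funM.
  - by move=> n x _; rewrite lee_fin mulr_ge0.
  - by move=> x _ a b ab; rewrite lee_fin ler_wpM2r// ndg.
by rewrite e1 e2; congr (limn _); apply/funext.
Qed.

End density.

Lemma Rint_dominated d (X : measurableType d) (R : realType)
  (m : {measure set X -> \bar R}) (F : nat -> X -> R) (f G : X -> R) :
  (forall n, measurable_fun setT (F n)) -> measurable_fun setT f ->
  (forall x, F n x @[n --> \oo] --> f x) -> (forall n x, `|F n x| <= G x) ->
  L1 m G -> \int[m]_x F n x @[n --> \oo] --> \int[m]_x f x.
Proof.
move=> mF mf Ff FG iG.
have [|||||if_ _ c] := @dominated_convergence _ _ _ m setT measurableT
  (fun n x => (F n x)%:E) (EFin \o f) (EFin \o G).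
- by move=> n; exact/measurable_EFinP.
- exact/measurable_EFinP.
- by apply: aeW => x _; apply: cvg_EFin; [exact: nearW|exact: Ff].
- exact: iG.
- by apply: aeW => x n _; rewrite lee_fin.
apply: fine_cvg; rewrite fineK; first exact: c.
exact: integrable_fin_num.
Qed.

Section orthogonality.
Context d (X : measurableType d) (R : realType) (m : {measure set X -> \bar R}).
Import HBNNSimple.

(** Composed with [xi], the simple functions below [phi] are combinations of indicators of preimages
    under [xi], each orthogonal to [Y]; [|phi (xi x) * Y x|] dominates the passage to the limit. *)
Let orth_ge0 (xi Y : X -> R) (phi : R -> R) : measurable_fun setT xi ->
  L1 m Y ->
  (forall B, measurable B -> \int[m]_x (\1_(xi @^-1` B) x * Y x) = 0) ->
  measurable_fun setT phi -> (forall r, 0 <= phi r) ->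
  L1 m (fun x => phi (xi x) * Y x) ->
  \int[m]_x (phi (xi x) * Y x) = 0.
Proof.
move=> mxi iY h mphi phi0 i.
have meF : measurable_fun [set: R] (EFin \o phi) by exact/measurable_EFinP.
pose g := nnsfun_approx measurableT meF.
have phi0' r : [set: R] r -> (0 <= (EFin \o phi) r)%E by rewrite lee_fin.
have gf r : EFin \o g ^~ r @ \oo --> (phi r)%:E.
  exact: (cvg_nnsfun_approx _ meF phi0').
have gle n r : g n r <= phi r.
  by rewrite -lee_fin /g nnsfun_approxE; exact: le_approx.
have mY := L1_measurable iY.
have mg n : measurable_fun setT (fun x => g n (xi x)).
  exact: measurableT_comp.
have step n : \int[m]_x (g n (xi x) * Y x) = 0.
  have -> : \int[m]_x (g n (xi x) * Y x) = \int[m]_x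
      (\sum_(y <- finmap.enum_fset (fset_set (range (g n)))) (y * (\1_(xi @^-1` (g n @^-1` [set y])) x * Y x))).
    apply: eq_Rintegral => x _; rewrite fimfunE fsbig_finite//= mulr_suml.
    by apply: eq_bigr => y _; rewrite mulrA.
  have i1 y : L1 m (fun x => \1_(xi @^-1` (g n @^-1` [set y])) x * Y x).
    apply: (L1_le (g := fun x => `|Y x|)).
    - apply: measurable_funM => //; apply: measurable_indic.
      by rewrite -[X in measurable X]setTI; apply: mxi.
    - move=> x; rewrite normrM ler_piMl// indicE.
      by case: (_ \in _); rewrite ?normr1 ?normr0.
    - exact: integrable_norm.
  rewrite Rint_sum; last by move=> y _; exact: L1Zl.
  by apply: big1 => y _; rewrite RintZl// h ?mulr0.
have c : \int[m]_x (g n (xi x) * Y x) @[n --> \oo] --> \int[m]_x (phi (xi x) * Y x).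
  apply: (Rint_dominated (G := fun x => `|phi (xi x) * Y x|)).
  - by move=> n; exact: measurable_funM.
  - exact: L1_measurable i.
  - move=> x; apply: cvgM; last exact: cvg_cst.
    exact: (fine_cvg (gf (xi x))).
  - by move=> n x; rewrite !normrM ler_wpM2r// !ger0_norm.
  - exact: integrable_norm.
rewrite (_ : (fun n => _) = cst 0) in c; last exact/funext.
by rewrite -(cvg_lim (@norm_hausdorff _ R) c) lim_cst.
Qed.

(* Testing against indicators of [xi] only: [xi] need not generate a
   sigma-algebra on which [Y] has a conditional expectation. *)
Lemma orthogonal_fun (xi Y : X -> R) : measurable_fun setT xi ->
  L1 m Y -> L1 m (fun x => xi x * Y x) ->
  (forall B, measurable B -> \int[m]_x (\1_(xi @^-1` B) x * Y x) = 0) ->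
  \int[m]_x (xi x * Y x) = 0.
Proof.
move=> mxi iY i h; have mY := L1_measurable iY.
have mp : measurable_fun [set: R] (fun r : R => Num.max r 0).
  exact: measurable_maxr.
have mn : measurable_fun [set: R] (fun r : R => Num.max (- r) 0).
  by apply: measurable_maxr => //; exact: measurableT_comp.
have le1 r : `|Num.max r 0| <= `|r| :> R.
  by rewrite ger0_norm ?le_max ?lexx ?orbT// ge_max ler_norm normr_ge0.
have ip (phi : R -> R) : measurable_fun setT phi -> (forall r, `|phi r| <= `|r|) ->
    L1 m (fun x => phi (xi x) * Y x).
  move=> mphi hphi; apply: (L1_le (g := fun x => `|xi x * Y x|)).
  - by apply: measurable_funM => //; exact: measurableT_comp.
  - by move=> x; rewrite !normrM ler_wpM2r.
  - exact: integrable_norm.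
have i1 := ip _ mp le1.
have i2 : L1 m (fun x => Num.max (- xi x) 0 * Y x).
  by apply: (ip (fun r => Num.max (- r) 0)) => // r; rewrite -[`|r|]normrN.
have -> : \int[m]_x (xi x * Y x) =
    \int[m]_x (Num.max (xi x) 0 * Y x - Num.max (- xi x) 0 * Y x).
  apply: eq_Rintegral => x _; rewrite -mulrBl; congr (_ * _).
  by rewrite /Num.max; case: ifPn; case: ifPn; lra.
rewrite RintB//.
rewrite (orth_ge0 mxi iY h mp)//; last by move=> r; rewrite le_max lexx orbT.
rewrite (orth_ge0 (phi := fun r => Num.max (- r) 0) mxi iY h mn) ?subr0//.
by move=> r; rewrite le_max lexx orbT.
Qed.

End orthogonality.

(** * Gaussian variables and Brownian increments *)

Section normal_moments.
Context (R : realType) (s : R) (s_gt0 : 0 < s).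
Local Notation mu := (@lebesgue_measure R).
Local Notation n := (normal_pdf 0 s).

Let s0 : s != 0. Proof. by rewrite gt_eqF. Qed.

(** This makes - s^2 n a primitive of x n and - s^2 x n a primitive of (x^2 - s^2) n, from which the
    first two moments are computed. *)
Lemma is_derive_normal_pdf (x : R) :
  is_derive x 1 n (- x / s ^+ 2 * n x).
Proof.
have e : n = (fun y : R => normal_peak s *: expR ((- (y ^+ 2)) / (s ^+ 2 *+ 2))).
  by apply/funext => y; rewrite normal_pdfE// /normal_fun subr0.
rewrite [X in is_derive _ _ X _]e.
have d1 : is_derive x 1 (fun y : R => (- (y ^+ 2)) / (s ^+ 2 *+ 2))
    (- x / s ^+ 2).
  apply: is_derive_eq.
  by rewrite /GRing.scale/= -(mulr_natr (s ^+ 2)); field.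
have d2 := is_derive1_comp (is_derive_expR _) d1.
apply: (is_derive_eq (is_deriveZ (normal_peak s) d2)).
by rewrite e /GRing.scale/=; ring.
Qed.

Lemma Rint_FTC_sym (F f : R -> R) (b : R) : 0 < b ->
  (forall x : R, is_derive x (1 : R) F (f x)) -> continuous f ->
  \int[mu]_x (f x * \1_(`[- b, b]) x) = F b - F (- b).
Proof.
move=> b0 dF cf.
have cF x : {for x, continuous F}.
  apply/differentiable_continuous/derivable1_diffP.
  exact: (@ex_derive _ _ _ _ _ _ _ (dF x)).
have -> : \int[mu]_x (f x * \1_(`[- b, b]) x) = \int[mu]_(x in `[- b, b]) f x.
  rewrite [RHS]Rintegral_mkcond; apply: eq_Rintegral => x _.
  by rewrite patchE indicE; case: ifP; rewrite ?mulr1 ?mulr0.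
rewrite /Rintegral (@continuous_FTC2 _ f F)//.
- by lra.
- exact: continuous_subspaceT.
- split; first by move=> x _; exact: (@ex_derive _ _ _ _ _ _ _ (dF x)).
    exact: cvg_at_right_filter (cF _).
  exact: cvg_at_left_filter (cF _).
- by move=> x _; rewrite derive1E; exact: derive_val.
Qed.

(** The successor keeps the interval nondegenerate at N = 0, as [Rint_FTC_sym] requires. *)
Lemma Rint_sym_lim (f : R -> R) : L1 mu f ->
  \int[mu]_x (f x * \1_(`[- (N.+1%:R), N.+1%:R]) x) @[N --> \oo]
    --> \int[mu]_x f x.
Proof.
move=> hf; apply: (@Rint_dominated _ _ _ mu
  (fun N x => f x * \1_(`[- (N.+1%:R), N.+1%:R]) x) f (fun x => `|f x|)).
- by move=> N; apply: measurable_funM => //; exact: L1_measurable hf.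
- exact: L1_measurable hf.
- move=> x; apply: cvg_near_cst; near=> N.
  rewrite indicE mem_set ?mulr1//= in_itv/= -ler_norml.
  by apply: (le_trans (ltW (truncnS_gt `|x|))); rewrite ler_nat ltnS; near: N; exact: nbhs_infty_ge.
- move=> N x; rewrite normrM ler_piMr// indicE.
  by case: (_ \in _); rewrite ?normr1 ?normr0.
- exact: integrable_norm.
Unshelve. all: by end_near. Qed.

Lemma continuous_normal : continuous n.
Proof. exact: continuous_normal_pdf. Qed.

Lemma mul_expRN_le1 (y : R) : 0 <= y -> y * expR (- y) <= 1.
Proof.
move=> y0; rewrite expRN ler_pdivrMr ?expR_gt0// mul1r.
by apply: le_trans (expR_ge1Dx y); rewrite lerDr.
Qed.

(** Doubling the deviation leaves a factor exp(- y) with y = 3/8 x^2 / s^2, since 1/2 - 1/8 = 3/8;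
    then x^2 = 8/3 s^2 y and y exp(- y) <= 1. The wider Gaussian dominates x^2 n for integrability
    and, its density being bounded, controls the boundary terms at infinity. *)
Lemma sqr_normal_le (x : R) : x ^+ 2 * n x <=
  (8 / 3 * s ^+ 2 * normal_peak s / normal_peak (2 * s)) * normal_pdf 0 (2 * s) x.
Proof.
have s20 : 2 * s != 0 by rewrite mulf_neq0.
rewrite !normal_pdfE// /normal_fun !subr0.
have ps := normal_peak_gt0 s0; have p2s := normal_peak_gt0 s20.
rewrite [leRHS](_ : _ = 8 / 3 * s ^+ 2 * normal_peak s *
  expR (- x ^+ 2 / ((2 * s) ^+ 2 *+ 2))); last by field; rewrite gt_eqF.
set y := 3 / 8 * (x ^+ 2 / s ^+ 2).
have y0 : 0 <= y by rewrite mulr_ge0 ?divr_ge0 ?sqr_ge0.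
have -> : - x ^+ 2 / (s ^+ 2 *+ 2) = - y + - x ^+ 2 / ((2 * s) ^+ 2 *+ 2).
  by rewrite /y -(mulr_natr (s ^+ 2)) -(mulr_natr ((2 * s) ^+ 2)); field.
rewrite expRD; set E := expR (- x ^+ 2 / _).
have -> : x ^+ 2 * (normal_peak s * (expR (- y) * E)) =
  8 / 3 * s ^+ 2 * normal_peak s * E * (y * expR (- y)).
  by rewrite /y; field.
rewrite ler_piMr//; last exact: mul_expRN_le1.
by rewrite !mulr_ge0 ?sqr_ge0 ?expR_ge0 ?normal_peak_ge0 ?(ltW s_gt0).
Qed.

Lemma L1_normal : L1 mu n.
Proof. exact: integrable_normal_pdf. Qed.

Lemma L1_sqr_normal : L1 mu (fun x => x ^+ 2 * n x).
Proof.
apply: (L1_le _ _ (L1Zl (8 / 3 * s ^+ 2 * normal_peak s / normal_peak (2 * s))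
  (@integrable_normal_pdf R 0 (2 * s)))).
  apply: measurable_funM; first exact: measurable_funX.
  exact: measurable_normal_pdf.
move=> x; rewrite ger0_norm; first exact: sqr_normal_le.
by rewrite mulr_ge0 ?sqr_ge0// normal_pdf_ge0.
Qed.

Lemma L1_id_normal : L1 mu (fun x => x * n x).
Proof.
apply: (L1_le _ _ (L1D L1_sqr_normal L1_normal)).
  apply: measurable_funM => //; exact: measurable_normal_pdf.
move=> x; rewrite normrM (ger0_norm (normal_pdf_ge0 _ _ _)).
rewrite -[X in _ <= _ + X]mul1r -mulrDl ler_wpM2r ?normal_pdf_ge0//.
by rewrite ler_norml; apply/andP; split; nra.
Qed.

Lemma normal_pdfN x : n (- x) = n x.
Proof. by rewrite !normal_pdfE// /normal_fun !subr0 sqrrN. Qed.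

Lemma Rint_normal : \int[mu]_x n x = 1.
Proof. by rewrite /Rintegral integral_normal_pdf. Qed.

Lemma Rint_id_normal : \int[mu]_x (x * n x) = 0.
Proof.
have h := Rint_sym_lim L1_id_normal.
rewrite -(cvg_lim (@norm_hausdorff _ R) h); apply: lim_near_cst => //.
apply: nearW => N.
have dF (x : R) : is_derive x (1 : R) (fun x => - s ^+ 2 * n x) (x * n x).
  apply: (is_derive_eq (is_deriveZ (- s ^+ 2) (is_derive_normal_pdf x))).
  by rewrite /GRing.scale/=; field.
have cf : continuous (fun x : R => x * n x).
  by move=> x; apply: cvgM; [exact: cvg_id|exact: continuous_normal].
(* The density is even, so the two boundary values cancel. *)
by rewrite (Rint_FTC_sym (ltr0Sn R N) dF cf) normal_pdfN subrr.
Qed.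

Lemma Rint_sqr_normal : \int[mu]_x (x ^+ 2 * n x) = s ^+ 2.
Proof.
have i1 : L1 mu (fun x => s ^+ 2 * n x) by apply: L1Zl; exact: L1_normal.
(* Unlike x^2 n alone, the difference has an explicit primitive, so only boundary terms remain. *)
suff : \int[mu]_x (x ^+ 2 * n x - s ^+ 2 * n x) = 0.
  rewrite RintB//; last exact: L1_sqr_normal.
  rewrite (RintZl _ L1_normal) Rint_normal mulr1.
  by move/eqP; rewrite subr_eq0 => /eqP.
have h := Rint_sym_lim (L1B L1_sqr_normal i1).
rewrite -(cvg_lim (@norm_hausdorff _ R) h); apply/cvg_lim => //.
have e N : \int[mu]_x ((x ^+ 2 * n x - s ^+ 2 * n x) *
    \1_(`[- (N.+1%:R), N.+1%:R]) x) = - 2 * s ^+ 2 * (N.+1%:R * n N.+1%:R).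
  have dF (x : R) : is_derive x (1 : R) (fun x => - s ^+ 2 * (x * n x))
      (x ^+ 2 * n x - s ^+ 2 * n x).
    have d2 := is_deriveM (is_derive_id x 1) (is_derive_normal_pdf x).
    apply: (is_derive_eq (is_deriveZ (- s ^+ 2) d2)).
    by rewrite /GRing.scale/=; field.
  have cf : continuous (fun x : R => x ^+ 2 * n x - s ^+ 2 * n x).
    move=> x; apply: cvgB; apply: cvgM; try exact: continuous_normal.
      exact: sqr_continuous.
    exact: cvg_cst.
  rewrite (Rint_FTC_sym (ltr0Sn R N) dF cf).
  by rewrite normal_pdfN; ring.
under eq_fun do rewrite e.
suff hN : N.+1%:R * n N.+1%:R @[N --> \oo] --> (0 : R).
  have h3 : - 2 * s ^+ 2 * (N.+1%:R * n N.+1%:R) @[N --> \oo] --> - 2 * s ^+ 2 * 0.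
    by apply: cvgM; [exact: cvg_cst|exact: hN].
  by rewrite mulr0 in h3; exact: h3.
(* By [sqr_normal_le] and the peak of the wider density, b^2 n(b) <= C, hence b n(b) <= C / b at b =
   N + 1. *)
pose C := 8 / 3 * s ^+ 2 * normal_peak s / normal_peak (2 * s) * normal_peak (2 * s).
have h0 : C * (N.+1%:R)^-1 @[N --> \oo] --> (0 : R).
  have h3 : C * (N.+1%:R)^-1 @[N --> \oo] --> C * 0.
    by apply: cvgM; [exact: cvg_cst|exact: cvg_harmonic].
  by rewrite mulr0 in h3; exact: h3.
apply: (squeeze_cvgr _ (cvg_cst 0) h0).
apply: nearW => N; rewrite mulr_ge0 ?normal_pdf_ge0//=.
have h1 := sqr_normal_le (N.+1%:R).
have s20 : 2 * s != 0 by rewrite mulf_neq0.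
have h2 : (8 / 3 * s ^+ 2 * normal_peak s / normal_peak (2 * s)) *
    normal_pdf 0 (2 * s) N.+1%:R <= C.
  rewrite ler_wpM2l ?normal_pdf_ub//.
  by rewrite !mulr_ge0 ?invr_ge0 ?normal_peak_ge0 ?(ltW s_gt0).
by rewrite ler_pdivlMr// mulrAC -expr2; exact: le_trans h1 h2.
Qed.

End normal_moments.

Section independence.
Context d (X : measurableType d) (R : realType) (P : probability X R).

Lemma Rint_indic (A : set X) : measurable A -> \int[P]_x \1_A x = fine (P A).
Proof. by move=> mA; rewrite /Rintegral integral_indic// setIT. Qed.

Lemma L1_indic (A : set X) : measurable A -> L1 P (\1_A).
Proof. by move=> mA; exact: integrable_indic. Qed.

Lemma L1_cst (c : R) : L1 P (fun=> c).
Proof. exact: finite_measure_integrable_cst. Qed.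

Lemma L2_cst (c : R) : L2 P (fun=> c).
Proof. by split => //; exact: L1_cst. Qed.

Lemma L2_L1 (f : X -> R) : L2 P f -> L1 P f.
Proof.
move=> hf; have := L2M hf (L2_cst 1).
by apply: eq_integrable => // x _ /=; rewrite mulr1.
Qed.

Lemma L1_indicM (A : set X) (f : X -> R) : measurable A -> L1 P f ->
  L1 P (fun x => \1_A x * f x).
Proof.
move=> mA hf; apply: (L1_le (g := fun x => `|f x|)).
- by apply: measurable_funM => //; exact: L1_measurable hf.
- move=> x; rewrite normrM ler_piMl// indicE.
  by case: (_ \in _); rewrite ?normr1 ?normr0.
- exact: integrable_norm.
Qed.

Lemma L2_indicM (A : set X) (f : X -> R) : measurable A -> L2 P f ->
  L2 P (fun x => \1_A x * f x).
Proof.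
move=> mA hf; under eq_fun do rewrite mulrC.
apply: (L2Mb (M := 1)) => // x; rewrite indicE.
by case: (_ \in _); rewrite ?normr1 ?normr0.
Qed.

(** Independence makes 1_A - P(A) orthogonal to the indicator of every event of [xi], hence to [xi]
    itself by [orthogonal_fun]. *)
Lemma Rint_indep (A : set X) (xi : X -> R) : measurable A -> L1 P xi ->
  (forall B, measurable B -> P (A `&` xi @^-1` B) = (P A * P (xi @^-1` B))%E) ->
  \int[P]_x (\1_A x * xi x) = fine (P A) * \int[P]_x xi x.
Proof.
move=> mA ixi h; have mxi := L1_measurable ixi.
have iY : L1 P (fun x => \1_A x - fine (P A)).
  by apply: L1B; [exact: L1_indic|exact: L1_cst].
have i1 : L1 P (fun x => \1_A x * xi x) by exact: L1_indicM.
have i2 : L1 P (fun x => fine (P A) * xi x) by exact: L1Zl.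
have := @orthogonal_fun _ _ _ P xi (fun x => \1_A x - fine (P A)) mxi iY.
have e x : xi x * (\1_A x - fine (P A)) = \1_A x * xi x - fine (P A) * xi x.
  by ring.
under [X in L1 _ X]eq_fun do rewrite e.
move=> /(_ (L1B i1 i2)) h0.
apply/eqP; rewrite -subr_eq0 -RintZl// -RintB//; apply/eqP.
under eq_Rintegral do rewrite -e.
apply: h0 => B mB.
have mB' : measurable (xi @^-1` B) by rewrite -[X in measurable X]setTI; exact: mxi.
have -> : \int[P]_x (\1_(xi @^-1` B) x * (\1_A x - fine (P A))) =
    \int[P]_x (\1_(A `&` xi @^-1` B) x - fine (P A) * \1_(xi @^-1` B) x).
  by apply: eq_Rintegral => x _; rewrite indicI/=; ring.
rewrite RintB; last 2 first.
- by apply: L1_indic; exact: measurableI.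
- by apply: L1Zl; exact: L1_indic.
rewrite RintZl; last exact: L1_indic.
rewrite !Rint_indic//; last exact: measurableI.
by rewrite h// fineM ?fin_num_measure// subrr.
Qed.

End independence.

Section gaussian_variable.
Context d (X : measurableType d) (R : realType) (P : probability X R).
Variables (s : R) (D : X -> R).
Hypotheses (s_gt0 : 0 < s) (mD : measurable_fun setT D).
Hypothesis lawD : forall B, measurable B -> P (D @^-1` B) = normal_prob 0 s B.

Lemma integral_gaussian (f : R -> R) : measurable_fun setT f ->
  (forall x, 0 <= f x) ->
  (\int[P]_x (f (D x))%:E = \int[lebesgue_measure]_x (f x * normal_pdf 0 s x)%:E)%E.
Proof.
move=> mf f0.
have e := @ge0_integral_density _ _ _ lebesgue_measure
  (normal_prob 0 s) (normal_pdf 0 s) f (measurable_normal_pdf 0 s)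
  (normal_pdf_ge0 0 s) (fun A mA => erefl) mf f0.
pose D' : {mfun X >-> measurableTypeR R} :=
  HB.pack D (isMeasurableFun.Build _ _ _ (measurableTypeR R) D mD).
rewrite -e -(@ge0_integral_pushforward _ _ _ (measurableTypeR R) R D' mD P setT (EFin \o f))//.
- by apply: eq_measure_integral => A mA _; exact: lawD.
- exact/measurable_EFinP.
- by move=> x _ /=; rewrite lee_fin.
Qed.

Lemma L2_gaussian : L2 P D.
Proof.
split => //; apply/integrableP; split.
  by apply/measurable_EFinP; exact: measurable_funX.
under eq_integral do rewrite /= ger0_norm ?sqr_ge0//.
rewrite (@integral_gaussian (fun x => x ^+ 2)); last 2 first.
- exact: measurable_funX.
- by move=> x; exact: sqr_ge0.
by rewrite integrable_lty//; exact: L1_sqr_normal.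
Qed.

Lemma gaussian_var : \int[P]_x (D x ^+ 2) = s ^+ 2.
Proof.
rewrite -(Rint_sqr_normal s_gt0) /Rintegral; congr fine.
rewrite (@integral_gaussian (fun x => x ^+ 2))//; last first.
  by move=> x; exact: sqr_ge0.
Qed.

(** [integral_gaussian] handles nonnegative functions, so the mean is read off from the second
    moment of D + 1, computed once under the law and once by expansion. *)
Lemma gaussian_mean : \int[P]_x D x = 0.
Proof.
have iD := L2_L1 L2_gaussian; have iD2 := L2_gaussian.2.
have e1 : \int[P]_x ((D x + 1) ^+ 2) = s ^+ 2 + 1.
  transitivity (\int[lebesgue_measure]_x ((x + 1) ^+ 2 * normal_pdf 0 s x)).
    rewrite /Rintegral; congr fine.
    rewrite (@integral_gaussian (fun x => (x + 1) ^+ 2))//; last first.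
      by move=> x; exact: sqr_ge0.
    by apply: measurable_funX; exact: measurable_funD.
  transitivity (\int[lebesgue_measure]_x (x ^+ 2 * normal_pdf 0 s x +
    2 * (x * normal_pdf 0 s x) + normal_pdf 0 s x)).
    by apply: eq_Rintegral => x _; ring.
  have j1 := L1_sqr_normal s_gt0; have j2 := L1_id_normal s_gt0.
  have j3 := L1_normal s.
  rewrite RintD//; last by apply: L1D => //; exact: L1Zl.
  rewrite RintD//; last exact: L1Zl.
  by rewrite RintZl// Rint_sqr_normal// Rint_id_normal// Rint_normal mulr0 addr0.
have : \int[P]_x ((D x + 1) ^+ 2) = s ^+ 2 + 2 * \int[P]_x D x + 1.
  transitivity (\int[P]_x (D x ^+ 2 + 2 * D x + 1)).
    by apply: eq_Rintegral => x _; ring.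
  rewrite RintD//; [|by apply: L1D => //; exact: L1Zl|exact: L1_cst].
  rewrite RintD//; last exact: L1Zl.
  rewrite RintZl// gaussian_var Rintegral_cst//.
  by rewrite [X in fine X]probability_setT mulr1.
by rewrite e1 => h; lra.
Qed.

End gaussian_variable.

Section brownian_increments.
Context {R : realType} {disp : measure_display} {Omega : measurableType disp}.
Variables (P : probability Omega R) (T : R) (d : nat).
Variable W : process (R := R) (Omega := Omega) d 1.
Hypotheses (P_complete : measure_is_complete P)
           (W_brownian : brownian_motion P T W).
Local Notation F := (filtration P W).

Lemma past_measurable t A : t <= T -> <<s past W t >> A -> measurable A.
Proof.
move=> tT; apply: smallest_sub; first exact: sigma_algebra_measurable.
move=> _ [s [B [/andP[s0 st] bB ->]]].
by have [mW _ _ _] := W_brownian; apply: mW => //; rewrite s0 (le_trans st).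
Qed.

(** Completeness enters here: negligible sets are among the generators of the filtration. *)
Lemma filtration_measurable t A : t <= T -> F t A -> measurable A.
Proof.
move=> tT; apply: smallest_sub; first exact: sigma_algebra_measurable.
move=> B [pB|]; last exact: P_complete.
by apply: (past_measurable tT); exact: sub_sigma_algebra.
Qed.

Lemma filtration_sub s t : s <= t -> F s `<=` F t.
Proof.
move=> st; apply: sub_smallest2r; first exact: smallest_sigma_algebra.
move=> A [[r [B [/andP[r0 rs] bB ->]]]|nA]; last first.
  by right.
by left; exists r, B; rewrite r0 (le_trans rs).
Qed.

(** The product formula for increments is given for raw past events, while adaptedness refers to the
    augmented filtration. Sets that agree with a past event up to a negligible set form a
    sigma-algebra containing the generators of F_t. *)
Lemma filtration_past t A : F t A ->
  exists2 A', <<s past W t >> A' & P.-negligible (A `+` A').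
Proof.
pose G A := exists2 A', <<s past W t >> A' & P.-negligible (A `+` A').
suff FG : F t `<=` G by exact: FG.
clear A.
apply: smallest_sub; last first.
  move=> A [pA|nA].
    exists A; first exact: sub_sigma_algebra.
    by rewrite setYK; exact: negligible_set0.
  by exists set0; [exact: sigma_algebra0|rewrite setY0].
split.
- by exists set0; [exact: sigma_algebra0|rewrite setY0; exact: negligible_set0].
- move=> A /= [A' pA' nA]; exists (setT `\` A'); first exact: sigma_algebraCD.
  apply: negligibleS nA => x.
  by move=> [[[_ a1] a2]|[[_ a1] a2]]; [right|left]; split => //;
    apply: contrapT => a3; apply: a2; split.
- move=> A /= hA.
  have /choice[A' hA'] : forall n, exists A', <<s past W t >> A' /\
      P.-negligible (A n `+` A').
    by move=> n; have [A' ? ?] := hA n; exists A'.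
  exists (\bigcup_n A' n); first by apply: sigma_algebra_bigcup => n; exact: (hA' n).1.
  apply: (@negligibleS _ _ _ _ (\bigcup_n (A n `+` A' n))); last first.
    by apply: negligible_bigcup => n; exact: (hA' n).2.
  move=> x [[[n _ an] na]|[[n _ an] na]]; exists n => //; [left|right];
    by split => // h; apply: na; exists n.
Qed.

Lemma W_measurable t l : 0 <= t <= T -> measurable_fun setT (fun w => W t w l 0).
Proof.
move=> tT; apply: bmeas_mxP => // B bB.
by rewrite setTI; case: W_brownian => mW _ _ _; exact: mW.
Qed.

Definition dW (s t : R) (l : 'I_d) (w : Omega) : R := W t w l 0 - W s w l 0.

Lemma measurable_dW s t l : 0 <= s <= T -> 0 <= t <= T ->
  measurable_fun setT (dW s t l).
Proof. by move=> sT tT; apply: measurable_funB; exact: W_measurable. Qed.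

Section increment.
Variables (s t : R) (s0 : 0 <= s) (st : s < t) (tT : t <= T).

Let sT' : 0 <= s <= T. Proof. by rewrite s0 (le_trans (ltW st)). Qed.
Let tT' : 0 <= t <= T. Proof. by rewrite (le_trans s0 (ltW st)). Qed.
Let sd := Num.sqrt (t - s).
Let sd0 : 0 < sd. Proof. by rewrite sqrtr_gt0 subr_gt0. Qed.

Lemma brownian_indep A (B : 'I_d -> set R) : F s A ->
  (forall i, measurable (B i)) ->
  P (A `&` [set w | forall i, B i (dW s t i w)]) =
  (P A * \prod_(i < d) normal_prob 0 sd (B i))%E.
Proof.
move=> FA mB; have [A' pA' [N [mN N0 AN]]] := filtration_past FA.
have sT : s <= T by rewrite (le_trans (ltW st)).
have mA := filtration_measurable sT FA; have mA' := past_measurable sT pA'.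
have [_ _ _ /(_ s t A' B s0 st tT pA' mB) h] := W_brownian.
have mD : measurable [set w | forall i, B i (dW s t i w)].
  rewrite (_ : [set w | _] = \bigcap_(i in [set: 'I_d]) (dW s t i @^-1` B i)).
    apply: fin_bigcap_measurable; first exact: finite_finset.
    by move=> i _; rewrite -[X in measurable X]setTI; exact: measurable_dW.
  by apply/seteqP; split => [w h' i _|w h' i]; exact: h'.
(* [A] and [A'] agree off the null set [N]; the equality serves for the event of the increments and
   for [setT]. *)
have eqP C : measurable C -> P (A `&` C) = P (A' `&` C).
  move=> mC.
  have e : (A `&` C) `|` N = (A' `&` C) `|` N.
    apply/seteqP; split => x [[ax cx]|nx]; try by right.
      by have [a'x|a'x] := pselect (A' x); [left|right; apply: AN; left].
    by have [a'x|a'x] := pselect (A x); [left|right; apply: AN; right].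
  have mAC : measurable (A `&` C) by exact: measurableI.
  have mAC' : measurable (A' `&` C) by exact: measurableI.
  by rewrite -(measureU0 mAC mN N0) e measureU0.
by rewrite eqP// -[in RHS](setIT A) eqP// setIT h.
Qed.

Lemma brownian_indep1 A l (B : set R) : F s A -> measurable B ->
  P (A `&` dW s t l @^-1` B) = (P A * normal_prob 0 sd B)%E.
Proof.
move=> FA mB.
have := @brownian_indep A (fun i => if i == l then B else setT) FA.
have -> : [set w | forall i, (if i == l then B else setT) (dW s t i w)] =
    dW s t l @^-1` B.
  apply/seteqP; split => [w /(_ l)|w Bw i]; first by rewrite eqxx.
  by case: eqP => // ->.
rewrite (bigD1 l)//= eqxx big1 ?mule1; last first.
  by move=> i /negbTE ->; exact: probability_setT.
by apply => i; case: ifP.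
Qed.

Lemma brownian_indep2 A l m (B B' : set R) : l != m -> F s A ->
  measurable B -> measurable B' ->
  P (A `&` (dW s t l @^-1` B `&` dW s t m @^-1` B')) =
  (P A * (normal_prob 0 sd B * normal_prob 0 sd B'))%E.
Proof.
move=> lm FA mB mB'.
have := @brownian_indep A (fun i => if i == l then B else
  if i == m then B' else setT) FA.
have -> : [set w | forall i, (if i == l then B else
    if i == m then B' else setT) (dW s t i w)] =
    dW s t l @^-1` B `&` dW s t m @^-1` B'.
  apply/seteqP; split => [w h|w [Bw Bw'] i].
    by split; [have := h l|have := h m];
      rewrite /= eqxx// eq_sym (negbTE lm).
  by case: eqP => [->//|_]; case: eqP => [->|].
have ml : m != l by rewrite eq_sym.
rewrite (bigD1 l)//= eqxx (bigD1 m)//= (negbTE ml) eqxx big1 ?mule1; last first.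
  by move=> i /andP[/negbTE -> /negbTE ->]; exact: probability_setT.
by apply => i; case: ifP => // _; case: ifP.
Qed.

Lemma F_setT r : F r setT.
Proof. by rewrite -[setT]setC0 -setTD; apply: sigma_algebraCD; exact: sigma_algebra0. Qed.

Lemma law_dW l B : measurable B -> P (dW s t l @^-1` B) = normal_prob 0 sd B.
Proof.
move=> mB; rewrite -[X in P X]setTI brownian_indep1//; last exact: F_setT.
by rewrite [X in (X * _)%E]probability_setT mul1e.
Qed.

Let mD l : measurable_fun setT (dW s t l). Proof. exact: measurable_dW. Qed.

Let dW_L2' l : L2 P (dW s t l).
Proof. exact: (L2_gaussian sd0 (mD l) (@law_dW l)). Qed.

Let mA A : F s A -> measurable A.
Proof. by apply: filtration_measurable; rewrite (le_trans (ltW st)). Qed.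

Let dW_mean' A l : F s A -> \int[P]_w (\1_A w * dW s t l w) = 0.
Proof.
move=> FA; rewrite Rint_indep; [|exact: mA|exact: L2_L1|].
  by rewrite (gaussian_mean sd0 (mD l) (@law_dW l)) mulr0.
by move=> B mB; rewrite brownian_indep1// law_dW.
Qed.

Let dW_cov' A l m : F s A -> \int[P]_w (\1_A w * (dW s t l w * dW s t m w)) =
  (l == m)%:R * (t - s) * fine (P A).
Proof.
move=> FA; case: eqVneq => [<-|lm].
  rewrite mul1r mulrC Rint_indep; [|exact: mA|by apply: L2M|]; last first.
    move=> B mB.
    have -> : (fun w => dW s t l w * dW s t l w) @^-1` B =
        dW s t l @^-1` ((fun x => x * x) @^-1` B) by [].
    have mB' : measurable ((fun x : R => x * x) @^-1` B).
      by rewrite -[X in measurable X]setTI; apply: measurable_funM.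
    by rewrite brownian_indep1// law_dW.
  congr (_ * _).
  under eq_Rintegral do rewrite -expr2.
  rewrite (gaussian_var sd0 (mD l) (@law_dW l)) sqr_sqrtr//.
  by rewrite subr_ge0 ltW.
rewrite mul0r mul0r.
(* For l != m, orthogonality is tested on events of component l: component m is independent of A
   intersected with such an event, and centred. *)
under eq_Rintegral do rewrite mulrCA.
have mAA := mA FA.
apply: orthogonal_fun => //.
- by apply: L1_indicM => //; exact: L2_L1.
- apply: (L2M (dW_L2' l)); exact: L2_indicM.
move=> B mB.
have mB' : measurable (dW s t l @^-1` B).
  by rewrite -[X in measurable X]setTI; exact: mD.
have -> : \int[P]_w (\1_(dW s t l @^-1` B) w * (\1_A w * dW s t m w)) =
    \int[P]_w (\1_(A `&` dW s t l @^-1` B) w * dW s t m w).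
  by apply: eq_Rintegral => w _; rewrite indicI/= mulrA [X in X * _]mulrC.
rewrite Rint_indep; [|exact: measurableI|exact: L2_L1|].
  by rewrite (gaussian_mean sd0 (mD m) (@law_dW m)) mulr0.
move=> B' mB'2.
rewrite -setIA brownian_indep2// brownian_indep1// law_dW// muleA//.
Qed.

Definition dW_facts := (dW_L2', dW_mean', dW_cov').

End increment.

Section adapted_increment.
Variables (s t : R) (s0 : 0 <= s) (st : s <= t) (tT : t <= T).

(** Degenerate increments do occur: the times of a step process may coincide, and they are cut at an
    intermediate t. *)
Let dW0 l : s = t -> dW s t l = fun=> 0.
Proof. by move=> ->; apply/funext => w; rewrite /dW subrr. Qed.

Lemma dW_L2 l : L2 P (dW s t l).
Proof.
have [/dW0->|st'] := eqVneq s t; first exact: L2_0.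
by apply: (dW_facts s0 _ tT).1.1; rewrite lt_neqAle st'.
Qed.

Lemma dW_mean A l : F s A -> \int[P]_w (\1_A w * dW s t l w) = 0.
Proof.
have [/dW0->|st'] := eqVneq s t.
  by move=> _; under eq_Rintegral do rewrite mulr0; rewrite /Rintegral integral0.
by apply: (dW_facts s0 _ tT).1.2; rewrite lt_neqAle st'.
Qed.

Lemma dW_cov A l m : F s A -> \int[P]_w (\1_A w * (dW s t l w * dW s t m w)) =
  (l == m)%:R * (t - s) * fine (P A).
Proof.
have [st'|st'] := eqVneq s t.
  move=> _; rewrite (dW0 l st') st' subrr mulr0 mul0r.
  under eq_Rintegral do rewrite mul0r mulr0.
  by rewrite /Rintegral integral0.
by apply: (dW_facts s0 _ tT).2; rewrite lt_neqAle st'.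
Qed.

End adapted_increment.

(** Stated on the measurable type generated by F_t, so that the closure properties of
    [measurable_fun] apply to adaptedness; [FmeasP] returns to preimages. *)
Definition Fmeas (t : R) (xi : Omega -> R) :=
  @measurable_fun _ _ (g_sigma_algebraType (past W t `|` P.-negligible)) R setT xi.

Lemma FmeasP t xi : Fmeas t xi <-> forall B, measurable B -> F t (xi @^-1` B).
Proof.
split => [h B mB|h _ B mB].
  by have := h measurableT B mB; rewrite setTI.
by rewrite setTI; exact: h.
Qed.

Lemma Fmeas_le s t xi : s <= t -> Fmeas s xi -> Fmeas t xi.
Proof.
by move=> st /FmeasP h; apply/FmeasP => B mB; apply: (filtration_sub st); exact: h.
Qed.

Lemma Fmeas_measurable t xi : t <= T -> Fmeas t xi -> measurable_fun setT xi.
Proof.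
move=> tT /FmeasP h _ B mB; rewrite setTI.
exact: (filtration_measurable tT (h B mB)).
Qed.

Lemma Fmeas_W r t l : 0 <= r -> r <= t -> t <= T -> Fmeas t (fun w => W r w l 0).
Proof.
move=> r0 rt tT; apply/FmeasP => B mB.
apply: sub_sigma_algebra; left.
exists r, ((fun A : 'cV[R]_d => A l 0) @^-1` B); split => //.
  by rewrite r0.
(* Applied to the identity of the Borel space of R^d, this says that a coordinate pulls Borel sets
   back to Borel sets. *)
have := @bmeas_mxP _ (g_sigma_algebraType (@open 'cV[R]_d)) R d 1 setT id l 0.
by move=> /(_ measurableT) /(_ (fun B bB => ltac:(rewrite setTI; exact: bB)))
  /(_ measurableT B mB); rewrite setTI.
Qed.

Lemma Fmeas_dW r r' t l : 0 <= r -> 0 <= r' -> r <= t -> r' <= t -> t <= T ->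
  Fmeas t (dW r r' l).
Proof. by move=> *; apply: measurable_funB; exact: Fmeas_W. Qed.

Lemma dW_mean_fun s t l xi : 0 <= s -> s <= t -> t <= T ->
  Fmeas s xi -> L2 P xi -> \int[P]_w (xi w * dW s t l w) = 0.
Proof.
move=> s0 st tT Fxi xi2; have hD := dW_L2 s0 st tT l.
apply: orthogonal_fun; [exact: L2_measurable xi2|exact: L2_L1|exact: L2M|].
by move=> B mB; apply: dW_mean => //; exact: (FmeasP s xi).1.
Qed.

(** The product of two increments is handled in [L1], hence the bound on [xi]. By [dW_cov], that
    product minus its mean is orthogonal to every event of F_s, and [orthogonal_fun] applies. *)
Lemma dW_cov_fun s t l m xi M : 0 <= s -> s <= t -> t <= T ->
  Fmeas s xi -> (forall w, `|xi w| <= M) ->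
  \int[P]_w (xi w * (dW s t l w * dW s t m w)) =
  (l == m)%:R * (t - s) * \int[P]_w xi w.
Proof.
move=> s0 st tT Fxi xiM; have hD := dW_L2 s0 st tT.
have sT := le_trans st tT; have mxi := Fmeas_measurable sT Fxi.
have xi2 : L2 P xi.
  by have := L2Mb (L2_cst P 1) mxi xiM; under eq_fun do rewrite mul1r.
set K := (l == m)%:R * (t - s).
have i1 : L1 P (fun w => xi w * (dW s t l w * dW s t m w)).
  under eq_fun do rewrite mulrA [X in X * _]mulrC.
  by apply: L2M => //; exact: (L2Mb (hD l) mxi xiM).
have i2 : L1 P (fun w => K * xi w) by apply: L1Zl; exact: L2_L1.
have iY : L1 P (fun w => dW s t l w * dW s t m w - K).
  by apply: L1B; [exact: L2M|exact: L1_cst].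
apply/eqP; rewrite -subr_eq0 -RintZl; last exact: L2_L1.
rewrite -RintB//; apply/eqP.
have e w : xi w * (dW s t l w * dW s t m w) - K * xi w =
  xi w * (dW s t l w * dW s t m w - K) by ring.
have := L1B i1 i2; under eq_fun do rewrite e.
move=> i3; apply: orthogonal_fun => // B mB.
have FB : F s (xi @^-1` B) by exact: (FmeasP s xi).1.
have mB' := filtration_measurable sT FB.
under eq_Rintegral do rewrite mulrBr [X in _ - X]mulrC.
rewrite RintB; [|by apply: L1_indicM => //; exact: L2M|by apply: L1Zl; exact: L1_indic].
rewrite RintZl; last exact: L1_indic.
by rewrite dW_cov// Rint_indic// subrr.
Qed.

End brownian_increments.

(** * Covariances of elementary stochastic integrals *)

Section elementary_integrals.
Context {R : realType} {disp : measure_display} {Omega : measurableType disp}.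
Variables (P : probability Omega R) (T : R) (d : nat).
Variable W : process (R := R) (Omega := Omega) d 1.
Hypotheses (P_complete : measure_is_complete P)
           (W_brownian : brownian_motion P T W).
Local Notation F := (filtration P W).
Local Notation Fmeas := (Fmeas P W).
Local Notation dW := (dW W).

Lemma L2_bounded_dW s t r l xi M : 0 <= s -> s <= t -> t <= T -> r <= T ->
  Fmeas r xi -> (forall w, `|xi w| <= M) -> L2 P (fun w => xi w * dW s t l w).
Proof.
move=> s0 st tT rT Fxi xiM; under eq_fun do rewrite mulrC.
by apply: (L2Mb _ _ xiM); [exact: (dW_L2 P_complete W_brownian)|
  exact: (Fmeas_measurable P_complete W_brownian rT Fxi)].
Qed.

Lemma FmeasM t xi eta : Fmeas t xi -> Fmeas t eta ->
  Fmeas t (fun w => xi w * eta w).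
Proof. exact: measurable_funM. Qed.

(** For y <= y', the increment up to y' is the one up to y plus a later one, which is orthogonal to
    everything known at y. *)
Lemma dW_cov_same r y y' l m xi M : 0 <= r -> r <= y -> y <= T -> r <= y' ->
  y' <= T -> Fmeas r xi -> (forall w, `|xi w| <= M) ->
  \int[P]_w (xi w * (dW r y l w * dW r y' m w)) =
  (l == m)%:R * (Num.min y y' - r) * \int[P]_w xi w.
Proof.
wlog yy' : y y' l m / y <= y' => [H r0 ry yT ry' y'T Fxi xiM|].
  have [yy'|/ltW yy'] := leP y y'.
    by have := H y y' l m yy' r0 ry yT ry' y'T Fxi xiM; rewrite min_l.
  have := H y' y m l yy' r0 ry' y'T ry yT Fxi xiM; rewrite min_l//.
  rewrite eq_sym => <-.
  by apply: eq_Rintegral => w _; rewrite [dW r y l w * _]mulrC.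
rewrite min_l// => r0 ry yT ry' y'T Fxi xiM.
have rT := le_trans ry yT; have y0 := le_trans r0 ry.
have D1 := dW_L2 P_complete W_brownian r0 ry yT.
have D2 := dW_L2 P_complete W_brownian y0 yy' y'T.
have xiD : L2 P (fun w => xi w * dW r y l w) by exact: (L2_bounded_dW l r0 ry yT rT Fxi xiM).
rewrite -(dW_cov_fun P_complete W_brownian l m r0 ry yT Fxi xiM).
have z : \int[P]_w ((xi w * dW r y l w) * dW y y' m w) = 0.
  apply: (dW_mean_fun P_complete W_brownian) => //.
  by apply: FmeasM; [exact: Fmeas_le Fxi|apply: (Fmeas_dW (T := T))].
rewrite -[RHS]addr0 -z -RintD; last 2 first.
- by under eq_fun do rewrite mulrA; exact: L2M.
- exact: L2M.
by apply: eq_Rintegral => w _; rewrite /dW; ring.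
Qed.

(** Length of the intersection of ]a, b] and ]a', b']; the maximum with 0 covers disjoint
    intervals. *)
Definition overlap (a b a' b' : R) := Num.max 0 (Num.min b b' - Num.max a a').

Lemma overlapC a b a' b' : overlap a b a' b' = overlap a' b' a b.
Proof. by rewrite /overlap minC [Num.max a _]maxC. Qed.

(** Take a <= a'. If b <= a', everything but the second increment is known at a', so the mean is 0.
    Otherwise ]a, b] is cut at a'; the part before a' is again orthogonal, and [dW_cov_same] treats
    the rest. With arbitrary intervals allowed, two step processes can be compared without a common
    partition. *)
Lemma elementary_cov a b c l M a' b' c' m M' :
  0 <= a -> a <= b -> b <= T -> 0 <= a' -> a' <= b' -> b' <= T ->
  Fmeas a c -> (forall w, `|c w| <= M) ->
  Fmeas a' c' -> (forall w, `|c' w| <= M') ->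
  \int[P]_w ((c w * dW a b l w) * (c' w * dW a' b' m w)) =
  (l == m)%:R * overlap a b a' b' * \int[P]_w (c w * c' w).
Proof.
wlog aa' : a b c l M a' b' c' m M' / a <= a'.
  move=> H a0 ab bT a'0 a'b' b'T Fc cM Fc' cM'.
  have [aa'|/ltW a'a] := leP a a'; first exact: (H _ _ _ _ M _ _ _ _ M').
  rewrite overlapC eq_sym.
  have -> : \int[P]_w (c w * c' w) = \int[P]_w (c' w * c w).
    by apply: eq_Rintegral => w _; rewrite mulrC.
  rewrite -(H a' b' c' m M' a b c l M)//.
  by apply: eq_Rintegral => w _; rewrite mulrC.
move=> a0 ab bT a'0 a'b' b'T Fc cM Fc' cM'.
have aT := le_trans ab bT; have a'T := le_trans a'b' b'T.
have Fc2 := Fmeas_le aa' Fc.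
have FD r r' i : 0 <= r -> 0 <= r' -> r <= a' -> r' <= a' -> Fmeas a' (dW r r' i).
  by move=> *; exact: (Fmeas_dW (T := T)).
have cc'M w : `|c w * c' w| <= M * M' by rewrite normrM ler_pM.
have Fcc' : Fmeas a' (fun w => c w * c' w) by exact: FmeasM.
have [ba'|/ltW a'b] := leP b a'.
  rewrite /overlap max_l; last first.
    by rewrite subr_le0 ge_min le_max ba' orbT.
  rewrite mulr0 mul0r.
  under eq_Rintegral do rewrite mulrA [X in X * _]mulrAC.
  apply: (dW_mean_fun P_complete W_brownian) => //.
    by apply: FmeasM => //; apply: FD => //; exact: le_trans ab.
  exact: (L2_bounded_dW l a0 ab bT a'T Fcc' cc'M).
have -> : overlap a b a' b' = Num.min b b' - a'.
  by rewrite /overlap (max_r aa') max_r// subr_ge0 le_min a'b.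
rewrite -(dW_cov_same l m a'0 a'b bT a'b' b'T Fcc' cc'M).
have D0 := L2_bounded_dW l a0 aa' a'T a'T Fcc' cc'M.
have D1 := L2_bounded_dW l a'0 a'b bT a'T Fcc' cc'M.
have D2 := dW_L2 P_complete W_brownian a'0 a'b' b'T m.
have z : \int[P]_w ((c w * c' w * dW a a' l w) * dW a' b' m w) = 0.
  apply: (dW_mean_fun P_complete W_brownian) => //.
  by apply: FmeasM => //; apply: FD.
rewrite -[RHS]addr0 -z -RintD; last 2 first.
- by under eq_fun do rewrite mulrA; exact: L2M.
- exact: L2M.
by apply: eq_Rintegral => w _; rewrite /dW; ring.
Qed.

(* The subtracted increment is the part of ]a, b] before t. *)
Lemma elementary_mean a b c l M t xi : 0 <= a -> a <= b -> b <= T ->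
  0 <= t -> t <= T -> Fmeas a c -> (forall w, `|c w| <= M) ->
  Fmeas t xi -> L2 P xi ->
  \int[P]_w (xi w * (c w * (dW a b l w - dW (Num.min a t) (Num.min b t) l w))) = 0.
Proof.
move=> a0 ab bT t0 tT Fc cM Fxi xi2.
have aT := le_trans ab bT; have b0 := le_trans a0 ab.
pose a' := Num.max a t; pose b' := Num.max b t.
have e w : xi w * (c w * (dW a b l w - dW (Num.min a t) (Num.min b t) l w)) =
    (xi w * c w) * dW a' b' l w.
  rewrite -mulrA; congr (_ * (_ * _)); rewrite /dW /a' /b'.
  by case: (leP a t); case: (leP b t) => *; rewrite ?subrr ?opprB; ring.
under eq_Rintegral do rewrite e.
apply: (dW_mean_fun P_complete W_brownian).
- by rewrite le_max a0.
- by rewrite ge_max !le_max lexx ab orbT.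
- by rewrite ge_max bT.
- apply: FmeasM; first by apply: Fmeas_le Fxi; rewrite le_max lexx orbT.
  by apply: Fmeas_le Fc; rewrite le_max lexx.
- apply: (L2Mb xi2 _ cM).
  exact: (Fmeas_measurable P_complete W_brownian aT Fc).
Qed.

End elementary_integrals.

(** * Fubini's theorem for real-valued integrals *)

Section fubini_real.
Context d1 d2 (X : measurableType d1) (Y : measurableType d2) (R : realType).
Variables (m1 : {sigma_finite_measure set X -> \bar R})
          (m2 : {sigma_finite_measure set Y -> \bar R}).
Local Notation pi := (m1 \x m2)%E.

(** Iterated [Rintegral]s apply [fine] to the inner integral; this changes nothing almost
    everywhere, an integrable function being finite almost everywhere. *)
Let fineK_ae d (Z : measurableType d) (m : {measure set Z -> \bar R})
    (g : Z -> \bar R) : m.-integrable setT g ->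
  L1 m (fine \o g) /\ (\int[m]_x (fine (g x))%:E = \int[m]_x g x)%E.
Proof.
move=> hg; have mg := measurable_int m hg.
have mfg : measurable_fun setT (EFin \o (fine \o g)).
  by apply/measurable_EFinP; exact: measurableT_comp.
have e : ae_eq m setT (EFin \o (fine \o g)) g.
  have := integrable_ae measurableT hg.
  by apply: filterS => x /= /(_ I) h _; rewrite fineK.
split; last exact: ae_eq_integral.
apply/integrableP; split => //.
move/integrableP : hg => [_]; apply: le_lt_trans.
apply: ge0_le_integral => //; try exact: measurableT_comp.
move=> x _ /=; case: (g x) => [r| |]/=; rewrite ?normr0 ?leey//.
Qed.

Lemma integrable_fubini_snd (f : X * Y -> \bar R) : pi.-integrable setT f ->
  m2.-integrable setT (fubini_G m1 f).
Proof.
move=> hf; have mf := measurable_int pi hf.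
have mg : measurable_fun setT (fun z : Y * X => f (z.2, z.1)).
  by apply: (measurableT_comp mf); exact: measurable_swap.
have hg : (m2 \x m1)%E.-integrable setT (fun z : Y * X => f (z.2, z.1)).
  by apply/integrable12ltyP => //; apply/integrable21ltyP.
exact: integrable_fubini_F hg.
Qed.

Lemma L1_fubini1 (f : X * Y -> R) : L1 pi f ->
  L1 m1 (fun x => \int[m2]_y f (x, y)).
Proof. by move=> hf; have [] := fineK_ae (integrable_fubini_F hf). Qed.

Lemma L1_fubini2 (f : X * Y -> R) : L1 pi f ->
  L1 m2 (fun y => \int[m1]_x f (x, y)).
Proof. by move=> hf; have [] := fineK_ae (integrable_fubini_snd hf). Qed.

Lemma Rint_fubini1 (f : X * Y -> R) : L1 pi f ->
  \int[pi]_z f z = \int[m1]_x \int[m2]_y f (x, y).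
Proof.
move=> hf; have [_ e] := fineK_ae (integrable_fubini_F hf).
by rewrite [RHS]/Rintegral e (integral12_prod_meas1 hf).
Qed.

Lemma Rint_fubini2 (f : X * Y -> R) : L1 pi f ->
  \int[pi]_z f z = \int[m2]_y \int[m1]_x f (x, y).
Proof.
move=> hf; have [_ e] := fineK_ae (integrable_fubini_snd hf).
by rewrite [RHS]/Rintegral e (integral21_prod_meas1 hf).
Qed.

Lemma ae_L1_section1 (f : X * Y -> R) : L1 pi f ->
  {ae m1, forall x, L1 m2 (fun y => f (x, y))}.
Proof. exact: ae_integrable1. Qed.

Lemma ae_L1_section2 (f : X * Y -> R) : L1 pi f ->
  {ae m2, forall y, L1 m1 (fun x => f (x, y))}.
Proof. exact: ae_integrable2. Qed.

Lemma measurable_section1 (f : X * Y -> R) x : measurable_fun setT f ->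
  measurable_fun setT (fun y => f (x, y)).
Proof. by move=> mf; exact: measurableT_comp. Qed.

Lemma measurable_section2 (f : X * Y -> R) y : measurable_fun setT f ->
  measurable_fun setT (fun x => f (x, y)).
Proof. by move=> mf; exact: measurableT_comp. Qed.

Lemma ae_L2_section1 (f : X * Y -> R) : L2 pi f ->
  {ae m1, forall x, L2 m2 (fun y => f (x, y))}.
Proof.
move=> [mf hf]; apply: filterS (ae_L1_section1 hf) => x hx.
by split => //; exact: measurable_section1.
Qed.

Lemma ae_L2_section2 (f : X * Y -> R) : L2 pi f ->
  {ae m2, forall y, L2 m1 (fun x => f (x, y))}.
Proof.
move=> [mf hf]; apply: filterS (ae_L1_section2 hf) => x hx.
by split => //; exact: measurable_section2.
Qed.

Lemma L1_tensor (f : X -> R) (g : Y -> R) : L1 m1 f -> L1 m2 g ->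
  L1 pi (fun z => f z.1 * g z.2) /\
  \int[pi]_z (f z.1 * g z.2) = \int[m1]_x f x * \int[m2]_y g y.
Proof.
move=> hf hg; have mf := L1_measurable hf; have mg := L1_measurable hg.
have m : measurable_fun setT (fun z : X * Y => f z.1 * g z.2).
  by apply: measurable_funM; exact: measurableT_comp.
have h : L1 pi (fun z => f z.1 * g z.2).
  apply/integrable12ltyP; first exact/measurable_EFinP.
  under eq_integral => x _.
    under eq_integral => y _ do rewrite /= normrM EFinM.
    rewrite ge0_integralZl//; last first.
      by apply/measurable_EFinP; exact: measurableT_comp.
    over.
  rewrite /= ge0_integralZr//; last 2 first.
  - by apply/measurable_EFinP; exact: measurableT_comp.
  - exact: integral_ge0.
  move/integrableP : hf => [_ hf]; move/integrableP : hg => [_ hg].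
  rewrite lte_mul_pinfty//; first exact: integral_ge0.
  by rewrite ge0_fin_numE//; exact: integral_ge0.
split => //; rewrite Rint_fubini1//=.
under eq_Rintegral => x _ do rewrite RintZl//.
by rewrite RintegralZr.
Qed.

Lemma L2_tensor (f : X -> R) (g : Y -> R) : L2 m1 f -> L2 m2 g ->
  L2 pi (fun z => f z.1 * g z.2).
Proof.
move=> [mf hf] [mg hg]; split.
  by apply: measurable_funM; exact: measurableT_comp.
have [h _] := L1_tensor hf hg.
by apply: eq_integrable h => // z _ /=; rewrite exprMn.
Qed.

End fubini_real.

Lemma cvgL2_le d (X : measurableType d) (R : realType)
  (m : {measure set X -> \bar R}) (D : nat -> X -> R) (g : nat -> X -> \bar R) :
  (forall N, L2 m (D N)) -> (forall N, measurable_fun setT (g N)) ->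
  (forall N x, ((D N x ^+ 2)%:E <= g N x)%E) ->
  (\int[m]_x g N x)%E @[N --> \oo] --> 0%E ->
  \int[m]_x (D N x ^+ 2) @[N --> \oo] --> (0 : R).
Proof.
move=> hD mg Dg h.
apply: (@fine_cvg _ _ _ _ _ 0); apply: (squeeze_cvge _ (cvg_cst 0%E) h).
apply: nearW => N; apply/andP; split.
  by apply: integral_ge0 => x _; rewrite lee_fin sqr_ge0.
apply: ge0_le_integral => //.
- by move=> x _; rewrite lee_fin sqr_ge0.
- by apply/measurable_EFinP; exact: (L1_measurable (hD N).2).
Qed.

Lemma fnorm_sqr (R : realType) r c (A : 'M[R]_(r, c)) :
  fnorm A ^+ 2 = \sum_i \sum_j A i j ^+ 2.
Proof.
rewrite sqr_sqrtr//; apply: sumr_ge0 => i _; apply: sumr_ge0 => j _.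
exact: sqr_ge0.
Qed.

Lemma fnorm_ge0 (R : realType) r c (A : 'M[R]_(r, c)) : 0 <= fnorm A.
Proof. exact: sqrtr_ge0. Qed.

Lemma entry_sqr_le (R : realType) r c (A : 'M[R]_(r, c)) i j :
  A i j ^+ 2 <= fnorm A ^+ 2.
Proof.
rewrite fnorm_sqr (bigD1 i)//= (bigD1 j)//= -addrA lerDl addr_ge0//.
  by apply: sumr_ge0 => k _; exact: sqr_ge0.
by apply: sumr_ge0 => l _; apply: sumr_ge0 => k _; exact: sqr_ge0.
Qed.

Lemma entry_le (R : realType) r c (A : 'M[R]_(r, c)) i j : `|A i j| <= fnorm A.
Proof.
have := entry_sqr_le A i j.
by rewrite -(real_normK (num_real (A i j))) ler_pXn2r ?nnegrE ?fnorm_ge0.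
Qed.

Lemma measurable_fnorm_sqr (R : realType) d (X : measurableType d) (E : set X)
  r c (A : X -> 'M[R]_(r, c)) :
  (forall i j, measurable_fun E (fun x => A x i j)) ->
  measurable_fun E (fun x => fnorm (A x) ^+ 2).
Proof.
move=> mA; under eq_fun do rewrite fnorm_sqr.
apply: measurable_sum => i; apply: measurable_sum => j.
exact: measurable_funX.
Qed.

(** * Processes on [0, T] as functions on the product space *)

Section truncation.
Context {R : realType} {disp : measure_display} {Omega : measurableType disp}.
Variables (P : probability Omega R) (T : R).
Local Notation mu := (@lebesgue_measure R).
Local Notation pi := (mu \x P)%E.
Local Notation E := (`[0, T] `*` [set: Omega]).

(** Extension by 0 outside [0, T]: integrals over [0, T] x Omega become integrals over the whole
    product space, where the Fubini lemmas are stated. *)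
Definition trunc (g : R -> Omega -> R) : measurableTypeR R * Omega -> R :=
  fun z => \1_(`[0, T]) z.1 * g z.1 z.2.

Lemma trunc_in g t w : 0 <= t <= T -> trunc g (t, w) = g t w.
Proof. by move=> tT; rewrite /trunc/= indicE mem_set ?mul1r//= in_itv. Qed.

Lemma trunc_out g t w : ~~ (0 <= t <= T) -> trunc g (t, w) = 0.
Proof.
move=> tT; rewrite /trunc/= indicE memNset ?mul0r//= in_itv/=.
exact/negP.
Qed.

Lemma measurable_trunc (g : R -> Omega -> R) :
  measurable_fun E (fun z : R * Omega => g z.1 z.2) ->
  measurable_fun setT (trunc g).
Proof.
move=> mg.
have -> : trunc g = (fun z : R * Omega => g z.1 z.2) \_ E.
  apply/funext => -[t w]; rewrite patchE /trunc indicE/=.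
  have -> : ((t, w) \in E) = (t \in `[0, T]%classic).
    by apply/idP/idP; rewrite !inE/=; [case|split].
  by case: ifP; rewrite ?mul1r ?mul0r.
apply/(measurable_restrictT _ _).1 => //.
by apply: measurableX.
Qed.

Lemma measurable_of_trunc (g : R -> Omega -> R) :
  measurable_fun setT (trunc g) ->
  measurable_fun E (fun z : R * Omega => g z.1 z.2).
Proof.
move=> mg; apply: (eq_measurable_fun (trunc g)); last exact: measurable_funTS.
by move=> [t w]; rewrite inE => -[/= + _]; rewrite in_itv/= => /trunc_in->.
Qed.


Lemma integral_trunc (g : R -> Omega -> R) w :
  (\int[mu]_t (trunc g (t, w))%:E = \int[mu]_(t in `[0%R, T]) (g t w)%:E)%E.
Proof.
rewrite [RHS]integral_mkcond; apply: eq_integral => t _.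
by rewrite patchE /trunc indicE/=; case: ifP; rewrite ?mul1r ?mul0r.
Qed.

Lemma trunc_ge0 g z : (forall t w, 0 <= g t w) -> 0 <= trunc g z.
Proof. by move=> g0; rewrite mulr_ge0. Qed.

Lemma integral_pi_trunc (g : R -> Omega -> R) :
  measurable_fun setT (trunc g) -> (forall t w, 0 <= g t w) ->
  (\int[pi]_z (trunc g z)%:E =
   \int[P]_w \int[mu]_(t in `[0%R, T]) (g t w)%:E)%E.
Proof.
move=> mg g0; have mE : measurable_fun setT (EFin \o trunc g) by exact/measurable_EFinP.
have E0 z : (0 <= (EFin \o trunc g) z)%E by rewrite lee_fin trunc_ge0.
etransitivity; first exact: (@fubini_tonelli2 _ _ _ _ R mu P _ mE E0).
by apply: eq_integral => w _; exact: integral_trunc.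
Qed.

Lemma L1_trunc (g : R -> Omega -> R) : measurable_fun setT (trunc g) ->
  (forall t w, 0 <= g t w) ->
  (\int[P]_w \int[mu]_(t in `[0%R, T]) (g t w)%:E < +oo)%E -> L1 pi (trunc g).
Proof.
move=> mg g0 h; apply/integrableP; split; first exact/measurable_EFinP.
rewrite -(integral_pi_trunc mg g0) in h; apply: le_lt_trans h.
rewrite le_eqVlt; apply/orP; left; apply/eqP; apply: eq_integral => z _ /=.
by rewrite ger0_norm// trunc_ge0.
Qed.

Lemma truncX g n z : (0 < n)%N -> trunc (fun t w => g t w ^+ n) z = trunc g z ^+ n.
Proof.
move=> n0; rewrite /trunc exprMn indicE.
by case: (_ \in _); rewrite ?expr1n// expr0n gtn_eqF.
Qed.

Section L2F_components.
Variables (d : nat) (W : process (R := R) (Omega := Omega) d 1).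
Variables (r c : nat) (y : process (R := R) (Omega := Omega) r c).

Lemma jointly_measurable_comp i j : jointly_measurable T y ->
  measurable_fun E (fun z : R * Omega => y z.1 z.2 i j).
Proof.
move=> my; apply: (@bmeas_mxP _ _ R _ _ E (fun z : R * Omega => y z.1 z.2)).
  exact: measurableX.
exact: my.
Qed.

Lemma measurable_trunc_fnorm : jointly_measurable T y ->
  measurable_fun setT (trunc (fun t w => fnorm (y t w) ^+ 2)).
Proof.
move=> my; apply: measurable_trunc; apply: measurable_fnorm_sqr => i j.
exact: jointly_measurable_comp.
Qed.

Lemma L2F_L2 i j : L2F P T W y -> L2 pi (trunc (fun t w => y t w i j)).
Proof.
move=> [_ my hy].
have h : L1 pi (trunc (fun t w => fnorm (y t w) ^+ 2)).
  apply: L1_trunc => //; first exact: measurable_trunc_fnorm.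
  by move=> t w; exact: sqr_ge0.
apply: L2_le h; first by apply: measurable_trunc; exact: jointly_measurable_comp.
by move=> z; rewrite -truncX// /trunc ler_wpM2l// entry_sqr_le.
Qed.

End L2F_components.

End truncation.

(** * The Ito integral *)

Section step_processes.
Context {R : realType} {disp : measure_display} {Omega : measurableType disp}.
Variables (P : probability Omega R) (T : R) (d : nat).
Variable W : process (R := R) (Omega := Omega) d 1.
Hypotheses (P_complete : measure_is_complete P)
           (W_brownian : brownian_motion P T W).
Local Notation mu := (@lebesgue_measure R).
Local Notation pi := (mu \x P)%E.
Local Notation F := (filtration P W).
Local Notation Fmeas := (Fmeas P W).
Local Notation dW := (dW W).

Lemma Rint_overlap (a b a' b' : R) :
  \int[mu]_t (\1_(`]a, b]) t * \1_(`]a', b']) t) = overlap a b a' b'.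
Proof.
have -> : \int[mu]_t (\1_(`]a, b]) t * \1_(`]a', b']) t) =
    \int[mu]_t \1_(`]Num.max a a', Num.min b b']) t.
  apply: eq_Rintegral => t _; rewrite !indicE -natrM mulnb; congr (_%:R).
  rewrite -in_setI; congr (nat_of_bool (_ \in _)); apply/seteqP.
  split => x /=; rewrite !in_itv/= gt_max le_min.
    by move=> [/andP[-> ->] /andP[-> ->]].
  by move=> /andP[/andP[-> ->] /andP[-> ->]].
rewrite /Rintegral integral_indic//= setIT lebesgue_measure_itv/= lte_fin.
rewrite /overlap; have [h|h] := ltP (Num.max a a') (Num.min b b').
  by rewrite [RHS]max_r// subr_ge0 ltW.
by rewrite [RHS]max_l// subr_le0.
Qed.

Lemma L2_indic_itv (a b : R) : L2 mu (\1_(`]a, b])).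
Proof.
split => //; have := @integrable_indic_itv R a b false false.
by apply: eq_integrable => // t _ /=; rewrite indicE; case: (_ \in _);
  rewrite ?expr1n ?expr0n.
Qed.

Section one_step_process.
Variables (r : nat) (S : step_process (R := R) (Omega := Omega) d r).
Hypothesis S_adapted : step_adapted P T W S.
Local Notation n := (sp_size S).

Lemma step_coefP (j : 'I_n) i l :
  [/\ 0 <= sp_time S j, sp_time S j <= sp_time S j.+1, sp_time S j.+1 <= T,
      Fmeas (sp_time S j) (fun w => sp_coef S j w i l) &
      exists M, forall w, `|sp_coef S j w i l| <= M].
Proof.
have [h1 h2 h3 h4 [M h5]] := S_adapted (ltn_ord j); split => //.
  apply: (@bmeas_mxP _ _ R _ _ setT) => // B bB.
  by rewrite setTI; exact: h4.
by exists M => w; apply: le_trans (h5 w); exact: entry_le.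
Qed.

Lemma step_coef_L2 (j : 'I_n) i l : L2 P (fun w => sp_coef S j w i l).
Proof.
have [h1 h2 h3 h4 [M h5]] := step_coefP j i l.
have := L2Mb (L2_cst P 1) (Fmeas_measurable P_complete W_brownian
  (le_trans h2 h3) h4) h5.
by under eq_fun do rewrite mul1r.
Qed.

Lemma step_integralE t w i :
  step_integral W S t w i 0 = \sum_(p : 'I_n * 'I_d)
    sp_coef S p.1 w i p.2 *
    dW (Num.min (sp_time S p.1) t) (Num.min (sp_time S p.1.+1) t) p.2 w.
Proof.
rewrite /step_integral summxE -(pair_bigA _ (fun (j : 'I_n) (l : 'I_d) => sp_coef S j w i l *
    dW (Num.min (sp_time S j) t) (Num.min (sp_time S j.+1) t) l w)).
by apply: eq_bigr => j _; rewrite mxE; apply: eq_bigr => l _; rewrite !mxE.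
Qed.

Lemma step_integralTE w i :
  step_integral W S T w i 0 = \sum_(p : 'I_n * 'I_d)
    sp_coef S p.1 w i p.2 * dW (sp_time S p.1) (sp_time S p.1.+1) p.2 w.
Proof.
rewrite step_integralE; apply: eq_bigr => -[j l] _ /=.
have [h1 h2 h3 h4 [M h5]] := step_coefP j i l.
by rewrite !min_l// (le_trans h2).
Qed.

(** The intervals of an adapted step process lie in [0, T], so truncation has no effect. *)
Lemma step_valE z i l : trunc T (fun t w => step_val S t w i l) z =
  \sum_(j < n) \1_(`]sp_time S j, sp_time S j.+1]) z.1 * sp_coef S j z.2 i l.
Proof.
rewrite /trunc /step_val summxE mulr_sumr; apply: eq_bigr => j _.
have [h1 h2 h3 h4 _] := step_coefP j i l.
rewrite !mxE mulrA; congr (_ * _).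
rewrite !indicE -natrM mulnb; congr (_%:R).
have [|] := boolP (z.1 \in `]sp_time S j, sp_time S j.+1]%classic);
  last by rewrite andbF.
rewrite andbT !inE/= !in_itv/= => /andP[/ltW u1 u2].
by rewrite mem_set//= in_itv/= (le_trans h1 u1) (le_trans u2).
Qed.

Lemma step_integral_L2 t i : 0 <= t <= T ->
  L2 P (fun w => step_integral W S t w i 0).
Proof.
move=> /andP[t0 tT]; under eq_fun do rewrite step_integralE.
apply: L2_sum => -[j l] _ /=.
have [h1 h2 h3 h4 [M h5]] := step_coefP j i l.
apply: (L2_bounded_dW P_complete W_brownian _ _ _ _ (le_trans h2 h3) h4 h5).
- by rewrite le_min h1.
- by rewrite le_min !ge_min h2 lexx orbT.
- by rewrite ge_min tT orbT.
Qed.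

Lemma step_val_L2 i l : L2 pi (trunc T (fun t w => step_val S t w i l)).
Proof.
rewrite (funext (fun z => step_valE z i l)).
apply: L2_sum => j _.
exact: (L2_tensor (L2_indic_itv (sp_time S j) (sp_time S j.+1)) (step_coef_L2 j i l)).
Qed.

Lemma step_martingale t i xi : 0 <= t <= T -> Fmeas t xi -> L2 P xi ->
  \int[P]_w (xi w * (step_integral W S T w i 0 - step_integral W S t w i 0)) = 0.
Proof.
move=> /andP[t0 tT] Fxi xi2.
have e w : xi w * (step_integral W S T w i 0 - step_integral W S t w i 0) =
  \sum_(p : 'I_n * 'I_d) xi w * (sp_coef S p.1 w i p.2 *
     (dW (sp_time S p.1) (sp_time S p.1.+1) p.2 w -
      dW (Num.min (sp_time S p.1) t) (Num.min (sp_time S p.1.+1) t) p.2 w)).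
  rewrite step_integralTE step_integralE -sumrB mulr_sumr.
  by apply: eq_bigr => p _; ring.
under eq_Rintegral do rewrite e.
have T0 : 0 <= T by exact: le_trans tT.
rewrite Rint_sum => [|[j l] _].
  apply: big1 => -[j l] _ /=.
  have [h1 h2 h3 h4 [M h5]] := step_coefP j i l.
  exact: (elementary_mean P_complete W_brownian _ h1 h2 h3 t0 tT h4 h5).
have [h1 h2 h3 h4 [M h5]] := step_coefP j i l => /=.
apply: (L2M xi2); under eq_fun do rewrite mulrBr.
have h6 := le_trans h2 h3.
apply: L2B; apply: (L2_bounded_dW P_complete W_brownian _ _ _ _ h6 h4 h5) => //.
- by rewrite le_min h1.
- by rewrite le_min !ge_min h2 lexx orbT.
- by rewrite ge_min tT orbT.
Qed.

End one_step_process.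

(** Both sides expand into overlap lengths times E(c c'): on the left by [elementary_cov], where
    distinct components of W contribute 0, on the right because a product of time indicators and
    random coefficients integrates to a product. *)
Lemma step_isometry r r' (S : step_process d r) (S' : step_process d r') i i' :
  step_adapted P T W S -> step_adapted P T W S' ->
  \int[P]_w (step_integral W S T w i 0 * step_integral W S' T w i' 0) =
  \sum_l \int[pi]_z (trunc T (fun t w => step_val S t w i l) z *
                     trunc T (fun t w => step_val S' t w i' l) z).
Proof.
move=> hS hS'.
pose c j l w := sp_coef S j w i l; pose c' j l w := sp_coef S' j w i' l.
pose Q j l j' m := overlap (sp_time S j) (sp_time S j.+1)
    (sp_time S' j') (sp_time S' j'.+1) * \int[P]_w (c j l w * c' j' m w).
transitivity (\sum_(l < d) \sum_(j < sp_size S) \sum_(j' < sp_size S') Q j l j' l).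
  under eq_Rintegral do rewrite (step_integralTE hS) (step_integralTE hS') big_distrlr.
  have L2p (p : 'I_(sp_size S) * 'I_d) : L2 P (fun w => sp_coef S p.1 w i p.2 *
      dW (sp_time S p.1) (sp_time S p.1.+1) p.2 w).
    have [h1 h2 h3 h4 [M h5]] := step_coefP hS p.1 i p.2.
    exact: (L2_bounded_dW P_complete W_brownian _ h1 h2 h3 (le_trans h2 h3) h4 h5).
  have L2p' (p : 'I_(sp_size S') * 'I_d) : L2 P (fun w => sp_coef S' p.1 w i' p.2 *
      dW (sp_time S' p.1) (sp_time S' p.1.+1) p.2 w).
    have [h1 h2 h3 h4 [M h5]] := step_coefP hS' p.1 i' p.2.
    exact: (L2_bounded_dW P_complete W_brownian _ h1 h2 h3 (le_trans h2 h3) h4 h5).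
  rewrite Rint_sum; last by move=> p _; apply: L1_sum => p' _; exact: L2M.
  transitivity (\sum_(p : 'I_(sp_size S) * 'I_d) \sum_(p' : 'I_(sp_size S') * 'I_d)
      (p.2 == p'.2)%:R * Q p.1 p.2 p'.1 p'.2).
    apply: eq_bigr => p _; rewrite Rint_sum; last by move=> p' _; exact: L2M.
    apply: eq_bigr => p' _.
    have [h1 h2 h3 h4 [M h5]] := step_coefP hS p.1 i p.2.
    have [g1 g2 g3 g4 [N g5]] := step_coefP hS' p'.1 i' p'.2.
    by rewrite (elementary_cov P_complete W_brownian _ _ h1 h2 h3 g1 g2 g3 h4 h5 g4 g5) /Q mulrA.
  rewrite -(pair_bigA _ (fun (j : 'I_(sp_size S)) (l : 'I_d) => \sum_(p' : 'I_(sp_size S') * 'I_d)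
      (l == p'.2)%:R * Q j l p'.1 p'.2)) exchange_big/=.
  apply: eq_bigr => l _; apply: eq_bigr => j _.
  rewrite -(pair_bigA _ (fun (j' : 'I_(sp_size S')) (m : 'I_d) => (l == m)%:R * Q j l j' m))/=.
  apply: eq_bigr => j' _; rewrite (bigD1 l)//= eqxx mul1r big1 ?addr0// => m.
  by rewrite eq_sym => /negbTE ->; rewrite mul0r.
apply: eq_bigr => l _.
under [RHS]eq_Rintegral do rewrite (step_valE hS) (step_valE hS') big_distrlr/=.
have hz (j : 'I_(sp_size S)) (j' : 'I_(sp_size S')) :
    L1 pi (fun z => (\1_(`]sp_time S j, sp_time S j.+1]) z.1 * sp_coef S j z.2 i l) *
    (\1_(`]sp_time S' j', sp_time S' j'.+1]) z.1 * sp_coef S' j' z.2 i' l)) .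
  exact: (L2M (L2_tensor (L2_indic_itv _ _) (step_coef_L2 hS j i l))
              (L2_tensor (L2_indic_itv _ _) (step_coef_L2 hS' j' i' l))).
rewrite Rint_sum; last by move=> j _; apply: L1_sum => j' _; exact: hz.
apply: eq_bigr => j _; rewrite Rint_sum; last by move=> j' _; exact: hz.
apply: eq_bigr => j' _; rewrite /Q -Rint_overlap.
have [_ <-] := L1_tensor
  (L2M (L2_indic_itv (sp_time S j) (sp_time S j.+1))
       (L2_indic_itv (sp_time S' j') (sp_time S' j'.+1)))
  (L2M (step_coef_L2 hS j i l) (step_coef_L2 hS' j' i' l)).
by apply: eq_Rintegral => z _; rewrite /c /c'; ring.
Qed.

End step_processes.

Lemma cvg_sumr (R : realType) (I : Type) (s : seq I) (F : I -> nat -> R)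
    (l : I -> R) : (forall i, F i N @[N --> \oo] --> l i) ->
  \sum_(i <- s) F i N @[N --> \oo] --> \sum_(i <- s) l i.
Proof.
move=> Fl; elim: s => [|i s ih].
  by rewrite big_nil; under eq_fun do rewrite big_nil; exact: cvg_cst.
by rewrite big_cons; under eq_fun do rewrite big_cons; exact: cvgD.
Qed.

(** * Directional derivatives and tangent inequalities *)

Section derivatives.
Context (R : realType).

Lemma seq_limit_ge (u : nat -> R) l c : u n @[n --> \oo] --> l ->
  (forall n, c <= u n) -> c <= l.
Proof.
move=> ul cu; rewrite -(cvg_lim (@norm_hausdorff _ R) ul).
by apply: limr_ge; [apply/cvg_ex; exists l|exact: nearW].
Qed.

(** A sequential form, because pointwise limits of sequences preserve measurability and bounds; the
    successor keeps the step meaningful at N = 0. *)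
Lemma derive_seq (V : normedModType R) (g : V -> R) (x v : V) :
  derivable g x v ->
  N.+1%:R * (g (x + (N.+1%:R)^-1 *: v) - g x) @[N --> \oo] --> 'D_v g x.
Proof.
move=> dg.
have h0 : (N.+1%:R)^-1 @[N --> \oo] --> (0 : R)^'.
  move=> A hA.
  have h : \forall N \near \oo, (N.+1%:R^-1 != 0 :> R) -> A (N.+1%:R^-1).
    exact: (@cvg_harmonic R _ hA).
  by apply: (@filterS nat \oo _ _ _ _ h) => N; apply; rewrite invr_eq0.
have := cvg_comp _ _ h0 dg; rewrite -/('D_v g x).
apply: cvg_trans; apply: near_eq_cvg; apply: nearW => N /=.
by rewrite invrK /GRing.scale/= [x + _]addrC.
Qed.

Lemma convex_functionP (E : lmodType R) (D : set E) (f : E -> R) x y (t : R) :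
  convex_function D f -> D x -> D y -> 0 <= t -> t <= 1 ->
  f (t *: x + (1 - t) *: y) <= t * f x + (1 - t) * f y.
Proof.
move=> cf Dx Dy t0 t1.
exact: (cf (Itv01 t0 t1) x y (mem_set Dx) (mem_set Dy)).
Qed.

(** By concavity every difference quotient at x in the direction y - x with step 1/(N + 1) already
    dominates g y - g x. *)
Lemma concave_tangent (V : normedModType R) (g : V -> R) (x y : V) :
  (forall t : R, 0 <= t -> t <= 1 ->
     - g (t *: y + (1 - t) *: x) <= t * - g y + (1 - t) * - g x) ->
  derivable g x (y - x) ->
  g y - g x <= 'D_(y - x) g x.
Proof.
move=> cg dg; apply: (seq_limit_ge (derive_seq dg)) => N.
have N0 : 0 < N.+1%:R :> R by [].
have := cg (N.+1%:R)^-1; rewrite invr_ge0 ltW// invf_le1// ler1n => /(_ isT isT).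
have -> : (N.+1%:R)^-1 *: y + (1 - (N.+1%:R)^-1) *: x = x + (N.+1%:R)^-1 *: (y - x) :> V.
  by rewrite scalerBl scale1r scalerBr addrCA.
move=> h; rewrite -ler_pdivrMl//; move: h; move: (g (x + _)) => gz; move: (N.+1%:R^-1) => k h.
have : k * (g y - g x) = k * g y - k * g x by ring.
have : (1 - k) * - g x = - g x + k * g x by ring.
by rewrite mulrN in h; lra.
Qed.

Lemma derive_dx n r c (g : 'cV[R]_n -> 'M[R]_(r, c)) x v :
  differentiable g x -> 'D_v g x = \sum_i v i 0 *: dx g i x.
Proof.
move=> dg; rewrite deriveE// {1}(matrix_sum_delta v) exchange_big/= big_ord1.
rewrite linear_sum; apply: eq_bigr => i _; rewrite linearZ/= /dx deriveE//.
Qed.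

Lemma derivable_entry n r c (g : 'cV[R]_n -> 'M[R]_(r, c)) x v i j :
  differentiable g x -> derivable (fun y => g y i j) x v.
Proof. by move=> /diff_derivable => /(_ v)/derivable_mxP. Qed.

Lemma derive_entry n r c (g : 'cV[R]_n -> 'M[R]_(r, c)) x v i j :
  differentiable g x -> 'D_v (fun y => g y i j) x = ('D_v g x) i j.
Proof. by move=> dg; rewrite derive_mx ?mxE//; exact: diff_derivable. Qed.

End derivatives.

(** * The Ito integral as a limit of step integrals *)

Section ito_integrals.
Context {R : realType} {disp : measure_display} {Omega : measurableType disp}.
Variables (P : probability Omega R) (T : R) (d : nat).
Variable W : process (R := R) (Omega := Omega) d 1.
Hypotheses (P_complete : measure_is_complete P)
           (W_brownian : brownian_motion P T W).
Local Notation mu := (@lebesgue_measure R).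
Local Notation pi := (mu \x P)%E.
Local Notation F := (filtration P W).
Local Notation Fmeas := (Fmeas P W).

Lemma adapted_Fmeas r c (y : process r c) t i j : 0 <= t <= T ->
  adapted P T W y -> Fmeas t (fun w => y t w i j).
Proof.
move=> tT ay; apply: (@bmeas_mxP _ _ R _ _ setT) => // B bB.
by rewrite setTI; exact: ay.
Qed.

Lemma adapted_measurable r c (y : process r c) t i j : 0 <= t <= T ->
  adapted P T W y -> measurable_fun setT (fun w => y t w i j).
Proof.
move=> tT ay; have /andP[_ tT'] := tT.
by apply: (Fmeas_measurable P_complete W_brownian tT'); exact: adapted_Fmeas.
Qed.

Section one_integral.
Variables (r : nat) (q : process (R := R) (Omega := Omega) r d)
          (I : process (R := R) (Omega := Omega) r 1).
Hypothesis qI : ito_integral P T W q I.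

(** Passes from norms of vectors and extended-real integrals to scalar components, to which [cvgL2]
    and its limit theorems apply. *)
Lemma ito_approx i :
  exists S : nat -> step_process d r, [/\ forall N, step_adapted P T W (S N),
    forall t, 0 <= t <= T -> L2 P (fun w => I t w i 0),
    forall t, 0 <= t <= T ->
      cvgL2 P (fun N w => step_integral W (S N) t w i 0) (fun w => I t w i 0) &
    forall l, cvgL2 pi (fun N => trunc T (fun t w => step_val (S N) t w i l))
                       (trunc T (fun t w => q t w i l))].
Proof.
case: qI => q2 aI _ [S [hS hq hI]]; exists S.
have mD N t : 0 <= t <= T -> measurable_fun setT
    (fun w => fnorm (step_integral W (S N) t w - I t w) ^+ 2).
  move=> tT; apply: measurable_fnorm_sqr => k j; rewrite ord1.
  under eq_fun do rewrite !mxE.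
  apply: measurable_funB; last exact: adapted_measurable.
  exact: (step_integral_L2 P_complete W_brownian (hS N) k tT).1.
have I2 t : 0 <= t <= T -> L2 P (fun w => I t w i 0).
  move=> tT; have mI := adapted_measurable i 0 tT aI.
  (* Convergence to 0 makes the distance finite for some N, and I_t is then the difference of two
     square-integrable variables. *)
  have : \forall N \near \oo,
      (\int[P]_w (fnorm (step_integral W (S N) t w - I t w) ^+ 2)%:E < +oo)%E.
    apply: filterS (cvg_is_fine (hI t tT)) => N; rewrite ltey_eq => ->; exact: orTb.
  move=> [N _ /(_ N (leqnn _)) hN].
  have iN : L1 P (fun w => fnorm (step_integral W (S N) t w - I t w) ^+ 2).
    apply/integrableP; split; first by apply/measurable_EFinP; exact: mD.
    by under eq_integral do rewrite /= ger0_norm ?sqr_ge0//.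
  have s2 := step_integral_L2 P_complete W_brownian (hS N) i tT.
  have D2 : L2 P (fun w => step_integral W (S N) t w i 0 - I t w i 0).
    apply: L2_le iN; first by apply: measurable_funB => //; exact: s2.1.
    by move=> w; have := entry_sqr_le (step_integral W (S N) t w - I t w) i 0;
      rewrite !mxE.
  have := L2B s2 D2; under eq_fun do rewrite opprB addrC subrK.
  by [].
split => //.
- move=> t tT; apply: (cvgL2_le _ _ _ (hI t tT)).
  + move=> N; apply: L2B; last exact: I2.
    exact: (step_integral_L2 P_complete W_brownian (hS N) i tT).
  + by move=> N; apply/measurable_EFinP; exact: mD.
  + move=> N w; rewrite lee_fin.
    have := entry_sqr_le (step_integral W (S N) t w - I t w) i 0.
    by rewrite !mxE.
- move=> l.
  have mV N k j : measurable_fun setT (trunc T (fun t w => (step_val (S N) t w - q t w) k j)).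
    have -> : trunc T (fun t w => (step_val (S N) t w - q t w) k j) =
        fun z => trunc T (fun t w => step_val (S N) t w k j) z -
                 trunc T (fun t w => q t w k j) z.
      by apply/funext => z; rewrite /trunc !mxE mulrBr.
    apply: measurable_funB.
      exact: (step_val_L2 P_complete W_brownian (hS N) k j).1.
    exact: (L2F_L2 k j q2).1.
  have mG N : measurable_fun setT
      (trunc T (fun t w => fnorm (step_val (S N) t w - q t w) ^+ 2)).
    apply: measurable_trunc; apply: measurable_fnorm_sqr => k j.
    exact: (@measurable_of_trunc R disp Omega T
      (fun t w => (step_val (S N) t w - q t w) k j)).
  apply: (@cvgL2_le _ _ _ pi _ (fun N z =>
    (trunc T (fun t w => fnorm (step_val (S N) t w - q t w) ^+ 2) z)%:E)).
  + move=> N; apply: L2B; last exact: (L2F_L2 i l q2).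
    exact: (step_val_L2 P_complete W_brownian (hS N) i l).
  + by move=> N; apply/measurable_EFinP.
  + move=> N z; rewrite lee_fin /trunc -mulrBr exprMn.
    have := entry_sqr_le (step_val (S N) z.1 z.2 - q z.1 z.2) i l.
    rewrite !mxE => h; rewrite indicE; case: (_ \in _); rewrite ?expr1n ?mul1r//.
    by rewrite expr0n !mul0r.
  + move: hq; apply: cvg_trans; apply: near_eq_cvg; apply: nearW => N.
    by rewrite (integral_pi_trunc P (mG N))// => t w; exact: sqr_ge0.
Qed.

Lemma ito_L2 t i : 0 <= t <= T -> L2 P (fun w => I t w i 0).
Proof. by have [S [_ h _ _]] := ito_approx i; exact: h. Qed.

Lemma ito_martingale t i xi : 0 <= t <= T -> Fmeas t xi -> L2 P xi ->
  \int[P]_w (xi w * (I T w i 0 - I t w i 0)) = 0.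
Proof.
move=> tT Fxi xi2; have [S [hS hI cI _]] := ito_approx i.
have TT : 0 <= T <= T.
  by case/andP: tT => t0 tT; rewrite lexx (le_trans t0 tT).
have sL2 N s (sT : 0 <= s <= T) := step_integral_L2 P_complete W_brownian (hS N) i sT.
have c1 := cvgL2_mulr (fun N => sL2 N T TT) (hI T TT) xi2 (cI T TT).
have c2 := cvgL2_mulr (fun N => sL2 N t tT) (hI t tT) xi2 (cI t tT).
have e0 : (fun N => \int[P]_w (step_integral W (S N) T w i 0 * xi w)) =
    (fun N => \int[P]_w (step_integral W (S N) t w i 0 * xi w)).
  apply/funext => N; apply/eqP; rewrite -subr_eq0; apply/eqP.
  rewrite -RintB; [|exact: (L2M (sL2 N T TT) xi2)|exact: (L2M (sL2 N t tT) xi2)].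
  rewrite -(step_martingale P_complete W_brownian (hS N) i tT Fxi xi2).
  by apply: eq_Rintegral => w _; ring.
have e1 : \int[P]_w (I T w i 0 * xi w) - \int[P]_w (I t w i 0 * xi w) = 0.
  apply/eqP; rewrite subr_eq0 -(cvg_lim (@norm_hausdorff _ R) c1) e0.
  by rewrite (cvg_lim (@norm_hausdorff _ R) c2).
rewrite -e1 -(RintB (L2M (hI T TT) xi2) (L2M (hI t tT) xi2)).
by apply: eq_Rintegral => w _; ring.
Qed.

Lemma ito_mean i : 0 <= T -> \int[P]_w I T w i 0 = 0.
Proof.
move=> T0; have [S [hS hI cI _]] := ito_approx i.
have TT : 0 <= T <= T by rewrite T0 lexx.
have zT : (0 : R) <= 0 <= T by rewrite lexx.
have sL2 N s (sT : 0 <= s <= T) := step_integral_L2 P_complete W_brownian (hS N) i sT.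
have c1 := cvgL2_mulr (fun N => sL2 N T TT) (hI T TT) (L2_cst P 1) (cI T TT).
have : \int[P]_w (I T w i 0 * 1) = 0.
  rewrite -(cvg_lim (@norm_hausdorff _ R) c1); apply: lim_near_cst => //.
  apply: nearW => N.
  (* The martingale property from time 0, tested with 1: a step integral vanishes at time 0, all its
     intervals being cut to a point. *)
  rewrite -(step_martingale P_complete W_brownian (hS N) i zT (xi := fun=> 1)).
  - apply: eq_Rintegral => w _; rewrite (step_integralE W (S N) 0).
    rewrite big1 ?subr0 ?mulr1 ?mul1r// => -[j l] _ /=.
    have [h1 h2 h3 _ _] := step_coefP (hS N) j i l.
    by rewrite !min_r// ?(le_trans h1)// /dW subrr mulr0.
  - exact: measurable_cst.
  - exact: L2_cst.
by under eq_Rintegral do rewrite mulr1.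
Qed.

End one_integral.

Lemma ito_isometry r r' (q : process r d) (I : process r 1) (q' : process r' d)
    (I' : process r' 1) i i' : 0 <= T ->
  ito_integral P T W q I -> ito_integral P T W q' I' ->
  \int[P]_w (I T w i 0 * I' T w i' 0) =
  \sum_l \int[pi]_z (trunc T (fun t w => q t w i l) z *
                     trunc T (fun t w => q' t w i' l) z).
Proof.
move=> T0 qI q'I'; have TT : 0 <= T <= T by rewrite T0 lexx.
have [q2 _ _ _] := qI; have [q2' _ _ _] := q'I'.
have [S [hS hI cI cq]] := ito_approx qI i.
have [S' [hS' hI' cI' cq']] := ito_approx q'I' i'.
have c1 := cvgL2_mul
  (fun N => step_integral_L2 P_complete W_brownian (hS N) i TT) (hI T TT)
  (fun N => step_integral_L2 P_complete W_brownian (hS' N) i' TT) (hI' T TT)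
  (cI T TT) (cI' T TT).
have c2 : \sum_l \int[pi]_z (trunc T (fun t w => step_val (S N) t w i l) z *
      trunc T (fun t w => step_val (S' N) t w i' l) z) @[N --> \oo] -->
    \sum_l \int[pi]_z (trunc T (fun t w => q t w i l) z *
      trunc T (fun t w => q' t w i' l) z).
  apply: cvg_sumr => l; apply: cvgL2_mul => //.
  - by move=> N; exact: (step_val_L2 P_complete W_brownian (hS N) i l).
  - exact: (L2F_L2 i l q2).
  - by move=> N; exact: (step_val_L2 P_complete W_brownian (hS' N) i' l).
  - exact: (L2F_L2 i' l q2').
rewrite -(cvg_lim (@norm_hausdorff _ R) c1) -(cvg_lim (@norm_hausdorff _ R) c2).
congr (lim (_ @ \oo)); apply/funext => N.
exact: (step_isometry P_complete W_brownian i i' (hS N) (hS' N)).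
Qed.

End ito_integrals.

Lemma L2_le_ae d (X : measurableType d) (R : realType)
    (m : {measure set X -> \bar R}) (f g : X -> R) :
  measurable_fun setT f -> {ae m, forall x, f x ^+ 2 <= g x} -> L1 m g -> L2 m f.
Proof.
move=> mf fg hg; have mg := L1_measurable hg.
have mf2 : measurable_fun setT (fun x => f x ^+ 2) by exact: measurable_funX.
split => //.
(* The minimum equals f^2 almost everywhere and is dominated everywhere, as [L1_le] requires. *)
apply: (@L1_ae _ _ _ _ (fun x => Num.min (f x ^+ 2) `|g x|)) => //.
  apply: filterS fg => x fg; rewrite min_l//.
  exact: le_trans fg (ler_norm _).
apply: (L1_le (g := fun x => `|g x|)).
- by apply: measurable_minr => //; exact: measurableT_comp.
- by move=> x; rewrite ger0_norm ?ge_min ?lexx ?orbT// le_min sqr_ge0 normr_ge0.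
- exact: integrable_norm.
Qed.

(** The inner integral may be infinite or undefined for some x, so Tonelli is applied to the
    positive and negative parts separately. *)
Lemma measurable_Rint_param d1 d2 (X : measurableType d1) (Y : measurableType d2)
    (R : realType) (m : {sigma_finite_measure set Y -> \bar R}) (f : X * Y -> R) :
  measurable_fun setT f -> measurable_fun setT (fun x => \int[m]_y f (x, y)).
Proof.
move=> mf; have mE : measurable_fun setT (EFin \o f) by exact/measurable_EFinP.
rewrite /Rintegral; apply: (measurableT_comp (f := fine)) => //.
have -> : (fun x => \int[m]_y (f (x, y))%:E)%E =
  (fun x => \int[m]_y (EFin \o f)^\+ (x, y) - \int[m]_y (EFin \o f)^\- (x, y))%E.
  apply/funext => x; rewrite [LHS]integralE.
  by under eq_integral do rewrite (funepos_comp (EFin \o f) (pair x))/=;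
    under [X in (_ - X)%E]eq_integral do rewrite (funeneg_comp (EFin \o f) (pair x))/=.
apply: emeasurable_funB; apply: measurable_fun_fubini_tonelli_F => //.
- exact: measurable_funepos.
- exact: measurable_funeneg.
Qed.

Lemma ae_snd d1 d2 (X : measurableType d1) (Y : measurableType d2) (R : realType)
    (m1 : {sigma_finite_measure set X -> \bar R})
    (m2 : {sigma_finite_measure set Y -> \bar R}) (Q : Y -> Prop) :
  {ae m2, forall y, Q y} -> {ae (m1 \x m2)%E, forall z, Q z.2}.
Proof.
move=> [N [mN N0 QN]]; exists (setT `*` N); split.
- exact: measurableX.
- by rewrite /= product_measure1E// N0 mule0.
- by move=> [x y] /= h; split => //; apply: QN.
Qed.

Lemma L1_Mle1 d (X : measurableType d) (R : realType)
    (m : {measure set X -> \bar R}) (e f : X -> R) :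
  measurable_fun setT e -> (forall x, `|e x| <= 1) -> L1 m f ->
  L1 m (fun x => e x * f x).
Proof.
move=> me e1 hf; apply: (L1_le (g := fun x => `|f x|)).
- by apply: measurable_funM => //; exact: L1_measurable hf.
- by move=> x; rewrite normrM ler_piMl.
- exact: integrable_norm.
Qed.

Lemma normr_indic_le1 (X : Type) (R : realType) (A : set X) x : `|\1_A x| <= 1 :> R.
Proof. by rewrite indicE; case: (_ \in _); rewrite ?normr1 ?normr0. Qed.

(** * The product rule in expectation *)

Section integration_by_parts.
Context (R : realType).
Local Notation mu := (@lebesgue_measure R).

(** The product is the integral of f(s) g(r) over the plane, cut along the diagonal: r <= s gives
    the first term, s < r the second. *)
Lemma Rint_by_parts (f g : R -> R) : L1 mu f -> L1 mu g ->
  (\int[mu]_s f s) * (\int[mu]_s g s) =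
  \int[mu]_s (f s * \int[mu]_r (\1_(`]-oo, s]) r * g r)) +
  \int[mu]_s (g s * \int[mu]_r (\1_(`]-oo, s]) r * f r)).
Proof.
move=> hf hg; have mf := L1_measurable hf; have mg := L1_measurable hg.
pose H (z : measurableTypeR R * measurableTypeR R) := f z.1 * g z.2.
have [iH eH] := L1_tensor hf hg.
have mI : measurable_fun setT
    (fun z : measurableTypeR R * measurableTypeR R => \1_(`]-oo, z.1]) z.2 : R).
  rewrite (_ : (fun z => _) = \1_[set z : measurableTypeR R * measurableTypeR R | z.2 <= z.1]).
    apply: measurable_indic; rewrite -[X in measurable X]setTI.
    by apply: measurable_fun_le.
  by apply/funext => z; rewrite !indicE; congr (nat_of_bool _)%:R;
    apply/idP/idP; rewrite !inE/= in_itv.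
have iH1 : L1 (mu \x mu)%E (fun z => \1_(`]-oo, z.1]) z.2 * (f z.1 * g z.2)).
  by apply: L1_Mle1 => // z; exact: normr_indic_le1.
rewrite -eH.
have e : \int[(mu \x mu)%E]_z (f z.1 * g z.2) =
   \int[(mu \x mu)%E]_z (\1_(`]-oo, z.1]) z.2 * (f z.1 * g z.2)) +
   \int[(mu \x mu)%E]_z (f z.1 * g z.2 - \1_(`]-oo, z.1]) z.2 * (f z.1 * g z.2)).
  rewrite -RintD//; last exact: L1B.
  by apply: eq_Rintegral => z _; rewrite addrC subrK.
rewrite e; congr (_ + _).
  rewrite Rint_fubini1//; apply: eq_Rintegral => s _ /=.
  rewrite -RintZl//; first by apply: eq_Rintegral => r _; ring.
  by apply: L1_Mle1 => // r; exact: normr_indic_le1.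
rewrite Rint_fubini2; last exact: L1B.
apply: eq_Rintegral => r _ /=.
have j1 : L1 mu (fun s => \1_(`]-oo, r]) s * f s).
  by apply: L1_Mle1 => // s; exact: normr_indic_le1.
rewrite -RintZl//; apply: ae_Rint.
- apply: measurable_funB; first by apply: measurable_funM.
  apply: measurable_funM; last by apply: measurable_funM.
  exact: (measurable_section2 r mI).
- by apply: measurable_funM => //; exact: L1_measurable j1.
(* The complementary half-plane is s < r and the formula has s <= r; for fixed r they differ at s =
   r only. *)
exists [set r]; split => //; first exact: lebesgue_measure_set1.
move=> s /=; apply: contra_notP => /eqP sr.
rewrite !indicE.
have -> : (r \in `]-oo, s]%classic) = (r <= s).
  by apply/idP/idP; rewrite inE/= in_itv.
have -> : (s \in `]-oo, r]%classic) = (s <= r).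
  by apply/idP/idP; rewrite inE/= in_itv.
by case: (ltgtP r s) sr => // _ _; rewrite ?mul1r ?mul0r ?subrr ?subr0 ?mulr0 // mulrC.
Qed.

End integration_by_parts.

Section primitive.
Context {R : realType} {disp : measure_display} {Omega : measurableType disp}.
Variables (P : probability Omega R) (T : R) (T0 : 0 <= T).
Local Notation mu := (@lebesgue_measure R).
Local Notation pi := (mu \x P)%E.
Variable g : R -> Omega -> R.
Local Notation g' := (trunc T g).
Hypothesis g2 : L2 pi g'.

(** Written over the whole line, it is a parametric integral of a jointly measurable function;
    [primE] recovers the integral over [0, t]. *)
Definition prim t w := \int[mu]_s (\1_(`]-oo, t]) s * g' (s, w)).

Lemma primE t w : 0 <= t <= T -> prim t w = \int[mu]_(s in `[0, t]) g s w.
Proof.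
move=> /andP[t0 tT]; rewrite [RHS]Rintegral_mkcond; apply: eq_Rintegral => s _.
rewrite patchE /trunc/= !indicE mulrA -natrM mulnb.
have -> : (s \in `]-oo, t]%classic) && (s \in `[0, T]%classic) = (s \in `[0, t]%classic).
  apply/idP/idP; rewrite ?in_setE/= !in_itv/=.
    by move=> /andP[]; rewrite !inE/= !in_itv/= => -> /andP[->].
  move=> /andP[s0 st]; apply/andP; split; rewrite inE/= in_itv/=//.
  by rewrite s0 (le_trans st).
by case: ifP; rewrite ?mul1r ?mul0r.
Qed.

Lemma trunc_idem z : \1_(`[0, T]) z.1 * g' z = g' z.
Proof.
by rewrite /trunc mulrA indicE; case: (_ \in _); rewrite ?mul1r ?mul0r.
Qed.

Lemma L2_indic0T : L2 mu (\1_(`[0, T])).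
Proof.
split => //; have := @integrable_indic_itv R 0 T true false.
by apply: eq_integrable => // t _ /=; rewrite indicE; case: (_ \in _);
  rewrite ?expr1n ?expr0n.
Qed.

Lemma Rint_indic0T : \int[mu]_t (\1_(`[0, T]) t ^+ 2) = T.
Proof.
transitivity (\int[mu]_t \1_(`[0, T]) t).
  by apply: eq_Rintegral => t _; rewrite indicE; case: (_ \in _);
    rewrite ?expr1n ?expr0n.
rewrite /Rintegral integral_indic//= setIT lebesgue_measure_itv/= lte_fin.
by have [//|T1] := ltP 0 T; [rewrite oppr0 adde0|apply/eqP; rewrite eq_le T0 T1].
Qed.

Lemma L1_trunc_L2 : L1 pi g'.
Proof.
have h : L2 pi (fun z => \1_(`[0, T]) z.1 * (1 : R)).
  exact: (L2_tensor L2_indic0T (L2_cst P 1)).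
have := L2M h g2; apply: eq_integrable => // z _ /=.
by rewrite mulr1 trunc_idem.
Qed.

Lemma ae_section2 : {ae P, forall w, L2 mu (fun s => g' (s, w))}.
Proof. exact: (ae_L2_section2 g2). Qed.

Lemma measurable_prim : measurable_fun setT
  (fun z : measurableTypeR R * Omega => prim z.1 z.2).
Proof.
apply: (@measurable_Rint_param _ _ _ _ R mu
  (fun y : (measurableTypeR R * Omega) * measurableTypeR R =>
     \1_(`]-oo, y.1.1]) y.2 * g' (y.2, y.1.2))).
apply: measurable_funM; last first.
  apply: (measurableT_comp g2.1).
  by apply/measurable_fun_pairP; split => /=; [exact: measurable_snd|
    exact: (measurableT_comp measurable_snd measurable_fst)].
rewrite (_ : (fun z => _) =
  \1_[set y : (measurableTypeR R * Omega) * measurableTypeR R | y.2 <= y.1.1]).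
  apply: measurable_indic; rewrite -[X in measurable X]setTI.
  apply: measurable_fun_le => //.
  exact: (measurableT_comp measurable_fst measurable_fst).
by apply/funext => z; rewrite !indicE; congr (nat_of_bool _)%:R;
  apply/idP/idP; rewrite !inE/= in_itv.
Qed.

(** Cauchy-Schwarz against the indicator of [0, T], whose squared norm is the factor T. *)
Lemma prim_sqr_le t w : L2 mu (fun s => g' (s, w)) ->
  prim t w ^+ 2 <= T * \int[mu]_s (g' (s, w) ^+ 2).
Proof.
move=> hw.
have m1 : measurable_fun setT (\1_(`]-oo, t]) : R -> R) by exact: measurable_indic.
have b1 (s : R) : `|\1_(`]-oo, t]) s| <= 1 :> R.
  by rewrite indicE; case: (_ \in _); rewrite ?normr1 ?normr0.
have h1 : L2 mu (fun s => \1_(`[0, T]) s * \1_(`]-oo, t]) s).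
  exact: (L2Mb L2_indic0T m1 b1).
have -> : prim t w = \int[mu]_s ((\1_(`[0, T]) s * \1_(`]-oo, t]) s) * g' (s, w)).
  by apply: eq_Rintegral => s _; rewrite -[in LHS]trunc_idem/=; ring.
rewrite -real_normK ?num_real//.
have cs := cauchy_schwarz h1 hw.
apply: (@le_trans _ _ ((Num.sqrt (\int[mu]_s ((\1_(`[0, T]) s * \1_(`]-oo, t]) s) ^+ 2)) *
    Num.sqrt (\int[mu]_s (g' (s, w) ^+ 2))) ^+ 2)).
  by rewrite ler_pXn2r ?nnegrE ?mulr_ge0 ?sqrtr_ge0.
rewrite exprMn !sqr_sqrtr; try by apply: Rint_ge0 => s; exact: sqr_ge0.
rewrite ler_wpM2r//; first by apply: Rint_ge0 => s; exact: sqr_ge0.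
rewrite -[leRHS]Rint_indic0T; apply: le_Rintegral => //.
- exact: h1.2.
- exact: L2_indic0T.2.
- by move=> s _; rewrite exprMn ler_piMr ?sqr_ge0.
Qed.

Lemma L2_prim t : L2 P (prim t).
Proof.
apply: (@L2_le_ae _ _ _ _ _ (fun w => T * \int[mu]_s (g' (s, w) ^+ 2))).
- exact: (measurable_section1 t measurable_prim).
- by apply: filterS ae_section2 => w; exact: prim_sqr_le.
- by apply: L1Zl; exact: (L1_fubini2 g2.2).
Qed.

Lemma L2_trunc_prim : L2 pi (trunc T prim).
Proof.
have h := L1_fubini2 g2.2.
have [i _] := L1_tensor L2_indic0T.2 (L1Zl T h).
apply: (L2_le_ae _ _ i).
  apply: measurable_funM; last exact: measurable_prim.
  have m0 : measurable_fun setT (\1_(`[0, T]) : measurableTypeR R -> R).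
    exact: measurable_indic.
  exact: (measurableT_comp m0 measurable_fst).
apply: filterS (ae_snd mu ae_section2) => -[t w] /= hw.
rewrite /trunc exprMn indicE /=; case: (_ \in _).
  by rewrite expr1n !mul1r; exact: prim_sqr_le.
by rewrite expr0n/= !mul0r.
Qed.

Lemma primT w : prim T w = \int[mu]_s g' (s, w).
Proof.
apply: eq_Rintegral => s _; rewrite -[RHS]trunc_idem/= -[in LHS]trunc_idem/= mulrA.
congr (_ * _); rewrite !indicE -natrM mulnb; congr (nat_of_bool _)%:R.
by apply/andP/idP => [[]//|h]; split => //; move: h;
  rewrite !inE/= !in_itv/= => /andP[].
Qed.

Lemma Rint_prim : \int[P]_w prim T w = \int[pi]_z g' z.
Proof.
rewrite (Rint_fubini2 L1_trunc_L2); apply: eq_Rintegral => w _.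
exact: primT.
Qed.

End primitive.

Section product_formula.
Context {R : realType} {disp : measure_display} {Omega : measurableType disp}.
Variables (P : probability Omega R) (T : R) (T0 : 0 <= T).
Local Notation mu := (@lebesgue_measure R).
Local Notation pi := (mu \x P)%E.

Lemma prim_by_parts (g h : R -> Omega -> R) :
  L2 pi (trunc T g) -> L2 pi (trunc T h) ->
  \int[P]_w (prim T g T w * prim T h T w) =
  \int[pi]_z (trunc T g z * trunc T (prim T h) z) +
  \int[pi]_z (trunc T h z * trunc T (prim T g) z).
Proof.
move=> g2 h2.
have g2' := L2_trunc_prim T0 g2; have h2' := L2_trunc_prim T0 h2.
have i1 := L2M g2 h2'; have i2 := L2M h2 g2'.
rewrite (Rint_fubini2 i1) (Rint_fubini2 i2).
rewrite -RintD; [|exact: (L1_fubini2 i1)|exact: (L1_fubini2 i2)].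
apply: ae_Rint.
- apply: measurable_funM; [exact: (L2_prim T0 g2 T).1|exact: (L2_prim T0 h2 T).1].
- by apply: measurable_funD; [exact: L1_measurable (L1_fubini2 i1)|
    exact: L1_measurable (L1_fubini2 i2)].
have ag := ae_L1_section2 (L1_trunc_L2 g2).
have ah := ae_L1_section2 (L1_trunc_L2 h2).
move: ag ah; apply: filterS2 => w iG iH.
rewrite !primT (Rint_by_parts iG iH); congr (_ + _); apply: eq_Rintegral => s _.
  by rewrite -[in LHS](trunc_idem T g)/= /trunc/= /prim; ring.
by rewrite -[in LHS](trunc_idem T h)/= /trunc/= /prim; ring.
Qed.

End product_formula.

Section product_rule.
Context {R : realType} {disp : measure_display} {Omega : measurableType disp}.
Variables (P : probability Omega R) (T : R) (T0 : 0 <= T) (d : nat).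
Variable W : process (R := R) (Omega := Omega) d 1.
Local Notation mu := (@lebesgue_measure R).
Local Notation pi := (mu \x P)%E.
Local Notation Fmeas := (Fmeas P W).

(* The martingale property of M is only required between t and T, tested
   against F_t-measurable variables. *)
Definition semimartingale (X : R -> Omega -> R) (x0 : R)
    (a M : R -> Omega -> R) : Prop :=
  [/\ L2 pi (trunc T X), forall t, 0 <= t <= T -> measurable_fun setT (X t),
      L2 pi (trunc T a) & forall t, 0 <= t <= T -> Fmeas t (a t)] /\
  [/\ forall t, 0 <= t <= T -> L2 P (M t),
      forall t xi, 0 <= t <= T -> Fmeas t xi -> L2 P xi ->
        \int[P]_w (xi w * (M T w - M t w)) = 0,
      \int[P]_w M T w = 0 &
      forall t, 0 <= t <= T -> {ae P, forall w, X t w = x0 + prim T a t w + M t w}].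

Let TT : 0 <= T <= T. Proof. by rewrite T0 lexx. Qed.

Lemma semimartingale_L2 X x0 a M t : semimartingale X x0 a M ->
  0 <= t <= T -> L2 P (X t).
Proof.
move=> [[_ mX a2 _] [M2 _ _ XE]] tT.
apply: (@L2_ae _ _ _ _ (fun w => x0 + prim T a t w + M t w)).
- exact: mX.
- by apply: filterS (XE t tT) => w ->.
- apply: L2D (M2 t tT); apply: L2D; first exact: L2_cst.
  exact: (L2_prim T0 a2).
Qed.

(** Under the time integral, M_T may be replaced by M_s because c_s is F_s-measurable; then M_s =
    X_s - x0 - A_s with A the primitive of a. *)
Lemma noise_drift X x0 a M c : semimartingale X x0 a M ->
  L2 pi (trunc T c) -> (forall t, 0 <= t <= T -> Fmeas t (c t)) ->
  \int[P]_w (M T w * prim T c T w) =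
  \int[pi]_z (trunc T X z * trunc T c z) - x0 * \int[P]_w prim T c T w -
  \int[pi]_z (trunc T c z * trunc T (prim T a) z).
Proof.
move=> [[X2 mX a2 _] [M2 MM _ XE]] c2 Fc.
have M2T := M2 T TT.
have i1T := L2_tensor (L2_indic0T T) M2T.
have cst2 := L2_tensor (L2_indic0T T) (L2_cst P x0).
have A2 := L2_trunc_prim T0 a2.
have c1 := L1_trunc_L2 c2.
(* A jointly measurable stand-in for M: it equals M_s almost surely at each fixed s in [0, T]. *)
pose n z := trunc T X z - \1_(`[0, T]) z.1 * x0 - trunc T (prim T a) z.
have n2 : L2 pi n by apply: L2B => //; exact: L2B.
have e1 : \int[P]_w (M T w * prim T c T w) =
    \int[pi]_z ((\1_(`[0, T]) z.1 * M T z.2) * trunc T c z).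
  rewrite (Rint_fubini2 (L2M i1T c2)); apply: ae_Rint.
  - by apply: measurable_funM; [exact: M2T.1|exact: (L2_prim T0 c2 T).1].
  - exact: L1_measurable (L1_fubini2 (L2M i1T c2)).
  - apply: filterS (ae_L1_section2 c1) => w hw.
    rewrite primT -RintZl//; apply: eq_Rintegral => s _ /=.
    by rewrite -[in LHS](trunc_idem T c)/=; ring.
have e2 : \int[pi]_z ((\1_(`[0, T]) z.1 * M T z.2) * trunc T c z) =
    \int[pi]_z (n z * trunc T c z).
  apply/eqP; rewrite -subr_eq0; apply/eqP.
  rewrite -RintB; [|exact: (L2M i1T c2)|exact: (L2M n2 c2)].
  have i3 := L1B (L2M i1T c2) (L2M n2 c2).
  rewrite (Rint_fubini1 i3) -[RHS](_ : \int[mu]_s 0 = 0); last first.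
    by rewrite /Rintegral integral0.
  apply: ae_Rint => //; first exact: L1_measurable (L1_fubini1 i3).
  (* At almost every s the section of c is in [L2], as required of a test variable in the martingale
     identity. *)
  apply: filterS (ae_L2_section1 c2) => s hs.
  have [sT|sT] := boolP (0 <= s <= T); last first.
    rewrite /Rintegral integral0_eq// => w _ /=.
    by rewrite trunc_out//; congr (_%:E); ring.
  have hs' : L2 P (c s).
    have e : (fun w => trunc T c (s, w)) = c s.
      by apply/funext => w; rewrite trunc_in.
    by rewrite -e.
  etransitivity; last exact: (MM s (c s) sT (Fc s sT) hs').
  apply: ae_Rint.
  - exact: (measurable_section1 s (L1_measurable i3)).
  - apply: measurable_funM; first exact: hs'.1.
    by apply: measurable_funB; [exact: M2T.1|exact: (M2 s sT).1].
  - apply: filterS (XE s sT) => w hw /=.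
    rewrite /n !trunc_in// hw /= indicE mem_set/=; last by rewrite in_itv.
    by ring.
rewrite e1 e2.
have -> : \int[P]_w prim T c T w = \int[pi]_z (trunc T c z) by exact: Rint_prim.
rewrite -RintZl// -RintB; [|exact: (L2M X2 c2)|exact: L1Zl].
rewrite -RintB; [|by apply: L1B; [exact: (L2M X2 c2)|exact: L1Zl]|exact: (L2M c2 A2)].
apply: eq_Rintegral => z _; rewrite /n -[in X in _ = _ - x0 * X - _](trunc_idem T c); ring.
Qed.

(** After expansion, the double integrals of [prim_by_parts] and the products of initial values with
    drifts cancel against the corrections in [noise_drift]; initial values times noise have mean
    0. *)
Lemma product_rule X x0 a M Y y0 c N :
  semimartingale X x0 a M -> semimartingale Y y0 c N ->
  \int[P]_w (X T w * Y T w) = x0 * y0 +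
    (\int[pi]_z (trunc T X z * trunc T c z) +
     \int[pi]_z (trunc T Y z * trunc T a z)) + \int[P]_w (M T w * N T w).
Proof.
move=> sX sY; have [[X2 mX a2 Fa] [M2 MM M0 XE]] := sX.
have [[Y2 mY c2 Fc] [N2 NN N0 YE]] := sY.
have hXY := noise_drift sX c2 Fc; have hYX := noise_drift sY a2 Fa.
have hAC := prim_by_parts T0 a2 c2.
have A2 := L2_prim T0 a2 T; have C2 := L2_prim T0 c2 T.
have {}M2 := M2 T TT; have {}N2 := N2 T TT.
have A1 := L2_L1 A2; have C1 := L2_L1 C2; have M1 := L2_L1 M2; have N1 := L2_L1 N2.
have j1 : L1 P (fun w => x0 * prim T c T w + y0 * prim T a T w) by apply: L1D; exact: L1Zl.
have j2 : L1 P (fun w => x0 * N T w + y0 * M T w) by apply: L1D; exact: L1Zl.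
have j0 := L1_cst P (x0 * y0).
have j3 := L2M A2 C2; have j4 := L2M M2 C2; have j5 := L2M N2 A2; have j6 := L2M M2 N2.
have -> : \int[P]_w (X T w * Y T w) = \int[P]_w
   ((x0 * y0 + (x0 * prim T c T w + y0 * prim T a T w) +
     (x0 * N T w + y0 * M T w)) +
    (prim T a T w * prim T c T w + M T w * prim T c T w + N T w * prim T a T w +
     M T w * N T w)).
  apply: ae_Rint.
  - by apply: measurable_funM; [exact: mX|exact: mY].
  - exact: L1_measurable (L1D (L1D (L1D j0 j1) j2) (L1D (L1D (L1D j3 j4) j5) j6)).
  - by have := YE T TT; have := XE T TT; apply: filterS2 => w -> ->; ring.
rewrite (RintD (L1D (L1D j0 j1) j2) (L1D (L1D (L1D j3 j4) j5) j6)).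
rewrite (RintD (L1D j0 j1) j2) (RintD j0 j1) (RintD (L1D (L1D j3 j4) j5) j6).
rewrite (RintD (L1D j3 j4) j5) (RintD j3 j4).
rewrite (RintD (L1Zl _ C1) (L1Zl _ A1)) (RintD (L1Zl _ N1) (L1Zl _ M1)).
rewrite (RintZl x0 C1) (RintZl y0 A1) (RintZl x0 N1) (RintZl y0 M1) M0 N0 hXY hYX hAC Rintegral_cst// [X in fine X]probability_setT/=.
move: (\int[P]_w prim T a T w) (\int[P]_w prim T c T w)
  (\int[P]_w (M T w * N T w)) (\int[pi]_z (trunc T X z * trunc T c z))
  (\int[pi]_z (trunc T Y z * trunc T a z))
  (\int[pi]_z (trunc T a z * trunc T (prim T c) z))
  (\int[pi]_z (trunc T c z * trunc T (prim T a) z)) => *.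
by ring.
Qed.

End product_rule.

Section ito_processes.
Context {R : realType} {disp : measure_display} {Omega : measurableType disp}.
Variables (P : probability Omega R) (T : R) (T0 : 0 <= T) (d : nat).
Variable W : process (R := R) (Omega := Omega) d 1.
Hypotheses (P_complete : measure_is_complete P)
           (W_brownian : brownian_motion P T W).
Local Notation mu := (@lebesgue_measure R).
Local Notation pi := (mu \x P)%E.
Local Notation Fmeas := (Fmeas P W).

Lemma ito_semimartingale n (X a : process (R := R) (Omega := Omega) n 1)
    (q : process n d) (x0 : 'cV[R]_n) :
  L2F P T W X -> {ae P, forall w, X 0 w = x0} -> ito_equation P T W X a q ->
  (forall i, L2 pi (trunc T (fun t w => a t w i 0))) ->
  (forall i t, 0 <= t <= T -> Fmeas t (fun w => a t w i 0)) ->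
  exists2 I : process n 1, ito_integral P T W q I &
    forall i, semimartingale P T W (fun t w => X t w i 0) (x0 i 0)
      (fun t w => a t w i 0) (fun t w => I t w i 0).
Proof.
move=> X2 X0 [ia [I qI XE]] a2 Fa; exists I => // i; split; split.
- exact: (L2F_L2 i 0 X2).
- by move=> t tT; apply: (adapted_measurable P_complete W_brownian i 0 tT); case: X2.
- exact: a2.
- exact: Fa.
- by move=> t tT; exact: (ito_L2 P_complete W_brownian qI).
- by move=> t xi tT Fxi xi2; exact: (ito_martingale P_complete W_brownian qI i tT Fxi xi2).
- exact: (ito_mean P_complete W_brownian qI).
- move=> t tT; move: X0 XE; apply: filterS2 => w X0 /(_ t tT) ->.
  by rewrite X0 !mxE (primE (fun t w => a t w i 0) w tT).
Qed.

(** The cost is an iterated extended-real integral; integrability over the product makes it the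
    embedding of a real number. *)
Lemma cost_Rint (F : R -> Omega -> R) (H : Omega -> R) :
  L1 pi (trunc T F) -> L1 P H ->
  (\int[P]_w (\int[mu]_(t in `[0%R, T]) (F t w)%:E + (H w)%:E))%E =
  (\int[pi]_z trunc T F z + \int[P]_w H w)%:E.
Proof.
move=> hF hH.
under eq_integral do rewrite -integral_trunc.
have iG := integrable_fubini_snd hF.
rewrite integralD//.
rewrite EFinD; congr (_ + _)%E; last by rewrite fineK//; exact: integrable_fin_num.
rewrite [RHS]fineK; last exact: integrable_fin_num.
exact: (integral21_prod_meas1 hF).
Qed.

End ito_processes.

(** * The Hamiltonian inequality *)

Lemma conv_sub (R : pzRingType) (E : lmodType R) (a : R) (v u : E) :
  a *: v + (1 - a) *: u - u = a *: (v - u).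
Proof.
by rewrite scalerBl scale1r scalerBr -addrA [u - _ - u]addrAC subrr sub0r.
Qed.

Lemma dotE (R : realType) m (x y : 'cV[R]_m) : dot x y = \sum_i x i 0 * y i 0.
Proof. by rewrite /dot mxE; apply: eq_bigr => i _; rewrite mxE. Qed.

Lemma fnormZ (R : realType) r c (a : R) (A : 'M[R]_(r, c)) :
  fnorm (a *: A) = `|a| * fnorm A.
Proof.
rewrite /fnorm -sqrtr_sqr -sqrtrM ?sqr_ge0// mulr_sumr; congr Num.sqrt.
apply: eq_bigr => i _; rewrite mulr_sumr; apply: eq_bigr => j _.
by rewrite mxE exprMn.
Qed.

Lemma fnorm_delta (R : realType) n (i : 'I_n) :
  fnorm (delta_mx i 0 : 'cV[R]_n) = 1.
Proof.
rewrite /fnorm (bigD1 i)//= big_ord1 mxE !eqxx/= expr1n big1 ?addr0 ?sqrtr1//.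
by move=> j /negbTE ji; rewrite big_ord1 mxE ji expr0n.
Qed.

Section hamiltonian.
Context {R : realType} {n d k : nat}.
Variables (T : R) (U : set 'cV[R]_k).
Variables (b : R -> 'cV[R]_n -> 'cV[R]_k -> 'cV[R]_n)
          (sigma : R -> 'cV[R]_n -> 'cV[R]_k -> 'M[R]_(n, d))
          (f : R -> 'cV[R]_n -> 'cV[R]_k -> R).
Local Notation f1 := (scalar_coef f).
Local Notation ham := (ham b sigma f).
Local Notation ham_x := (ham_x b sigma f).

Lemma hamE t x u p q : ham t x u p q = \sum_j p j 0 * b t x u j 0 +
  \sum_l \sum_j q j l * sigma t x u j l - f1 t x u 0 0.
Proof.
rewrite /Defs.ham dotE /mxtrace mxE mulr1n; congr (_ + _ - _).
apply: eq_bigr => l _; rewrite mxE; apply: eq_bigr => j _.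
by rewrite mxE.
Qed.

Section derivative.
Variables (t : R) (x : 'cV[R]_n) (u : 'cV[R]_k).
Hypotheses (db : differentiable (b t ^~ u) x)
  (dsigma : differentiable (sigma t ^~ u) x) (df : differentiable (f1 t ^~ u) x).

Lemma is_derive_ham p q (v : 'cV[R]_n) :
  is_derive x v (fun y => ham t y u p q)
    (\sum_j p j 0 * ('D_v (b t ^~ u) x) j 0 +
     \sum_l \sum_j q j l * ('D_v (sigma t ^~ u) x) j l -
     ('D_v (f1 t ^~ u) x) 0 0).
Proof.
have -> : (fun y => ham t y u p q) =
    (\sum_j (p j 0 \*: (fun y => b t y u j 0)) +
     \sum_l \sum_j (q j l \*: (fun y => sigma t y u j l)) -
     (fun y => f1 t y u 0 0)).
  apply/funext => y; rewrite hamE !fctE !fct_sumE; congr (_ + _ - _).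
  by apply: eq_bigr => l _; rewrite fct_sumE.
apply: is_deriveB; last first.
  by apply: DeriveDef; [exact: derivable_entry|exact: derive_entry].
apply: is_deriveD.
  apply: is_derive_sum => j; apply: is_deriveZ.
  by apply: DeriveDef; [exact: derivable_entry|exact: derive_entry].
apply: is_derive_sum => l; apply: is_derive_sum => j; apply: is_deriveZ.
by apply: DeriveDef; [exact: derivable_entry|exact: derive_entry].
Qed.

Lemma ham_xE p q i : ham_x t x u p q i 0 =
  \sum_j p j 0 * dx (b t ^~ u) i x j 0 +
  \sum_l \sum_j q j l * dx (sigma t ^~ u) i x j l - dx (f1 t ^~ u) i x 0 0.
Proof. by rewrite mxE; have [_ ->] := is_derive_ham p q (delta_mx i 0). Qed.

Lemma derivable_ham p q v : derivable (fun y => ham t y u p q) x v.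
Proof. by have [] := is_derive_ham p q v. Qed.

(** [ham_x] consists of partial derivatives only; differentiability of the coefficients makes the
    directional derivative linear in v. *)
Lemma derive_ham p q v :
  'D_v (fun y => ham t y u p q) x = dot (ham_x t x u p q) v.
Proof.
have [_ ->] := is_derive_ham p q v; rewrite dotE.
under [RHS]eq_bigr do rewrite ham_xE mulrBl mulrDl !mulr_suml.
rewrite !big_split/= sumrN; congr (_ + _ - _).
- rewrite exchange_big/=; apply: eq_bigr => j _.
  rewrite derive_dx// summxE mulr_sumr; apply: eq_bigr => i _.
  by rewrite mxE; ring.
- under [RHS]eq_bigr do under eq_bigr do rewrite mulr_suml.
  rewrite [RHS]exchange_big/=; apply: eq_bigr => l _.
  rewrite [RHS]exchange_big/=; apply: eq_bigr => j _.
  rewrite derive_dx// summxE mulr_sumr; apply: eq_bigr => i _.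
  by rewrite mxE; ring.
- rewrite derive_dx// summxE; apply: eq_bigr => i _.
  by rewrite mxE mulrC.
Qed.

End derivative.

(** A modulus has its limit from the right of 0, so r = 0 is treated apart. *)
Lemma modulus_seq (om : R -> R) r : modulus om -> 0 <= r ->
  om ((N.+1%:R)^-1 * r) @[N --> \oo] --> (0 : R).
Proof.
move=> [om0 _ _ omc] r0; have [->|r1] := eqVneq r 0.
  by under eq_fun do rewrite mulr0 om0; exact: cvg_cst.
have rp : 0 < r by rewrite lt0r r1.
apply: (cvg_comp (fun N => (N.+1%:R)^-1 * r) om _ omc).
move=> A hA.
have h0 : (N.+1%:R)^-1 * r @[N --> \oo] --> (0 : R).
  rewrite -[X in _ --> X](mul0r r); apply: cvgM; last exact: cvg_cst.
  exact: cvg_harmonic.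
have h : \forall N \near \oo, (0 < (N.+1%:R)^-1 * r) -> A ((N.+1%:R)^-1 * r).
  exact: (h0 _ hA).
by apply: (@filterS nat \oo _ _ _ _ h) => N; apply; rewrite mulr_gt0 ?invr_gt0.
Qed.

Section coef_C2_facts.
Variables (L : R) (om : R -> R) (r c : nat) (phi : @coef R n k r c).
Hypotheses (om_modulus : modulus om) (hphi : coef_C2 T U L om phi).

Lemma coef_C2_diff t x u : 0 <= t <= T -> U u -> differentiable (phi t ^~ u) x.
Proof. by move=> tT Uu; have [/(_ u Uu)[h _ _] _ _] := hphi tT; exact: h. Qed.

(** Both derivatives are taken at the same x, so the bound in [coef_C2] reduces to the modulus at |v
    - u| / (N + 1). *)
Lemma coef_C2_dx_cvg t x u v i j l : 0 <= t <= T -> U u ->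
  (forall N : nat, U ((N.+1%:R)^-1 *: v + (1 - (N.+1%:R)^-1) *: u)) ->
  dx (phi t ^~ ((N.+1%:R)^-1 *: v + (1 - (N.+1%:R)^-1) *: u)) i x j l
    @[N --> \oo] --> dx (phi t ^~ u) i x j l.
Proof.
move=> tT Uu UN; have [_ h _] := hphi tT.
apply/subr_cvg0/norm_cvg0P.
have := modulus_seq om_modulus (fnorm_ge0 (v - u)).
apply: (squeeze_cvgr _ (cvg_cst 0)); apply: nearW => N; rewrite normr_ge0/=.
have := h x x _ _ (UN N) Uu; rewrite subrr.
have -> : fnorm (0 : 'cV[R]_n) = 0.
  by rewrite -(scale0r (0 : 'cV[R]_n)) fnormZ normr0 mul0r.
rewrite mulr0 add0r.
have -> : (N.+1%:R)^-1 *: v + (1 - (N.+1%:R)^-1) *: u - u = (N.+1%:R)^-1 *: (v - u).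
  exact: conv_sub.
rewrite fnormZ ger0_norm ?invr_ge0// => hN; apply: le_trans hN.
pose D m := dx (phi t ^~ ((N.+1%:R)^-1 *: v + (1 - (N.+1%:R)^-1) *: u)) m x -
  dx (phi t ^~ u) m x.
apply: (le_trans (y := fnorm (D i))).
  by have := entry_le (D i) j l; rewrite /D !mxE.
rewrite -[leLHS]ger0_norm ?fnorm_ge0// -sqrtr_sqr ler_wsqrtr//.
by rewrite (bigD1 i)//= lerDl sumr_ge0// => m _; exact: sqr_ge0.
Qed.

End coef_C2_facts.

Section inequality.
Variables (L : R) (om : R -> R).
Hypotheses (om_modulus : modulus om) (hb : coef_C2 T U L om b)
  (hsigma : coef_C2 T U L om sigma) (hf : coef_C2 T U L om f1).

(* Concavity along the segment from (x, u) to (y, v), and maximality of u, give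
   the bound with the gradient taken at (x, u_lambda); then lambda -> 0. *)
Lemma ham_le t x u y v p q : 0 <= t <= T -> convex_set U -> U u -> U v ->
  convex_function ([set: 'cV[R]_n] `*` U)
    (fun z : 'cV[R]_n * 'cV[R]_k => - ham t z.1 z.2 p q) ->
  (forall w, U w -> ham t x w p q <= ham t x u p q) ->
  ham t y v p q - ham t x u p q <= dot (ham_x t x u p q) (y - x).
Proof.
move=> tT cU Uu Uv cH maxu.
pose uN (N : nat) := (N.+1%:R)^-1 *: v + (1 - (N.+1%:R)^-1) *: u.
have N01 (N : nat) : 0 <= (N.+1%:R)^-1 :> R /\ (N.+1%:R)^-1 <= 1 :> R.
  by rewrite invr_ge0; split => //; rewrite invf_le1// ler1n.
have UN N : U (uN N).
  have [h0 h1] := N01 N.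
  by have := cU v u (Itv01 h0 h1) (mem_set Uv) (mem_set Uu); rewrite inE.
have dwb w (Uw : U w) := coef_C2_diff hb x tT Uw.
have dws w (Uw : U w) := coef_C2_diff hsigma x tT Uw.
have dwf w (Uw : U w) := coef_C2_diff hf x tT Uw.
have lim : dot (ham_x t x (uN N) p q) (y - x) @[N --> \oo] -->
    dot (ham_x t x u p q) (y - x).
  rewrite dotE; under eq_fun do rewrite dotE.
  apply: cvg_sumr => i; apply: cvgM; last exact: cvg_cst.
  rewrite (ham_xE (dwb u Uu) (dws u Uu) (dwf u Uu)).
  under eq_fun do rewrite (ham_xE (dwb _ (UN _)) (dws _ (UN _)) (dwf _ (UN _))).
  apply: cvgB; last exact: (coef_C2_dx_cvg om_modulus hf).
  apply: cvgD.
    apply: cvg_sumr => j; apply: cvgM; first exact: cvg_cst.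
    exact: (coef_C2_dx_cvg om_modulus hb).
  apply: cvg_sumr => l; apply: cvg_sumr => j; apply: cvgM; first exact: cvg_cst.
  exact: (coef_C2_dx_cvg om_modulus hsigma).
apply: (seq_limit_ge lim) => N; have [h0 h1] := N01 N.
have Np : 0 < (N.+1%:R)^-1 :> R by rewrite invr_gt0.
pose xN := (N.+1%:R)^-1 *: y + (1 - (N.+1%:R)^-1) *: x.
have xNE : xN - x = (N.+1%:R)^-1 *: (y - x).
  exact: conv_sub.
have c1 : - ham t xN (uN N) p q <=
    (N.+1%:R)^-1 * - ham t y v p q + (1 - (N.+1%:R)^-1) * - ham t x u p q.
  exact: (@convex_functionP R ('cV[R]_n * 'cV[R]_k)%type _ _ (y, v) (x, u) _ cH
    (conj I Uv) (conj I Uu) h0 h1).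
(* Concavity in x alone, with the control frozen at [uN N], where the gradient in [c2] is taken. *)
have cx s : 0 <= s -> s <= 1 -> - ham t (s *: xN + (1 - s) *: x) (uN N) p q <=
    s * - ham t xN (uN N) p q + (1 - s) * - ham t x (uN N) p q.
  move=> s0 s1; have e : s *: uN N + (1 - s) *: uN N = uN N.
    by rewrite -scalerDl addrC subrK scale1r.
  have := @convex_functionP R ('cV[R]_n * 'cV[R]_k)%type _ _ (xN, uN N) (x, uN N) _ cH
    (conj I (UN N)) (conj I (UN N)) s0 s1.
  by rewrite /= e.
have c2 := @concave_tangent R 'cV[R]_n (fun z => ham t z (uN N) p q) x xN cx
  (@derivable_ham _ _ _ (dwb _ (UN N)) (dws _ (UN N)) (dwf _ (UN N)) p q (xN - x)).
have c3 := maxu _ (UN N).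
rewrite (derive_ham (dwb _ (UN N)) (dws _ (UN N)) (dwf _ (UN N))) xNE in c2.
have e : dot (ham_x t x (uN N) p q) ((N.+1%:R)^-1 *: (y - x)) =
    (N.+1%:R)^-1 * dot (ham_x t x (uN N) p q) (y - x).
  by rewrite !dotE mulr_sumr; apply: eq_bigr => i _; rewrite !mxE; ring.
rewrite e in c2.
(* In the letters below, with K = 1/(N + 1): K (A - B) <= C - B <= C - D <= K E, by concavity on the
   segment, maximality of u and the tangent inequality. *)
rewrite -(ler_pM2l Np).
move: (ham t y v p q) (ham t x u p q) (ham t xN (uN N) p q) (ham t x (uN N) p q)
  (dot _ _) ((N.+1%:R)^-1) c1 c2 c3 => A B C D E K c1 c2 c3.
have : K * (A - B) = K * A - K * B by ring.
have : (1 - K) * - B = - B + K * B by ring.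
by rewrite mulrN in c1; lra.
Qed.

End inequality.

End hamiltonian.

(** * Coefficients along state and control processes *)

Section coefficients.
Context {R : realType} {n k : nat}.
Variables (T : R) (U : set 'cV[R]_k).

(** The preimage of B under [phi] is Borel only as a trace on the domain. Since the triple stays in
    the domain over E, it can be exchanged for a Borel set with the same trace. *)
Lemma coef_measurable_comp d (Z : measurableType d) (E : set Z) r c
    (phi : @coef R n k r c) (tau : Z -> R) (x : Z -> 'cV[R]_n) (v : Z -> 'cV[R]_k) i j :
  measurable E -> coef_measurable T U phi -> measurable_fun E tau ->
  (forall z, E z -> 0 <= tau z <= T /\ U (v z)) ->
  (forall i, measurable_fun E (fun z => x z i 0)) ->
  (forall i, measurable_fun E (fun z => v z i 0)) ->
  measurable_fun E (fun z => phi (tau z) (x z) (v z) i j).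
Proof.
move=> mE mphi mtau EU mx mv.
apply: (@bmeas_mxP _ _ R _ _ E (fun z => phi (tau z) (x z) (v z))) => // B bB.
have [C bC hC] := mphi B bB.
have := bmeas_triple mE mtau mx mv bC; congr (measurable _).
apply/seteqP; split => z [Ez h]; split => //; have [h1 h2] := EU z Ez.
  have : ((`[0, T] `*` setT `*` U) `&` C) (tau z, x z, v z).
    by split => //; split => //; split => //=; rewrite in_itv.
  by rewrite -hC => -[].
have : ((`[0, T] `*` setT `*` U) `&`
    (fun z => phi z.1.1 z.1.2 z.2) @^-1` B) (tau z, x z, v z).
  by split => //; split => //; split => //=; rewrite in_itv.
by rewrite hC => -[].
Qed.

Section lipschitz.
Variables (L : R) (om : R -> R) (r c : nat) (phi : @coef R n k r c).
Hypotheses (om0 : om 0 = 0) (hphi : coef_lipschitz T U L om phi).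

Lemma fnorm0 m l : fnorm (0 : 'M[R]_(m, l)) = 0.
Proof. by rewrite -(scale0r 0) fnormZ normr0 mul0r. Qed.

Lemma coef_lip t x x' u i j : 0 <= t <= T -> U u ->
  `|phi t x u i j - phi t x' u i j| <= L * fnorm (x - x').
Proof.
move=> tT Uu; have [h _] := hphi tT; have := h x x' u u Uu Uu.
rewrite subrr fnorm0 om0 addr0; apply: le_trans.
by have := entry_le (phi t x u - phi t x' u) i j; rewrite !mxE.
Qed.

Lemma coef_growth t x u i j : 0 <= t <= T -> U u ->
  `|phi t x u i j| <= L * fnorm x + L.
Proof.
move=> tT Uu; have [_ h] := hphi tT.
have h1 := coef_lip x 0 i j tT Uu; rewrite subr0 in h1.
have h2 := le_trans (entry_le _ i j) (h u Uu).
rewrite -(subrK (phi t 0 u i j) (phi t x u i j)).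
by apply: (le_trans (ler_normD _ _)); apply: lerD.
Qed.

Lemma coef_growth_sqr t x u i j : 0 <= t <= T -> U u ->
  phi t x u i j ^+ 2 <= 2 * L ^+ 2 * fnorm x ^+ 2 + 2 * L ^+ 2.
Proof.
move=> tT Uu; have h := coef_growth x i j tT Uu.
apply: (@le_trans _ _ ((L * fnorm x + L) ^+ 2)).
  rewrite -real_normK ?num_real// ler_pXn2r ?nnegrE//.
  exact: le_trans h.
by have := sqr_ge0 (L * fnorm x - L); nra.
Qed.

Lemma dx_seq t x u i j l : differentiable (phi t ^~ u) x ->
  N.+1%:R * (phi t (x + (N.+1%:R)^-1 *: delta_mx i 0) u j l - phi t x u j l)
    @[N --> \oo] --> dx (phi t ^~ u) i x j l.
Proof.
move=> dphi; rewrite /dx -derive_entry//.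
apply: (@derive_seq R 'cV[R]_n (fun y => phi t y u j l) x (delta_mx i 0)).
exact: derivable_entry.
Qed.

(** The Lipschitz constant bounds every difference quotient. Hence H_x, affine in (p, q) with
    bounded coefficients, is square integrable along the processes. *)
Lemma dx_le t x u i j l : 0 <= t <= T -> U u -> differentiable (phi t ^~ u) x ->
  `|dx (phi t ^~ u) i x j l| <= L.
Proof.
move=> tT Uu dphi; have h := @dx_seq t x u i j l dphi.
have hN (N : nat) : `|N.+1%:R * (phi t (x + (N.+1%:R)^-1 *: delta_mx i 0) u j l -
    phi t x u j l)| <= L.
  rewrite normrM ger0_norm// -ler_pdivlMl// mulrC.
  apply: (le_trans (coef_lip _ _ j l tT Uu)).
  by rewrite addrAC subrr add0r fnormZ fnorm_delta mulr1 ger0_norm ?invr_ge0.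
rewrite ler_norml; apply/andP; split.
  by apply: (seq_limit_ge h) => N; have := hN N; rewrite ler_norml => /andP[].
rewrite -lerN2; apply: (seq_limit_ge (cvgN h)) => N /=.
by rewrite lerN2; have := hN N; rewrite ler_norml => /andP[].
Qed.

End lipschitz.
End coefficients.

Section along_processes.
Context {R : realType} {disp : measure_display} {Omega : measurableType disp}.
Variables (P : probability Omega R) (T : R) (n k d : nat).
Variables (U : set 'cV[R]_k) (W : process (R := R) (Omega := Omega) d 1).
Local Notation mu := (@lebesgue_measure R).
Local Notation pi := (mu \x P)%E.
Local Notation Fmeas := (Fmeas P W).
Local Notation E := (`[0, T] `*` [set: Omega]).

(* Weaker than progressive measurability in the usual sense. *)
Definition progressive (g : R -> Omega -> R) : Prop :=
  measurable_fun E (fun z : R * Omega => g z.1 z.2) /\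
  forall t, 0 <= t <= T -> Fmeas t (g t).

Lemma progressive_trunc g : progressive g -> measurable_fun setT (trunc T g).
Proof. by move=> [mg _]; exact: measurable_trunc. Qed.

Lemma L2F_progressive r c (y : process r c) i j : L2F P T W y ->
  progressive (fun t w => y t w i j).
Proof.
move=> [ay my _]; split; first exact: jointly_measurable_comp.
by move=> t tT; exact: (adapted_Fmeas i j tT ay).
Qed.

Lemma progressive_coef r c (phi : @coef R n k r c) (x : R -> Omega -> 'cV[R]_n)
    (v : R -> Omega -> 'cV[R]_k) i j :
  coef_measurable T U phi -> (forall t w, 0 <= t <= T -> U (v t w)) ->
  (forall i, progressive (fun t w => x t w i 0)) ->
  (forall i, progressive (fun t w => v t w i 0)) ->
  progressive (fun t w => phi t (x t w) (v t w) i j).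
Proof.
move=> mphi Uv px pv; split.
  apply: (@coef_measurable_comp R n k T U _ (R * Omega)%type E r c phi fst
    (fun z => x z.1 z.2) (fun z => v z.1 z.2)) => //.
  - exact: measurableX.
  - by apply: measurable_funTS; exact: measurable_fst.
  - by move=> [t w] [/= tT _]; rewrite in_itv/= in tT; split => //; exact: Uv.
  - by move=> l; have [] := px l.
  - by move=> l; have [] := pv l.
move=> t tT.
apply: (@coef_measurable_comp R n k T U _
  (g_sigma_algebraType (past W t `|` P.-negligible)) setT r c phi (fun=> t) (x t) (v t)) => //.
- by move=> w _; split => //; exact: Uv.
- by move=> l; have [_ h] := px l; exact: h.
- by move=> l; have [_ h] := pv l; exact: h.
Qed.

Lemma progressive_cvg (h : nat -> R -> Omega -> R) g :
  (forall N, progressive (h N)) ->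
  (forall t w, 0 <= t <= T -> h N t w @[N --> \oo] --> g t w) -> progressive g.
Proof.
move=> ph hg; split.
  apply: (measurable_fun_cvg (h := fun N (z : R * Omega) => h N z.1 z.2)).
    by move=> N; have [] := ph N.
  by move=> [t w] [/= tT _]; rewrite in_itv/= in tT; exact: hg.
move=> t tT; apply: (@measurable_fun_cvg _ (g_sigma_algebraType
  (past W t `|` P.-negligible)) R setT (fun N => h N t) (g t)).
  by move=> N; have [_ H] := ph N; exact: H.
by move=> w _; exact: hg.
Qed.

Lemma progressiveD g h : progressive g -> progressive h ->
  progressive (fun t w => g t w + h t w).
Proof.
move=> [mg ag] [mh ah]; split; first exact: measurable_funD.
by move=> t tT; apply: measurable_funD; [exact: ag|exact: ah].
Qed.

Lemma progressiveM g h : progressive g -> progressive h ->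
  progressive (fun t w => g t w * h t w).
Proof.
move=> [mg ag] [mh ah]; split; first exact: measurable_funM.
by move=> t tT; apply: measurable_funM; [exact: ag|exact: ah].
Qed.

Lemma progressive_cst a : progressive (fun _ _ => a).
Proof. by split => [|t tT]; exact: measurable_cst. Qed.

Lemma progressiveN g : progressive g -> progressive (fun t w => - g t w).
Proof.
move=> pg; have := progressiveM (progressive_cst (-1)) pg.
by congr progressive; apply/funext => t; apply/funext => w; rewrite mulN1r.
Qed.

Lemma progressiveB g h : progressive g -> progressive h ->
  progressive (fun t w => g t w - h t w).
Proof. by move=> pg ph; apply: progressiveD => //; exact: progressiveN. Qed.

Lemma progressive_sum m (g : 'I_m -> R -> Omega -> R) :
  (forall i, progressive (g i)) -> progressive (fun t w => \sum_i g i t w).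
Proof.
move=> pg; split.
  by apply: measurable_sum => i; have [] := pg i.
move=> t tT; apply: (@measurable_sum _ (g_sigma_algebraType _)) => i.
by have [_ h] := pg i; exact: h.
Qed.

Lemma progressive_eq g h : (forall t w, 0 <= t <= T -> g t w = h t w) ->
  progressive g -> progressive h.
Proof.
move=> gh pg; apply: (@progressive_cvg (fun=> g)) => // t w tT.
by rewrite gh//; exact: cvg_cst.
Qed.

Lemma L2_trunc_bounded y g L : L2 pi (trunc T y) -> progressive g ->
  (forall t w, 0 <= t <= T -> `|g t w| <= L) -> 0 <= L ->
  L2 pi (trunc T (fun t w => y t w * g t w)).
Proof.
move=> y2 pg gL L0.
have -> : trunc T (fun t w => y t w * g t w) = fun z => trunc T y z * trunc T g z.
  apply/funext => z; rewrite /trunc indicE.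
  by case: (_ \in _); rewrite ?mul1r// !mul0r.
apply: (L2Mb y2 (progressive_trunc pg) (M := L)) => -[t w].
by have [tT|tT] := boolP (0 <= t <= T);
  [rewrite trunc_in// gL|rewrite trunc_out// normr0].
Qed.

Lemma L2_trunc1 : L2 pi (trunc T (fun _ _ => 1)).
Proof.
exact: (L2_tensor (L2_indic0T T) (L2_cst P 1)).
Qed.

End along_processes.

Section coefficients_along_processes.
Context {R : realType} {disp : measure_display} {Omega : measurableType disp}.
Variables (P : probability Omega R) (T : R) (T0 : 0 <= T) (n k d : nat).
Variables (U : set 'cV[R]_k) (W : process (R := R) (Omega := Omega) d 1).
Local Notation mu := (@lebesgue_measure R).
Local Notation pi := (mu \x P)%E.
Local Notation progressive := (progressive P T W).

Variables (x : process (R := R) (Omega := Omega) n 1)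
          (v : process (R := R) (Omega := Omega) k 1).
Hypotheses (x2 : L2F P T W x) (v2 : L2F P T W v)
           (Uv : forall t w, 0 <= t <= T -> U (v t w)).

Let px i : progressive (fun t w => x t w i 0). Proof. exact: L2F_progressive. Qed.
Let pv i : progressive (fun t w => v t w i 0). Proof. exact: L2F_progressive. Qed.

Section one_coefficient.
Variables (L : R) (om : R -> R) (L' : R) (om' : R -> R) (r c : nat).
Variable phi : @coef R n k r c.
Hypotheses (L0 : 0 <= L) (om0 : om 0 = 0) (mphi : coef_measurable T U phi)
  (lphi : coef_lipschitz T U L om phi) (dphi : coef_C2 T U L' om' phi).

Lemma coef_progressive i j : progressive (fun t w => phi t (x t w) (v t w) i j).
Proof. exact: (progressive_coef i j mphi Uv px pv). Qed.

Lemma coef_L2 i j : L2 pi (trunc T (fun t w => phi t (x t w) (v t w) i j)).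
Proof.
have hx : L1 pi (trunc T (fun t w => fnorm (x t w) ^+ 2)).
  have [_ mx ix] := x2; apply: L1_trunc => //; first exact: measurable_trunc_fnorm.
  by move=> t w; exact: sqr_ge0.
have h1 : L1 pi (trunc T (fun _ _ => 1)) := L1_trunc_L2 (L2_trunc1 P T).
apply: (L2_le _ _ (L1D (L1Zl (2 * L ^+ 2) hx) (L1Zl (2 * L ^+ 2) h1))).
  exact: progressive_trunc (coef_progressive i j).
move=> [t w]; have [tT|tT] := boolP (0 <= t <= T); last first.
  by rewrite !trunc_out// expr0n/= !mulr0 addr0.
rewrite !trunc_in// mulr1.
exact: (coef_growth_sqr om0 lphi (x t w) i j tT (Uv w tT)).
Qed.

(** (A1) gives measurability of the coefficient, not of its derivative; the latter is a pointwise
    limit of difference quotients, each made of the coefficient along the state and a shifted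
    state. *)
Lemma dx_progressive i j l :
  progressive (fun t w => dx (phi t ^~ (v t w)) i (x t w) j l).
Proof.
apply: (@progressive_cvg _ _ _ _ _ _ _ (fun N t w => N.+1%:R *
  (phi t (x t w + (N.+1%:R)^-1 *: delta_mx i 0) (v t w) j l -
   phi t (x t w) (v t w) j l))).
  move=> N; apply: progressiveM; first exact: progressive_cst.
  apply: progressiveB; last exact: coef_progressive.
  apply: (@progressive_coef _ _ _ _ _ _ _ _ U W r c phi
    (fun t w => x t w + (N.+1%:R)^-1 *: delta_mx i 0) v) => // m.
  apply: (@progressive_eq _ _ _ _ _ _ _ (fun t w => x t w m 0 +
    ((N.+1%:R)^-1 *: (delta_mx i 0 : 'cV[R]_n)) m 0)).
    by move=> t w _; rewrite !mxE.
  by apply: progressiveD => //; exact: progressive_cst.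
move=> t w tT.
exact: (@dx_seq R n k r c phi t (x t w) (v t w) i j l (coef_C2_diff dphi _ tT (Uv w tT))).
Qed.

Lemma dx_bounded i j l t w : 0 <= t <= T ->
  `|dx (phi t ^~ (v t w)) i (x t w) j l| <= L.
Proof.
move=> tT; apply: (dx_le om0 lphi _ _ _ tT (Uv w tT)).
exact: (coef_C2_diff dphi _ tT (Uv w tT)).
Qed.

Lemma dx_mul_L2 y i j l : L2 pi (trunc T y) ->
  L2 pi (trunc T (fun t w => y t w * dx (phi t ^~ (v t w)) i (x t w) j l)).
Proof.
move=> y2; apply: (L2_trunc_bounded y2 (dx_progressive i j l) _ L0) => t w tT.
exact: dx_bounded.
Qed.

End one_coefficient.

Section hamiltonian.
Variables (L : R) (om : R -> R) (L' : R) (om' : R -> R).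
Variables (b : R -> 'cV[R]_n -> 'cV[R]_k -> 'cV[R]_n)
          (sigma : R -> 'cV[R]_n -> 'cV[R]_k -> 'M[R]_(n, d))
          (f : R -> 'cV[R]_n -> 'cV[R]_k -> R).
Local Notation f1 := (scalar_coef f).
Hypotheses (L0 : 0 <= L) (om0 : om 0 = 0)
  (mb : coef_measurable T U b) (lb : coef_lipschitz T U L om b)
  (db : coef_C2 T U L' om' b)
  (ms : coef_measurable T U sigma) (ls : coef_lipschitz T U L om sigma)
  (ds : coef_C2 T U L' om' sigma)
  (mf : coef_measurable T U f1) (lf : coef_lipschitz T U L om f1)
  (df : coef_C2 T U L' om' f1).
Variables (p : process (R := R) (Omega := Omega) n 1)
          (q : process (R := R) (Omega := Omega) n d).
Hypotheses (p2 : L2F P T W p) (q2 : L2F P T W q).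

(** [ham_x] in coordinates; the factor 1 gives the running-cost term the shape y * dx phi of
    [dx_mul_L2]. *)
Let G i t w := \sum_j p t w j 0 * dx (b t ^~ (v t w)) i (x t w) j 0 +
  \sum_l \sum_j q t w j l * dx (sigma t ^~ (v t w)) i (x t w) j l -
  1 * dx (f1 t ^~ (v t w)) i (x t w) 0 0.

Let ham_xG i t w : 0 <= t <= T ->
  G i t w = ham_x b sigma f t (x t w) (v t w) (p t w) (q t w) i 0.
Proof.
move=> tT; have Uw := Uv w tT; rewrite ham_xE /G ?mul1r//.
- exact: (coef_C2_diff db).
- exact: (coef_C2_diff ds).
- exact: (coef_C2_diff df).
Qed.

Lemma ham_x_progressive i : progressive
  (fun t w => ham_x b sigma f t (x t w) (v t w) (p t w) (q t w) i 0).
Proof.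
apply: (@progressive_eq _ _ _ _ _ _ _ (G i)); first by move=> t w; exact: ham_xG.
apply: progressiveB; last first.
  by apply: progressiveM; [exact: progressive_cst|exact: (dx_progressive mf df)].
apply: progressiveD.
  apply: progressive_sum => j; apply: progressiveM; first exact: L2F_progressive.
  exact: (dx_progressive mb db).
apply: progressive_sum => l; apply: progressive_sum => j.
apply: progressiveM; first exact: L2F_progressive.
exact: (dx_progressive ms ds).
Qed.

Lemma ham_x_L2 i : L2 pi (trunc T
  (fun t w => ham_x b sigma f t (x t w) (v t w) (p t w) (q t w) i 0)).
Proof.
have -> : trunc T (fun t w => ham_x b sigma f t (x t w) (v t w) (p t w) (q t w) i 0) =
  (fun z => \sum_j trunc T (fun t w => p t w j 0 *
      dx (b t ^~ (v t w)) i (x t w) j 0) z +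
   \sum_l \sum_j trunc T (fun t w => q t w j l *
      dx (sigma t ^~ (v t w)) i (x t w) j l) z -
   trunc T (fun t w => 1 * dx (f1 t ^~ (v t w)) i (x t w) 0 0) z).
  apply/funext => -[t w]; have [tT|tT] := boolP (0 <= t <= T); last first.
    rewrite !trunc_out// !big1 ?addr0 ?subr0// => l _; rewrite ?trunc_out//.
    by rewrite big1// => j _; rewrite trunc_out.
  rewrite !trunc_in// -ham_xG// /G.
  congr (_ + _ - _); first by apply: eq_bigr => j _; rewrite trunc_in.
  by apply: eq_bigr => l _; apply: eq_bigr => j _; rewrite trunc_in.
apply: L2B; last exact: (dx_mul_L2 L0 om0 mf lf df _ _ _ (L2_trunc1 P T)).
apply: L2D.
  apply: L2_sum => j _.
  exact: (dx_mul_L2 L0 om0 mb lb db _ _ _ (L2F_L2 j 0 p2)).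
apply: L2_sum => l _; apply: L2_sum => j _.
exact: (dx_mul_L2 L0 om0 ms ls ds _ _ _ (L2F_L2 j l q2)).
Qed.

End hamiltonian.
End coefficients_along_processes.

(** * Comparison of costs *)

Lemma Rint_le0_ae d (X : measurableType d) (R : realType)
    (m : {measure set X -> \bar R}) (g : X -> R) :
  L1 m g -> {ae m, forall x, g x <= 0} -> \int[m]_x g x <= 0.
Proof.
move=> hg g0; have mg := L1_measurable hg.
have mg' : measurable_fun setT (fun x => Num.min (g x) 0) by exact: measurable_minr.
have e : {ae m, forall x, g x = Num.min (g x) 0}.
  by apply: filterS g0 => x gx; rewrite min_l.
rewrite (ae_Rint mg mg' e) -oppr_ge0 -RintN; last exact: L1_ae hg.
by apply: Rint_ge0 => x; rewrite oppr_ge0 ge_min lexx orbT.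
Qed.

Section terminal_cost.
Context {R : realType} {n k : nat}.
Variables (T : R) (T0 : 0 <= T) (U : set 'cV[R]_k) (u0 : 'cV[R]_k) (Uu0 : U u0).
Variables (h : 'cV[R]_n -> R) (L : R) (om : R -> R) (L' : R) (om' : R -> R).
Local Notation h1 := (scalar_coef (k := k) (fun _ x _ => h x)).
Hypotheses (om0 : om 0 = 0) (mh : borel_on [set: 'cV[R]_n] h)
  (lh : coef_lipschitz T U L om h1) (dh : coef_C2 T U L' om' h1)
  (h_convex : convex_function [set: 'cV[R]_n] h).

Let TT : 0 <= T <= T. Proof. by rewrite T0 lexx. Qed.

(** (A1) treats h as a coefficient constant in t and u, so reading off its properties takes a time,
    here T, and a point [u0] of U. *)
Let hE x : h1 T x u0 0 0 = h x. Proof. by rewrite mxE mulr1n. Qed.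

Lemma terminal_L1 disp (Omega : measurableType disp) (P : probability Omega R)
    (x : Omega -> 'cV[R]_n) : (forall i, L2 P (fun w => x w i 0)) ->
  L1 P (fun w => h (x w)).
Proof.
move=> x2; apply: L2_L1.
have hx : L1 P (fun w => fnorm (x w) ^+ 2).
  under eq_fun do rewrite fnorm_sqr.
  by apply: L1_sum => i _; apply: L1_sum => j _; rewrite ord1; exact: (x2 i).2.
apply: (L2_le _ _ (L1D (L1Zl (2 * L ^+ 2) hx) (L1_cst P (2 * L ^+ 2)))).
  apply/(bmeasR _ measurableT) => B bB.
  have [C bC hC] := mh bB.
  have mx : bmeas setT x.
    by apply: bmeas_mx => // i j; rewrite ord1; exact: (x2 i).1.
  have := mx C bC; rewrite !setTI in hC *.
  by rewrite -hC.
by move=> w; rewrite -hE; exact: (coef_growth_sqr om0 lh (x w) 0 0 TT Uu0).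
Qed.

Lemma terminal_tangent x y : dot (grad h x) (y - x) <= h y - h x.
Proof.
have dx1 : differentiable (h1 T ^~ u0) x := coef_C2_diff dh x TT Uu0.
have e : (fun z => h1 T z u0 0 0) = h by apply/funext => z; exact: hE.
have dhx v : derivable h x v.
  by rewrite -e; exact: derivable_entry.
have -> : dot (grad h x) (y - x) = 'D_(y - x) h x.
  rewrite -[in RHS]e derive_entry// derive_dx// summxE dotE.
  apply: eq_bigr => i _; rewrite !mxE mulrC; congr (_ * _).
  by rewrite /dx -derive_entry// e.
have cg s : 0 <= s -> s <= 1 ->
    - (- h) (s *: y + (1 - s) *: x) <= s * - (- h) y + (1 - s) * - (- h) x.
  by move=> s0 s1; rewrite !opprK; exact: (convex_functionP h_convex I I s0 s1).
have := @concave_tangent R 'cV[R]_n (- h) x y cg (derivableN (dhx (y - x))).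
rewrite deriveN// => H.
by rewrite -lerN2 opprB; apply: le_trans H; rewrite !fctE; lra.
Qed.

End terminal_cost.

Section comparison.
Context {R : realType} {disp : measure_display} {Omega : measurableType disp}.
Variables (P : probability Omega R) (T : R) (T0 : 0 <= T) (n d k : nat).
Variables (W : process (R := R) (Omega := Omega) d 1) (U : set 'cV[R]_k).
Variables (b : R -> 'cV[R]_n -> 'cV[R]_k -> 'cV[R]_n)
          (sigma : R -> 'cV[R]_n -> 'cV[R]_k -> 'M[R]_(n, d))
          (f : R -> 'cV[R]_n -> 'cV[R]_k -> R) (h : 'cV[R]_n -> R)
          (x0 : 'cV[R]_n).
Local Notation mu := (@lebesgue_measure R).
Local Notation pi := (mu \x P)%E.
Local Notation f1 := (scalar_coef f).
Local Notation h1 := (scalar_coef (k := k) (fun _ x _ => h x)).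
Local Notation ham := (ham b sigma f).
Local Notation ham_x := (ham_x b sigma f).
Variables (L : R) (om : R -> R) (L' : R) (om' : R -> R).
Hypotheses (P_complete : measure_is_complete P)
  (W_brownian : brownian_motion P T W)
  (L0 : 0 <= L) (om0 : om 0 = 0) (om'_modulus : modulus om')
  (mb : coef_measurable T U b) (lb : coef_lipschitz T U L om b)
  (db : coef_C2 T U L' om' b)
  (ms : coef_measurable T U sigma) (ls : coef_lipschitz T U L om sigma)
  (ds : coef_C2 T U L' om' sigma)
  (mf : coef_measurable T U f1) (lf : coef_lipschitz T U L om f1)
  (df : coef_C2 T U L' om' f1)
  (mh : borel_on [set: 'cV[R]_n] h) (lh : coef_lipschitz T U L om h1)
  (dh : coef_C2 T U L' om' h1)
  (h_convex : convex_function [set: 'cV[R]_n] h) (U_convex : convex_set U)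
  (H_max : max_exists T U b sigma f).

Let TT : 0 <= T <= T. Proof. by rewrite T0 lexx. Qed.

Lemma state_semimartingale (v : process k 1) (y : process n 1) :
  admissible T U P W v -> state T b sigma P W x0 v y ->
  exists2 I : process n 1,
    ito_integral P T W (fun t w => sigma t (y t w) (v t w)) I &
    forall i, semimartingale P T W (fun t w => y t w i 0) (x0 i 0)
      (fun t w => b t (y t w) (v t w) i 0) (fun t w => I t w i 0).
Proof.
move=> [Uv v2] [y2 y0 yE].
apply: (ito_semimartingale T0 P_complete W_brownian y2 y0 yE) => i.
  exact: (coef_L2 y2 v2 Uv om0 mb lb).
by move=> t tT; have [_ H] := coef_progressive y2 v2 Uv mb i 0; exact: H.
Qed.

Section candidate.
Variables (x : process (R := R) (Omega := Omega) n 1)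
  (u : process (R := R) (Omega := Omega) k 1)
  (p : process (R := R) (Omega := Omega) n 1)
  (q : process (R := R) (Omega := Omega) n d) (p0 : 'cV[R]_n).
Hypothesis forward : forward_system T U b sigma f P W x0 p0 x u p q.

Let ham_xt t w := ham_x t (x t w) (u t w) (p t w) (q t w).

Lemma adjoint_semimartingale :
  exists2 I : process n 1, ito_integral P T W q I &
    forall i, semimartingale P T W (fun t w => p t w i 0) (p0 i 0)
      (fun t w => - ham_xt t w i 0) (fun t w => I t w i 0).
Proof.
have [[[Uu u2] [x2 _ _] [p2 q2] pE _] p00] := forward.
have e i : (fun t w => (- ham_xt t w) i 0) = (fun t w => - ham_xt t w i 0).
  by apply/funext => t; apply/funext => w; rewrite mxE.
have [||I qI H] := ito_semimartingale T0 P_complete W_brownian p2 p00 pE.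
- move=> i; rewrite e.
  have := L2N (ham_x_L2 x2 u2 Uu L0 om0 mb lb db ms ls ds mf lf df p2 q2 i).
  by congr (L2 _ _); apply/funext => z; rewrite /trunc mulrN.
- move=> i t tT.
  have [_ H] := progressiveN (ham_x_progressive x2 u2 Uu mb db ms ds mf df p2 q2 i).
  have -> : (fun w => (- ham_xt t w) i 0) = (fun w => - ham_xt t w i 0).
    by apply/funext => w; rewrite mxE.
  exact: H t tT.
exists I => // i; have := H i; by rewrite e.
Qed.

Section competitor.
Variables (v : process (R := R) (Omega := Omega) k 1)
          (y : process (R := R) (Omega := Omega) n 1).
Hypotheses (v_adm : admissible T U P W v) (y_state : state T b sigma P W x0 v y).

(** The drift of <p, y - x>, including the covariation of the two noises. *)
Let Delta t w := \sum_i ((y t w i 0 - x t w i 0) * - ham_xt t w i 0 +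
  p t w i 0 * (b t (y t w) (v t w) i 0 - b t (x t w) (u t w) i 0) +
  \sum_l (sigma t (y t w) (v t w) i l - sigma t (x t w) (u t w) i l) * q t w i l).

Lemma L1_trunc_sum m (g : 'I_m -> R -> Omega -> R) :
  (forall i, L1 pi (trunc T (g i))) -> L1 pi (trunc T (fun t w => \sum_i g i t w)).
Proof.
move=> hg; have := @L1_sum _ _ _ pi _ (index_enum 'I_m) xpredT _ (fun i _ => hg i).
by apply: eq_integrable => // z _ /=; rewrite /trunc mulr_sumr.
Qed.

(** The product rule is applied to y_i p_i and to x_i p_i; both start from [x0 i 0 * p0 i 0], so the
    initial terms cancel. *)
Lemma pairing_terminal : L1 pi (trunc T Delta) /\
  \int[P]_w (\sum_i p T w i 0 * (y T w i 0 - x T w i 0)) =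
  \int[pi]_z trunc T Delta z.
Proof.
have [[u_adm x_state [p2 q2] _ _] _] := forward.
have [[Uu u2] [x2 _ _]] := (u_adm, x_state).
have [[Uv v2] [y2 _ _]] := (v_adm, y_state).
have [Ip qIp sp] := adjoint_semimartingale.
have [Ix sIx sx] := state_semimartingale u_adm x_state.
have [Iy sIy sy] := state_semimartingale v_adm y_state.
have tM (g1 g2 : R -> Omega -> R) z :
    trunc T g1 z * trunc T g2 z = trunc T (fun t w => g1 t w * g2 t w) z.
  by rewrite /trunc indicE; case: (_ \in _); rewrite ?mul1r ?mul0r.
have tB (g1 g2 : R -> Omega -> R) z :
    trunc T g1 z - trunc T g2 z = trunc T (fun t w => g1 t w - g2 t w) z.
  by rewrite /trunc mulrBr.
have tL2 g1 g2 : L2 pi (trunc T g1) -> L2 pi (trunc T g2) ->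
    L1 pi (trunc T (fun t w => g1 t w * g2 t w)).
  by move=> h1 h2; have := L2M h1 h2; congr (L1 _ _); apply/funext => z; exact: tM.
have tL2B g1 g2 : L2 pi (trunc T g1) -> L2 pi (trunc T g2) ->
    L2 pi (trunc T (fun t w => g1 t w - g2 t w)).
  by move=> h1 h2; have := L2B h1 h2; congr (L2 _ _); apply/funext => z; exact: tB.
pose A i t w := (y t w i 0 - x t w i 0) * - ham_xt t w i 0.
pose B i t w := p t w i 0 * (b t (y t w) (v t w) i 0 - b t (x t w) (u t w) i 0).
pose C i l t w := (sigma t (y t w) (v t w) i l - sigma t (x t w) (u t w) i l) * q t w i l.
have hL2 i : L2 pi (trunc T (fun t w => - ham_xt t w i 0)) by have [[]] := sp i.
have s2y i l := coef_L2 y2 v2 Uv om0 ms ls i l.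
have s2x i l := coef_L2 x2 u2 Uu om0 ms ls i l.
have iA i : L1 pi (trunc T (A i)).
  exact: (tL2 _ _ (tL2B _ _ (L2F_L2 i 0 y2) (L2F_L2 i 0 x2)) (hL2 i)).
have iB i : L1 pi (trunc T (B i)).
  exact: (tL2 _ _ (L2F_L2 i 0 p2) (tL2B _ _ (coef_L2 y2 v2 Uv om0 mb lb i 0)
    (coef_L2 x2 u2 Uu om0 mb lb i 0))).
have iC i l : L1 pi (trunc T (C i l)).
  exact: (tL2 _ _ (tL2B _ _ (s2y i l) (s2x i l)) (L2F_L2 i l q2)).
have iD i : L1 pi (trunc T (fun t w => A i t w + B i t w + \sum_l C i l t w)).
  have := L1D (L1D (iA i) (iB i)) (L1_trunc_sum (iC i)).
  by congr (L1 _ _); apply/funext => z; rewrite /trunc !mulrDr.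
split; first exact: (L1_trunc_sum iD).
have pT i := semimartingale_L2 T0 (sp i) TT.
have xT i := semimartingale_L2 T0 (sx i) TT.
have yT i := semimartingale_L2 T0 (sy i) TT.
have term i : \int[P]_w (p T w i 0 * (y T w i 0 - x T w i 0)) =
    \int[pi]_z trunc T (fun t w => A i t w + B i t w + \sum_l C i l t w) z.
  have e1 := product_rule T0 (sy i) (sp i).
  have e2 := product_rule T0 (sx i) (sp i).
  rewrite (ito_isometry P_complete W_brownian i i T0 sIy qIp) in e1.
  rewrite (ito_isometry P_complete W_brownian i i T0 sIx qIp) in e2.
  transitivity (\int[P]_w (y T w i 0 * p T w i 0) - \int[P]_w (x T w i 0 * p T w i 0)).
    rewrite -RintB; [|exact: (L2M (yT i) (pT i))|exact: (L2M (xT i) (pT i))].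
    by apply: eq_Rintegral => w _; ring.
  rewrite e1 e2.
  transitivity (\int[pi]_z trunc T (A i) z + \int[pi]_z trunc T (B i) z +
      \sum_l \int[pi]_z trunc T (C i l) z); last first.
    rewrite -Rint_sum; last by move=> l _; exact: iC.
    rewrite -(RintD (iA i) (iB i)) -RintD; [|exact: L1D|by apply: L1_sum => l _; exact: iC].
    by apply: eq_Rintegral => z _; rewrite /trunc !mulrDr mulr_sumr.
  rewrite [X in X - _]addrAC [X in _ - X]addrAC.
  have -> : \int[pi]_z trunc T (A i) z =
      \int[pi]_z (trunc T (fun t w => y t w i 0) z * trunc T (fun t w => - ham_xt t w i 0) z) -
      \int[pi]_z (trunc T (fun t w => x t w i 0) z * trunc T (fun t w => - ham_xt t w i 0) z).
    rewrite -RintB; [|exact: (L2M (L2F_L2 i 0 y2) (hL2 i))|exact: (L2M (L2F_L2 i 0 x2) (hL2 i))].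
    by apply: eq_Rintegral => z _; rewrite -mulrBl tB tM.
  have -> : \int[pi]_z trunc T (B i) z =
      \int[pi]_z (trunc T (fun t w => p t w i 0) z *
        trunc T (fun t w => b t (y t w) (v t w) i 0) z) -
      \int[pi]_z (trunc T (fun t w => p t w i 0) z *
        trunc T (fun t w => b t (x t w) (u t w) i 0) z).
    have b2y := coef_L2 y2 v2 Uv om0 mb lb i 0.
    have b2x := coef_L2 x2 u2 Uu om0 mb lb i 0.
    rewrite -RintB; [|exact: (L2M (L2F_L2 i 0 p2) b2y)|exact: (L2M (L2F_L2 i 0 p2) b2x)].
    by apply: eq_Rintegral => z _; rewrite -mulrBr tB tM.
  have -> : \sum_l \int[pi]_z trunc T (C i l) z =
      \sum_l \int[pi]_z (trunc T (fun t w => sigma t (y t w) (v t w) i l) z *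
        trunc T (fun t w => q t w i l) z) -
      \sum_l \int[pi]_z (trunc T (fun t w => sigma t (x t w) (u t w) i l) z *
        trunc T (fun t w => q t w i l) z).
    rewrite -sumrB; apply: eq_bigr => l _.
    rewrite -RintB; [|exact: (L2M (s2y i l) (L2F_L2 i l q2))|exact: (L2M (s2x i l) (L2F_L2 i l q2))].
    by apply: eq_Rintegral => z _; rewrite -mulrBl tB tM.
  move: (\sum_l _) (\sum_l _) => S1 S2.
  by move: (\int[pi]_z _) (\int[pi]_z _) (\int[pi]_z _) (\int[pi]_z _) => *; ring.
rewrite Rint_sum; last first.
  by move=> i _; exact: (L2M (pT i) (L2B (yT i) (xT i))).
rewrite (eq_bigr _ (fun i _ => term i)) -Rint_sum; last by move=> i _; exact: iD.
by apply: eq_Rintegral => z _; rewrite /trunc mulr_sumr.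
Qed.

Hypothesis H_concave : {ae P, forall w, forall t, 0 <= t <= T ->
  convex_function ([set: 'cV[R]_n] `*` U)
    (fun z : 'cV[R]_n * 'cV[R]_k => - ham t z.1 z.2 (p t w) (q t w))}.
Hypothesis terminal : {ae P, forall w, p T w = - grad h (x T w)}.

(** [hbar] is a [sup], an upper bound only for a set bounded above; [H_max] supplies the bound. *)
Lemma ham_max t z c r s a : 0 <= t <= T -> U a ->
  ham t z c r s = hbar U b sigma f t z r s -> ham t z a r s <= ham t z c r s.
Proof.
move=> tT Ua ->; apply: sup_upper_bound; last by exists a.
split; first by exists (ham t z a r s), a.
have [e Ue maxe] := H_max z r s tT; exists (ham t z e r s) => _ [g Ug <-].
exact: maxe.
Qed.

Let Df t w := f t (y t w) (v t w) - f t (x t w) (u t w).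

Lemma Delta_ham t w : Delta t w - Df t w =
  ham t (y t w) (v t w) (p t w) (q t w) - ham t (x t w) (u t w) (p t w) (q t w) -
  dot (ham_xt t w) (y t w - x t w).
Proof.
rewrite !hamE dotE /Df /Delta !mxE !mulr1n !big_split/=.
have -> : \sum_i (y t w i 0 - x t w i 0) * - ham_xt t w i 0 =
    - \sum_i ham_xt t w i 0 * (y t w - x t w) i 0.
  by rewrite -sumrN; apply: eq_bigr => i _; rewrite !mxE mulrN mulrC.
have -> : \sum_i p t w i 0 * (b t (y t w) (v t w) i 0 - b t (x t w) (u t w) i 0) =
    \sum_i p t w i 0 * b t (y t w) (v t w) i 0 -
    \sum_i p t w i 0 * b t (x t w) (u t w) i 0.
  by rewrite -sumrB; apply: eq_bigr => i _; rewrite mulrBr.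
have -> : \sum_i \sum_l (sigma t (y t w) (v t w) i l - sigma t (x t w) (u t w) i l) *
      q t w i l =
    \sum_l \sum_i q t w i l * sigma t (y t w) (v t w) i l -
    \sum_l \sum_i q t w i l * sigma t (x t w) (u t w) i l.
  rewrite exchange_big -sumrB; apply: eq_bigr => l _; rewrite -sumrB.
  by apply: eq_bigr => i _; rewrite mulrBl mulrC [X in _ - X]mulrC.
move: (\sum_i _) (\sum_i _) (\sum_i _) (\sum_i _) (\sum_i _) => S1 S2 S3 S4 S5.
by ring.
Qed.

Lemma L1_running (c : process k 1) (z : process n 1) :
  admissible T U P W c -> state T b sigma P W x0 c z ->
  L1 pi (trunc T (fun t w => f t (z t w) (c t w))).
Proof.
move=> [Uc c2] [z2 _ _].
have := L1_trunc_L2 (coef_L2 z2 c2 Uc om0 mf lf 0 0); congr (L1 _ _).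
by congr (trunc _ _); apply/funext => t; apply/funext => w; rewrite mxE mulr1n.
Qed.

Lemma Delta_le : \int[pi]_z trunc T (fun t w => Delta t w - Df t w) z <= 0.
Proof.
have [[u_adm x_state _ _ maxH] _] := forward.
have [Uu _] := u_adm; have [Uv _] := v_adm.
have iD : L1 pi (trunc T (fun t w => Delta t w - Df t w)).
  have := L1B pairing_terminal.1 (L1B (L1_running v_adm y_state) (L1_running u_adm x_state)).
  by congr (L1 _ _); apply/funext => z; rewrite /trunc !mulrBr.
(* Time is kept outside because the null set of the maximum condition depends on t. *)
rewrite (Rint_fubini1 iD); apply: Rint_le0_ae; first exact: L1_fubini1.
move: maxH (ae_L1_section1 iD).
apply: (@filterS2 _ _ (ae_filter_ringOfSetsType mu)) => t maxt iDt.
apply: Rint_le0_ae => //; have [tT|tT] := boolP (0 <= t <= T); last first.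
  by apply: filterE => w; rewrite trunc_out.
move: (maxt tT) H_concave; apply: filterS2 => w maxw /(_ t tT) cH.
rewrite trunc_in// Delta_ham subr_le0.
apply: (ham_le om'_modulus db ds df _ tT U_convex (Uu t w tT) (Uv t w tT) cH).
by move=> a Ua; exact: ham_max.
Qed.

Lemma cost_le : (cost T f h P u x <= cost T f h P v y)%E.
Proof.
have [[u_adm x_state p_q _ _] _] := forward.
(* The control at time 0 and an arbitrary sample point provide the element of U that the lemmas on h
   take. *)
have u0 : U (u 0 point) by apply: u_adm.1; rewrite lexx.
have iu := L1_running u_adm x_state; have iv := L1_running v_adm y_state.
have [Ip _ sp] := adjoint_semimartingale.
have [Ix _ sx] := state_semimartingale u_adm x_state.
have [Iy _ sy] := state_semimartingale v_adm y_state.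
have pT i := semimartingale_L2 T0 (sp i) TT.
have xT i := semimartingale_L2 T0 (sx i) TT.
have yT i := semimartingale_L2 T0 (sy i) TT.
have hx := terminal_L1 T0 u0 om0 mh lh xT.
have hy := terminal_L1 T0 u0 om0 mh lh yT.
have cu : cost T f h P u x = _ := cost_Rint iu hx.
have cv : cost T f h P v y = _ := cost_Rint iv hy.
rewrite cu cv lee_fin.
have [iD eD] := pairing_terminal.
have iP : L1 P (fun w => \sum_i p T w i 0 * (y T w i 0 - x T w i 0)).
  by apply: L1_sum => i _; exact: (L2M (pT i) (L2B (yT i) (xT i))).
have term : \int[P]_w (h (x T w) - h (y T w) -
    \sum_i p T w i 0 * (y T w i 0 - x T w i 0)) <= 0.
  apply: Rint_le0_ae; first exact: L1B (L1B hx hy) iP.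
  move: terminal; apply: filterS => w ->.
  have := terminal_tangent T0 u0 dh h_convex (x T w) (y T w); rewrite dotE.
  have -> : \sum_i (- grad h (x T w)) i 0 * (y T w i 0 - x T w i 0) =
      - \sum_i grad h (x T w) i 0 * (y T w - x T w) i 0.
    by rewrite -sumrN; apply: eq_bigr => i _; rewrite !mxE mulNr.
  by lra.
rewrite (RintB (L1B hx hy) iP) (RintB hx hy) eD in term.
have run := Delta_le.
have e : \int[pi]_z trunc T (fun t w => Delta t w - Df t w) z =
    \int[pi]_z trunc T Delta z -
    (\int[pi]_z trunc T (fun t w => f t (y t w) (v t w)) z -
     \int[pi]_z trunc T (fun t w => f t (x t w) (u t w)) z).
  rewrite -(RintB iv iu) -(RintB iD (L1B iv iu)).
  by apply: eq_Rintegral => z _; rewrite /trunc !mulrBr.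
(* The integral of [Delta] cancels between [term] and [run], leaving J(u) <= J(v). *)
by lra.
Qed.

End competitor.
End candidate.
End comparison.

Lemma expectation_sqr_eq0 (R : realType) d (Omega : measurableType d)
    (P : probability Omega R) m (y z : Omega -> 'cV[R]_m) :
  (forall i, measurable_fun setT (fun w => y w i 0)) ->
  (forall i, measurable_fun setT (fun w => z w i 0)) ->
  ('E_P[(fun w => (fnorm (y w - z w) ^+ 2)%R)] = 0)%E ->
  {ae P, forall w, z w = y w}.
Proof.
move=> my mz; rewrite unlock => e.
have mg : measurable_fun setT (fun w => (fnorm (y w - z w) ^+ 2)%:E).
  apply/measurable_EFinP/measurable_fnorm_sqr => i j; rewrite ord1.
  by under eq_fun do rewrite !mxE; exact: measurable_funB.
have /(ae_eq_integral_abs P measurableT mg).1 :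
    (\int[P]_w `|(fnorm (y w - z w) ^+ 2)%:E| = 0)%E.
  rewrite -[RHS]e; apply: eq_integral => w _.
  by rewrite gee0_abs// lee_fin sqr_ge0.
apply: filterS => w /(_ I)/eqP; rewrite eqe => /eqP yz0.
apply/matrixP => i j; apply/eqP; rewrite eq_sym -subr_eq0 -sqrf_eq0.
rewrite eq_le sqr_ge0 andbT -yz0.
by have := entry_sqr_le (y w - z w) i j; rewrite !mxE.
Qed.

Theorem corollary1
  (R : realType) (disp : measure_display) (Omega : measurableType disp)
  (P : probability Omega R) (T : R) (n d k : nat)
  (W : process (R := R) (Omega := Omega) d 1)
  (U : set 'cV[R]_k)
  (b : R -> 'cV[R]_n -> 'cV[R]_k -> 'cV[R]_n)
  (sigma : R -> 'cV[R]_n -> 'cV[R]_k -> 'M[R]_(n, d))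
  (f : R -> 'cV[R]_n -> 'cV[R]_k -> R)
  (h : 'cV[R]_n -> R)
  (x0 : 'cV[R]_n)
  (T_gt0 : 0 < T)
  (P_complete : measure_is_complete P)
  (W_brownian : brownian_motion P T W)
  (F_right_continuous : right_continuous_filtration T (filtration P W))
  (hA1 : A1 T U b sigma f h)
  (hA2 : A2 T U b sigma f)
  (h_convex : convex_function [set: 'cV[R]_n] h)
  (hx_continuous : continuous (grad h))
  (H_max : max_exists T U b sigma f)
  (hA3 : A3 T U b sigma f)
  (x : process (R := R) (Omega := Omega) n 1)
  (u : process (R := R) (Omega := Omega) k 1)
  (p : process (R := R) (Omega := Omega) n 1)
  (q : process (R := R) (Omega := Omega) n d)
  (p0 : 'cV[R]_n)
  (forward : forward_system T U b sigma f P W x0 p0 x u p q)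
  (H_concave : {ae P, forall w, forall t, 0 <= t <= T ->
     convex_function ([set: 'cV[R]_n] `*` U)
       (fun z : 'cV[R]_n * 'cV[R]_k =>
          - ham b sigma f t z.1 z.2 (p t w) (q t w))})
  (terminal :
     ('E_P[(fun w => (fnorm (- grad h (x T w) - p T w) ^+ 2)%R)] = 0)%E) :
  [/\ extended_hamiltonian_system T U b sigma f h P W x0 x u p q,
      cost_of T b sigma f h P W x0 u (cost T f h P u x) &
      optimal_cost T U b sigma f h P W x0 = cost T f h P u x].
Proof.
have T0 := ltW T_gt0.
have TT : 0 <= T <= T by rewrite T0 lexx.
have [[mb ms mf mh] [L [om [/ltW L0 [om0 _ _ _] [lb ls lf lh]]]]
  [L' [om' [_ om'_modulus [db ds df dh]]]]] := hA1.
have [[U_convex _] _ _] := hA2.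
have [[u_adm x_state [p2 q2] p_eq max_H] p_init] := forward.
have measurable_T (z : process n 1) i : L2F P T W z ->
    measurable_fun setT (fun w => z T w i 0).
  by move=> [az _ _]; exact: (adapted_measurable P_complete W_brownian i 0 TT az).
have [x2 _ _] := x_state.
have terminal_ae : {ae P, forall w, p T w = - grad h (x T w)}.
  apply: expectation_sqr_eq0 terminal => i; last exact: measurable_T.
  (* Continuity of h_x makes h_x(x_T) measurable, as needed to pass from zero expectation to almost
     sure equality. *)
  under eq_fun do rewrite mxE.
  apply: measurableT_comp => //; apply: bmeas_mxP => //.
  apply: (bmeas_comp hx_continuous); apply: bmeas_mx => // j l.
  by rewrite ord1; exact: measurable_T.
split; [exact: conj forward.1 terminal_ae|exact: ex_intro2 x_state erefl|].
apply/le_anti/andP; split.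
  by apply: ereal_inf_lbound; exists u => //; exists x.
apply: le_ereal_inf_tmp => _ [v v_adm [y y_state ->]].
exact: (cost_le T0 P_complete W_brownian L0 om0 om'_modulus mb lb db ms ls ds
  mf lf df mh lh dh h_convex U_convex H_max forward v_adm y_state H_concave
  terminal_ae).
Qed.
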